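(* Let $(R,Y_-,\partial)$ be any vertex Lie algebra over $\mathbb{C}$, and let $\mathcal{V}_h(R)$ be the vertex algebra over $\mathbb{C}[h]$ associated with the vertex Lie algebra $(R[h],hY_-,\partial)$ over $\mathbb{C}[h]$. Then there is a unique vertex algebra isomorphism from $\mathcal{V}(R)$ onto the quotient vertex algebra $\mathcal{V}_h(R)/(h-1)\mathcal{V}_h(R)$ extending the natural map from $R$ to $\mathcal{V}_h(R)/(h-1)\mathcal{V}_h(R)$. The quotient vertex algebra $\mathcal{V}_h(R)/h\mathcal{V}_h(R)$ is commutative, and there is a unique vertex Poisson algebra isomorphism from $S(R)$ onto the vertex Poisson algebra $\mathcal{V}_h(R)/h\mathcal{V}_h(R)$ extending the natural map from $R$ to $\mathcal{V}_h(R)/h\mathcal{V}_h(R)$.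
   Context: Vertex algebra over a unital commutative $\mathbb{C}$-algebra $K$: a $K$-module $V$ with a $K$-linear map $Y:V\to\mathrm{Hom}_K(V,V((x)))$, $v\mapsto Y(v,x)=\sum_{n\in\mathbb{Z}}v_nx^{-n-1}$, and $\mathbf{1}\in V$ such that $Y(\mathbf{1},x)=\mathrm{id}$; $Y(v,x)\mathbf{1}\in V[[x]]$ with $v_{-1}\mathbf{1}=v$; and for $u,v\in V$ $$x_0^{-1}\delta\left(\tfrac{x_1-x_2}{x_0}\right)Y(u,x_1)Y(v,x_2)-x_0^{-1}\delta\left(\tfrac{x_2-x_1}{-x_0}\right)Y(v,x_2)Y(u,x_1)=x_2^{-1}\delta\left(\tfrac{x_1-x_0}{x_2}\right)Y(Y(u,x_0)v,x_2),$$ where $\delta(x)=\sum_{n\in\mathbb{Z}}x^n$ and powers of binomials are expanded in nonnegative powers of the second variable. $V$ is commutative if $[Y(u,x_1),Y(v,x_2)]=0$ for all $u,v$. Quotients of a vertex algebra over $\mathbb{C}[h]$ by $h$ or $h-1$ are regarded as vertex algebras over $\mathbb{C}$. Vertex Lie algebra over $K$: a $K$-module $R$ with a $K$-linear operator $\partial$ and $K$-bilinear products $(a,b)\mapsto a_nb$ ($n\in\mathbb{N}=\{0,1,2,\dots\}$) such that for $a,b,c\in R$, $m,n\in\mathbb{N}$: (C0) $a_nb=0$ for $n$ sufficiently large; (C1) $(\partial a)_nb=-n\,a_{n-1}b$ (which is $0$ for $n=0$); (C2) $a_nb=\sum_{i\ge0}(-1)^{n+i+1}\frac{1}{i!}\partial^i(b_{n+i}a)$;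 (C3) $a_mb_nc-b_na_mc=\sum_{i=0}^m\binom{m}{i}(a_ib)_{m+n-i}c$. One writes $Y_-(a,x)=\sum_{n\ge0}a_nx^{-n-1}$. If $(R,Y_-,\partial)$ is a vertex Lie algebra over $\mathbb{C}$, then, extending $\partial,Y_-$ $\mathbb{C}[h]$-linearly to $R[h]=R\otimes\mathbb{C}[h]$, $(R[h],hY_-,\partial)$ is a vertex Lie algebra over $\mathbb{C}[h]$ (its products are $h\,a_nb$). Vertex Poisson algebra: a unital commutative associative $\mathbb{C}$-algebra $A$ with a derivation $\partial$ and a vertex Lie algebra structure with the same $\partial$ such that each $a_n$ ($a\in A$, $n\ge0$) is a derivation of $A$. An isomorphism of vertex Poisson algebras is a bijective algebra homomorphism commuting with $\partial$ and preserving all products $a_nb$, $n\ge0$. The symmetric algebra $S(R)$ of a vertex Lie algebra $R$ is a vertex Poisson algebra with the unique structure extending $\partial$ and $Y_-$ of $R$. Associated vertex algebra (over $K$): for a vertex Lie algebra $R$ over $K$, $\mathcal{L}(R)=(R\otimes_KK[t,t^{-1}])/\hat\partial(R\otimes_KK[t,t^{-1}])$, $\hat\partial=\partial\otimes1+1\otimes\frac{d}{dt}$, is a Lie algebra over $K$ with, for $a(n)$ the image of $a\otimes t^n$, $[a(m),b(n)]=\sum_{i\ge0}\binom{m}{i}(a_ib)(m+n-i)$; $\mathcal{L}(R)_+$ is spanned by the $a(n)$, $n\ge0$. $\mathcal{V}(R)=U(\mathcal{L}(R))\otimes_{U(\mathcal{L}(R)_+)}K$ ($K$ trivial), $\mathbf{1}=1\otimes1$;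 $R$ embeds via $a\mapsto a(-1)\mathbf{1}$, and $\mathcal{V}(R)$ has a unique vertex algebra structure over $K$ with vacuum $\mathbf{1}$ and $Y(a,x)=\sum_{n\in\mathbb{Z}}a(n)x^{-n-1}$ for $a\in R$. $\mathcal{V}_h(R)$ is this construction for $K=\mathbb{C}[h]$ and $(R[h],hY_-,\partial)$; thus $R\subset R[h]\subset\mathcal{V}_h(R)$, which gives the natural $\mathbb{C}$-linear maps from $R$ to quotients of $\mathcal{V}_h(R)$. If $W$ is a vertex algebra over $\mathbb{C}[h]$ with $\ker_Wh\subset hW$ and $W/hW$ commutative, then $W/hW$ is a vertex Poisson algebra over $\mathbb{C}$ with $(u+hW)\cdot(v+hW)=u_{-1}v+hW$, $\partial(u+hW)=u_{-2}\mathbf{1}+hW$, and $(u+hW)_i(v+hW)=\frac1h u_iv+hW$ for $i\ge0$ (where $\frac1hu_iv$ denotes any $w\in W$ with $hw=u_iv$). This is the vertex Poisson structure on $\mathcal{V}_h(R)/h\mathcal{V}_h(R)$. *)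

(* Defs.v *)
From HB Require Import structures.
From mathcomp Require Import all_boot all_order all_algebra.
From mathcomp Require Import generic_quotient.
From mathcomp Require Import boolp classical_sets functions cardinality fsbigop.
From mathcomp Require Import reals complex.

Set Implicit Arguments.
Unset Strict Implicit.
Unset Printing Implicit Defensive.

Import GRing.Theory.

Local Open Scope classical_set_scope.
Local Open Scope quotient_scope.
Local Open Scope ring_scope.

(* Sums over nat and int of finitely supported families are written with the
   \sum_(i \in A) of fsbigop. It is 0 on an infinite support; the finiteness
   axioms below exclude that case wherever such a sum is used. *)

(* m (m - 1) ... (m - i + 1) / i! *)
Definition binz (m : int) (i : nat) : int :=
  match m with
  | Posz k => 'C(k, i)%:Z
  | Negz k => (-1) ^+ i * 'C(k + i, i)%:Z
  end.

Section FinSupp.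
Variables (I : choiceType) (M : zmodType).

Definition finsupp : {pred I -> M} :=
  fun f => `[< finite_set [set i | f i <> 0] >].

Lemma finsupp_zmod_closed : zmod_closed finsupp.
Proof.
split=> [|f g /asboolP sf /asboolP sg]; apply/asboolP.
  by rewrite (_ : [set _ | _] = set0) //; apply/seteqP; split.
apply: (@sub_finite_set _ _ ([set i | f i <> 0] `|` [set i | g i <> 0])).
  move=> i /= fgi; have [f0|/eqP fN0] := eqVneq (f i) 0; last by left.
  by right=> g0; apply: fgi; rewrite -[LHS]/(f i - g i) f0 g0 subrr.
by rewrite finite_setU.
Qed.

HB.instance Definition _ :=
  GRing.isZmodClosed.Build (I -> M) finsupp finsupp_zmod_closed.

Record fsfam := FsFam { fsval :> I -> M; _ : finsupp fsval }.

HB.instance Definition _ := [isSub for fsval].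
HB.instance Definition _ := [Choice of fsfam by <:].
HB.instance Definition _ := [SubChoice_isSubZmodule of fsfam by <:].

Definition mkfs (f : I -> M) : fsfam := insubd (0 : fsfam) f.

Definition single (i : I) (a : M) : fsfam :=
  mkfs (fun j => if j == i then a else 0).

Lemma mkfsE f : finite_set [set i | f i <> 0] -> mkfs f = f :> (I -> M).
Proof. by move=> sf; rewrite /mkfs -[LHS]/(val _) insubdK//; apply/asboolP. Qed.

Lemma fsvalP (f : fsfam) : finite_set [set i | f i <> 0].
Proof. by apply/asboolP; case: f. Qed.

Lemma fsfamP (f g : fsfam) : (forall i, f i = g i) -> f = g.
Proof. by move=> fg; apply: val_inj; apply: funext. Qed.

End FinSupp.

Section FinSuppLmod.
Variables (K : pzRingType) (I : choiceType) (M : lmodType K).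

Lemma finsupp_submod_closed : submod_closed (@finsupp I M).
Proof.
split=> [|a f g sf sg]; first exact: rpred0.
apply: rpredD sg; apply/asboolP.
apply: (@sub_finite_set _ _ [set i | f i <> 0]); last exact/asboolP.
by move=> i /= afi f0; apply: afi; rewrite -[LHS]/(a *: f i) f0 scaler0.
Qed.

HB.instance Definition _ :=
  GRing.isSubmodClosed.Build K (I -> M) (@finsupp I M) finsupp_submod_closed.
HB.instance Definition _ := [SubZmodule_isSubLmodule of fsfam I M by <:].

End FinSuppLmod.

Section Span.
Variables (K : pzRingType) (M : lmodType K) (S : set M).

Inductive span : set M :=
| span_gen x : S x -> span x
| span_0 : span 0
| span_D x y : span x -> span y -> span (x + y)
| span_Z a x : span x -> span (a *: x).

Lemma span_N x : span x -> span (- x).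
Proof. by move=> sx; rewrite -scaleN1r; apply: span_Z. Qed.

Definition quotm_rel (x y : M) : bool := `[< span (x - y) >].

Lemma quotm_equiv : equiv_class_of quotm_rel.
Proof.
split=> [x|x y|y x z].
- by apply/asboolP; rewrite subrr; apply: span_0.
- by apply/asboolP/asboolP => /span_N; rewrite opprB.
- move=> /asboolP xy /asboolP yz; apply/asboolP.
  by rewrite -(subrKA y); apply: span_D.
Qed.

Canonical quotm_equivRel := EquivRelPack quotm_equiv.

Definition quotm := {eq_quot quotm_rel}.
HB.instance Definition _ := EqQuotient.on quotm.
HB.instance Definition _ := Choice.on quotm.

Lemma quotm_eqP x y : reflect (span (x - y)) (x == y %[mod quotm]).
Proof. by rewrite eqmodE; apply: asboolP. Qed.

Lemma quotm_reprP x : span (repr (\pi_quotm x) - x).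
Proof. by apply/quotm_eqP; rewrite reprK. Qed.

Definition quotm_add (x y : quotm) : quotm := \pi_quotm (repr x + repr y).
Definition quotm_opp (x : quotm) : quotm := \pi_quotm (- repr x).
Definition quotm_scale (a : K) (x : quotm) : quotm := \pi_quotm (a *: repr x).

Lemma pi_add x y : quotm_add (\pi x) (\pi y) = \pi_quotm (x + y).
Proof.
apply/eqP/quotm_eqP; rewrite opprD addrACA.
by apply: span_D; apply: quotm_reprP.
Qed.

Lemma pi_opp x : quotm_opp (\pi x) = \pi_quotm (- x).
Proof.
by apply/eqP/quotm_eqP; rewrite -opprD; apply: span_N; apply: quotm_reprP.
Qed.

Lemma pi_scale a x : quotm_scale a (\pi x) = \pi_quotm (a *: x).
Proof.
by apply/eqP/quotm_eqP; rewrite -scalerBr; apply: span_Z; apply: quotm_reprP.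
Qed.

Lemma quotm_addA : associative quotm_add.
Proof.
by elim/quotW=> x; elim/quotW=> y; elim/quotW=> z; rewrite !pi_add addrA.
Qed.
Lemma quotm_addC : commutative quotm_add.
Proof. by elim/quotW=> x; elim/quotW=> y; rewrite !pi_add addrC. Qed.
Lemma quotm_add0 : left_id (\pi_quotm 0) quotm_add.
Proof. by elim/quotW=> x; rewrite pi_add add0r. Qed.
Lemma quotm_addN : left_inverse (\pi_quotm 0) quotm_opp quotm_add.
Proof. by elim/quotW=> x; rewrite pi_opp pi_add addNr. Qed.

HB.instance Definition _ := GRing.isZmodule.Build quotm
  quotm_addA quotm_addC quotm_add0 quotm_addN.

Lemma quotm_scaleA a b x :
  quotm_scale a (quotm_scale b x) = quotm_scale (a * b) x.
Proof. by elim/quotW: x => x; rewrite !pi_scale scalerA. Qed.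
Lemma quotm_scale1 : left_id 1 quotm_scale.
Proof. by elim/quotW=> x; rewrite pi_scale scale1r. Qed.
Lemma quotm_scaleDr : right_distributive quotm_scale +%R.
Proof.
move=> a; elim/quotW=> x; elim/quotW=> y.
by rewrite -[_ + _]/(quotm_add _ _) -[RHS]/(quotm_add _ _)
  !(pi_add, pi_scale) scalerDr.
Qed.
Lemma quotm_scaleDl x : {morph quotm_scale^~ x : a b / a + b}.
Proof.
move=> a b; elim/quotW: x => x.
by rewrite -[RHS]/(quotm_add _ _) !(pi_add, pi_scale) scalerDl.
Qed.

HB.instance Definition _ := GRing.Zmodule_isLmodule.Build K quotm
  quotm_scaleA quotm_scale1 quotm_scaleDr quotm_scaleDl.

Lemma quotmD x y : \pi_quotm (x + y) = \pi_quotm x + \pi_quotm y.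
Proof. by rewrite -pi_add. Qed.
Lemma quotmZ a x : \pi_quotm (a *: x) = a *: \pi_quotm x.
Proof. by rewrite -pi_scale. Qed.

End Span.

(* W / pW for a module W over C[h] (h is 'X), as a module over C *)
Definition hquot (C : comNzRingType) (W : lmodType {poly C}) (p : {poly C}) :=
  quotm [set p *: w | w in [set: W]].

Section HQuot.
Variables (C : comNzRingType) (W : lmodType {poly C}) (p : {poly C}).

HB.instance Definition _ := GRing.Zmodule.on (hquot W p).

Definition hclass (w : W) : hquot W p := \pi_(hquot W p) w.

Definition hquot_scale (c : C) (x : hquot W p) : hquot W p :=
  (c%:P : {poly C}) *: (x : quotm _).

Lemma hquot_scaleA a b x :
  hquot_scale a (hquot_scale b x) = hquot_scale (a * b) x.
Proof. by rewrite /hquot_scale scalerA polyCM. Qed.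
Lemma hquot_scale1 : left_id 1 hquot_scale.
Proof. by move=> x; rewrite /hquot_scale scale1r. Qed.
Lemma hquot_scaleDr : right_distributive hquot_scale +%R.
Proof. by move=> a x y; rewrite /hquot_scale scalerDr. Qed.
Lemma hquot_scaleDl x : {morph hquot_scale^~ x : a b / a + b}.
Proof. by move=> a b; rewrite /hquot_scale polyCD scalerDl. Qed.

HB.instance Definition _ := GRing.Zmodule_isLmodule.Build C (hquot W p)
  hquot_scaleA hquot_scale1 hquot_scaleDr hquot_scaleDl.

End HQuot.

(* R[h]: the coefficient of h^k in f is f k, and h is 'X. *)

Definition hpoly (C : comNzRingType) (R : lmodType C) := fsfam nat R.

Section HPoly.
Variables (C : comNzRingType) (R : lmodType C).

HB.instance Definition _ := GRing.Zmodule.on (hpoly R).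

Lemma finite_natP (P : nat -> Prop) :
  finite_set [set i | P i] <-> exists N, forall i, (N <= i)%N -> ~ P i.
Proof.
split=> [/finite_seqP[A PA]|[N PN]].
  exists (\max_(i <- A) i).+1 => i Ai Pi.
  have : [set i | P i] i by [].
  rewrite PA => /= iA; move: Ai; rewrite ltnNge.
  by rewrite (@leq_bigmax_seq _ _ xpredT id).
apply: (@sub_finite_set _ _ `I_N); last exact: finite_II.
by move=> i /= Pi; rewrite ltnNge; apply/negP => /PN.
Qed.

Definition hscale (p : {poly C}) (f : hpoly R) : hpoly R :=
  mkfs (fun n => \sum_(i < n.+1) p`_i *: f (n - i)%N).

Lemma hscaleE p f n : hscale p f n = \sum_(i < n.+1) p`_i *: f (n - i)%N.
Proof.
rewrite /hscale mkfsE //; apply/(finite_natP (fun n => _ <> 0)).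
have /(finite_natP (fun n => _ <> 0))[N fN] := fsvalP f.
exists (size p + N)%N => k Nk; apply; rewrite big1 // => i _.
have [pi|ip] := leqP (size p) i; first by rewrite nth_default ?scale0r.
have -> : f (k - i)%N = 0; last by rewrite scaler0.
apply: contrapT; apply: fN; rewrite leq_subRL -1?ltnS //.
by apply: leq_trans Nk; rewrite leq_add2r ltnW.
Qed.

Lemma hscaleEr p f n : hscale p f n = \sum_(i < n.+1) p`_(n - i) *: f i.
Proof.
rewrite hscaleE (reindex_inj rev_ord_inj) /=.
by apply: eq_bigr => i _; rewrite subSS subKn // -ltnS.
Qed.

Lemma hscaleA p q f : hscale p (hscale q f) = hscale (p * q) f.
Proof.
apply: fsfamP => i; rewrite hscaleE hscaleEr.
pose coef3 j k := p`_j *: (q`_(i - j - k) *: f k).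
transitivity (\sum_(j < i.+1) \sum_(k < i.+1 | (k <= i - j)%N) coef3 j k).
  apply: eq_bigr => /= j _; rewrite hscaleEr scaler_sumr /=.
  by rewrite (big_ord_narrow_leq (leq_subr _ _)).
rewrite (exchange_big_dep predT) //=; apply: eq_bigr => k _.
transitivity (\sum_(j < i.+1 | (j <= i - k)%N) coef3 j k).
  apply: eq_bigl => j; rewrite -ltnS -(ltnS j) -!subSn ?leq_ord //.
  by rewrite -subn_gt0 -(subn_gt0 j) -!subnDA addnC.
rewrite (big_ord_narrow_leq (leq_subr _ _)) coefM scaler_suml /=.
by apply: eq_bigr => j _; rewrite /coef3 -!subnDA addnC scalerA.
Qed.

Lemma hscale1 : left_id 1 hscale.
Proof.
move=> f; apply: fsfamP => n; rewrite hscaleE big_ord_recl coef1 scale1r subn0.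
by rewrite big1 ?addr0 // => i _; rewrite coef1 scale0r.
Qed.

Lemma hscaleDr : right_distributive hscale +%R.
Proof.
move=> p f g; apply: fsfamP => n.
rewrite -[RHS]/(hscale p f n + hscale p g n) !hscaleE -big_split /=.
by apply: eq_bigr => i _; rewrite -scalerDr.
Qed.

Lemma hscaleDl f : {morph hscale^~ f : p q / p + q}.
Proof.
move=> p q; apply: fsfamP => n.
rewrite -[RHS]/(hscale p f n + hscale q f n) !hscaleE -big_split /=.
by apply: eq_bigr => i _; rewrite coefD scalerDl.
Qed.

HB.instance Definition _ := GRing.Zmodule_isLmodule.Build {poly C} (hpoly R)
  hscaleA hscale1 hscaleDr hscaleDl.

Definition hconst (a : R) : hpoly R := single 0%N a.

(* the C[h]-linear extensions of a linear and of a bilinear map *)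
Definition hext (del : R -> R) (f : hpoly R) : hpoly R :=
  mkfs (fun k => del (f k)).

Definition hext2 (prd : R -> R -> R) (f g : hpoly R) : hpoly R :=
  mkfs (fun k => \sum_(i < k.+1) prd (f i) (g (k - i)%N)).

End HPoly.

(* palg is the unital associative K-algebra with generators X and relations
   rel. *)

Inductive aterm (K X : Type) :=
| AGen of X
| AConst of K
| AAdd of aterm K X & aterm K X
| AMul of aterm K X & aterm K X.
Arguments AGen {K X}.
Arguments AConst {K X}.
Arguments AAdd {K X}.
Arguments AMul {K X}.

HB.instance Definition _ K X := gen_eqMixin (aterm K X).
HB.instance Definition _ K X := gen_choiceMixin (aterm K X).

Section Presented.
Variables (K : comNzRingType) (X : Type).
Local Notation term := (aterm K X).
Variable rel : term -> term -> Prop.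

(* the least congruence containing rel whose quotient is a K-algebra with
   structure map k |-> AConst k *)
Inductive acong : term -> term -> Prop :=
| acong_rel s t : rel s t -> acong s t
| acong_refl s : acong s s
| acong_sym s t : acong s t -> acong t s
| acong_trans s t u : acong s t -> acong t u -> acong s u
| acong_add s s' t t' : acong s s' -> acong t t' -> acong (AAdd s t) (AAdd s' t')
| acong_mul s s' t t' : acong s s' -> acong t t' -> acong (AMul s t) (AMul s' t')
| acong_addA s t u : acong (AAdd s (AAdd t u)) (AAdd (AAdd s t) u)
| acong_addC s t : acong (AAdd s t) (AAdd t s)
| acong_add0 s : acong (AAdd (AConst 0) s) s
| acong_mulA s t u : acong (AMul s (AMul t u)) (AMul (AMul s t) u)
| acong_1mul s : acong (AMul (AConst 1) s) s
| acong_0mul s : acong (AMul (AConst 0) s) (AConst 0)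
| acong_mulDl s t u : acong (AMul (AAdd s t) u) (AAdd (AMul s u) (AMul t u))
| acong_mulDr s t u : acong (AMul s (AAdd t u)) (AAdd (AMul s t) (AMul s u))
| acong_constD k l : acong (AConst (k + l)) (AAdd (AConst k) (AConst l))
| acong_constM k l : acong (AConst (k * l)) (AMul (AConst k) (AConst l))
| acong_constC k s : acong (AMul (AConst k) s) (AMul s (AConst k)).

Definition acongb (s t : term) : bool := `[< acong s t >].

Lemma acong_equiv : equiv_class_of acongb.
Proof.
split=> [s|s t|t s u].
- by apply/asboolP; apply: acong_refl.
- by apply/asboolP/asboolP; apply: acong_sym.
- move=> /asboolP st /asboolP tu; apply/asboolP; exact: acong_trans tu.
Qed.

Canonical acong_equivRel := EquivRelPack acong_equiv.

Definition palg := {eq_quot acongb}.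
HB.instance Definition _ := EqQuotient.on palg.
HB.instance Definition _ := Choice.on palg.

Lemma palg_eqP s t : reflect (acong s t) (s == t %[mod palg]).
Proof. by rewrite eqmodE; apply: asboolP. Qed.

Lemma palg_reprP s : acong (repr (\pi_palg s)) s.
Proof. by apply/palg_eqP; rewrite reprK. Qed.

Definition pgen (x : X) : palg := \pi_palg (AGen x).
Definition pconst (k : K) : palg := \pi_palg (AConst k).
Definition padd (x y : palg) : palg := \pi_palg (AAdd (repr x) (repr y)).
Definition pmul (x y : palg) : palg := \pi_palg (AMul (repr x) (repr y)).
Definition popp (x : palg) : palg := pmul (pconst (-1)) x.
Definition pscale (k : K) (x : palg) : palg := pmul (pconst k) x.

Lemma pi_padd s t : padd (\pi_palg s) (\pi_palg t) = \pi_palg (AAdd s t).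
Proof. by apply/eqP/palg_eqP; apply: acong_add; apply: palg_reprP. Qed.

Lemma pi_pmul s t : pmul (\pi_palg s) (\pi_palg t) = \pi_palg (AMul s t).
Proof. by apply/eqP/palg_eqP; apply: acong_mul; apply: palg_reprP. Qed.

Lemma paddA : associative padd.
Proof.
elim/quotW=> s; elim/quotW=> t; elim/quotW=> u.
rewrite (pi_padd t) (pi_padd s t) (pi_padd s) (pi_padd _ u).
by apply/eqP/palg_eqP; apply: acong_addA.
Qed.
Lemma paddC : commutative padd.
Proof.
elim/quotW=> s; elim/quotW=> t; rewrite (pi_padd s) (pi_padd t).
by apply/eqP/palg_eqP; apply: acong_addC.
Qed.
Lemma padd0 : left_id (pconst 0) padd.
Proof.
by elim/quotW=> s; rewrite pi_padd; apply/eqP/palg_eqP; apply: acong_add0.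
Qed.
Lemma pmulA : associative pmul.
Proof.
elim/quotW=> s; elim/quotW=> t; elim/quotW=> u.
rewrite (pi_pmul t) (pi_pmul s t) (pi_pmul s) (pi_pmul _ u).
by apply/eqP/palg_eqP; apply: acong_mulA.
Qed.
Lemma p1mul : left_id (pconst 1) pmul.
Proof.
by elim/quotW=> s; rewrite pi_pmul; apply/eqP/palg_eqP; apply: acong_1mul.
Qed.
Lemma p0mul : left_zero (pconst 0) pmul.
Proof.
by elim/quotW=> s; rewrite pi_pmul; apply/eqP/palg_eqP; apply: acong_0mul.
Qed.
Lemma pmulDl : left_distributive pmul padd.
Proof.
elim/quotW=> s; elim/quotW=> t; elim/quotW=> u.
rewrite (pi_padd s) (pi_pmul s) (pi_pmul t) (pi_pmul _ u) (pi_padd _ (AMul t u)).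
by apply/eqP/palg_eqP; apply: acong_mulDl.
Qed.
Lemma pmulDr : right_distributive pmul padd.
Proof.
elim/quotW=> s; elim/quotW=> t; elim/quotW=> u.
rewrite (pi_padd t) (pi_pmul s t) (pi_pmul s u) (pi_pmul s) (pi_padd (AMul s t)).
by apply/eqP/palg_eqP; apply: acong_mulDr.
Qed.
Lemma pconstD k l : pconst (k + l) = padd (pconst k) (pconst l).
Proof. by rewrite pi_padd; apply/eqP/palg_eqP; apply: acong_constD. Qed.
Lemma pconstM k l : pconst (k * l) = pmul (pconst k) (pconst l).
Proof. by rewrite pi_pmul; apply/eqP/palg_eqP; apply: acong_constM. Qed.
Lemma pconstC k x : pmul (pconst k) x = pmul x (pconst k).
Proof.
by elim/quotW: x => s; rewrite !pi_pmul; apply/eqP/palg_eqP; apply: acong_constC.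
Qed.
Lemma pmul1 : right_id (pconst 1) pmul.
Proof. by move=> x; rewrite -pconstC p1mul. Qed.
Lemma paddN : left_inverse (pconst 0) popp padd.
Proof.
by move=> x; rewrite /popp -[X in padd _ X]p1mul -pmulDl -pconstD addNr p0mul.
Qed.

HB.instance Definition _ := GRing.isZmodule.Build palg paddA paddC padd0 paddN.
HB.instance Definition _ := GRing.Zmodule_isPzRing.Build palg
  pmulA p1mul pmul1 pmulDl pmulDr.

Lemma pscaleA a b x : pscale a (pscale b x) = pscale (a * b) x.
Proof. by rewrite /pscale pconstM pmulA. Qed.
Lemma pscaleDr : right_distributive pscale +%R.
Proof. by move=> a x y; apply: pmulDr. Qed.
Lemma pscaleDl x : {morph pscale^~ x : a b / a + b}.
Proof. by move=> a b; rewrite /pscale pconstD; apply: pmulDl. Qed.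

HB.instance Definition _ := GRing.Zmodule_isLmodule.Build K palg
  pscaleA p1mul pscaleDr pscaleDl.

Lemma palg_scalerAl (a : K) (x y : palg) : a *: (x * y) = (a *: x) * y.
Proof. exact: pmulA. Qed.

Lemma palg_scalerAr (a : K) (x y : palg) : a *: (x * y) = x * (a *: y).
Proof.
rewrite -[LHS]/(pmul (pconst a) (pmul x y)) -[RHS]/(pmul x (pmul (pconst a) y)).
by rewrite !pmulA (pconstC a x).
Qed.

Section Eval.
Variables (A : algType K) (f : X -> A).

Fixpoint aeval (t : term) : A :=
  match t with
  | AGen x => f x
  | AConst k => k%:A
  | AAdd s t => aeval s + aeval t
  | AMul s t => aeval s * aeval t
  end.

Lemma aeval_cong : (forall s t, rel s t -> aeval s = aeval t) ->
  forall s t, acong s t -> aeval s = aeval t.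
Proof.
move=> frel s t; elim=> {s t} /=.
- exact: frel.
- by [].
- by [].
- by move=> s t u _ -> _ ->.
- by move=> s s' t t' _ -> _ ->.
- by move=> s s' t t' _ -> _ ->.
- by move=> s t u; rewrite addrA.
- by move=> s t; rewrite addrC.
- by move=> s; rewrite scale0r add0r.
- by move=> s t u; rewrite mulrA.
- by move=> s; rewrite scale1r mul1r.
- by move=> s; rewrite scale0r mul0r.
- by move=> s t u; rewrite mulrDl.
- by move=> s t u; rewrite mulrDr.
- by move=> k l; rewrite scalerDl.
- by move=> k l; rewrite -scalerAl mul1r scalerA.
- by move=> k s; rewrite -scalerAl -scalerAr mul1r mulr1.
Qed.

(* the algebra morphism extending f; meaningful only when f respects rel *)
Definition plift (x : palg) : A := aeval (repr x).

End Eval.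

Lemma palg_nontrivial :
    (forall s t, rel s t -> aeval (fun=> 0 : K^o) s = aeval (fun=> 0 : K^o) t) ->
  (1 : palg) != 0.
Proof.
move=> rel0; apply/negP => /palg_eqP /(aeval_cong rel0) /= /eqP.
by rewrite scale0r scale1r oner_eq0.
Qed.

End Presented.

Section Sym.
Variables (K : comNzRingType) (M : lmodType K).

Inductive sym_rel : aterm K M -> aterm K M -> Prop :=
| sym_relD x y : sym_rel (AGen (x + y)) (AAdd (AGen x) (AGen y))
| sym_relZ k x : sym_rel (AGen (k *: x)) (AMul (AConst k) (AGen x))
| sym_relC s t : sym_rel (AMul s t) (AMul t s).

Definition sym := palg sym_rel.

Lemma sym_mulC : commutative (@pmul _ _ sym_rel).
Proof.
elim/quotW=> s; elim/quotW=> t; rewrite !pi_pmul; apply/eqP/palg_eqP.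
by apply: acong_rel; apply: sym_relC.
Qed.

Lemma sym_nontrivial : (1 : palg sym_rel) != 0.
Proof.
apply: palg_nontrivial => _ _ [x y|k x|s t] /=; last exact: mulrC.
  by rewrite addr0.
by rewrite mulr0.
Qed.

HB.instance Definition _ := GRing.Lmodule.on sym.
HB.instance Definition _ := GRing.PzRing.on sym.
HB.instance Definition _ := GRing.PzSemiRing_isNonZero.Build sym sym_nontrivial.
HB.instance Definition _ := GRing.PzSemiRing_hasCommutativeMul.Build sym sym_mulC.
HB.instance Definition _ := GRing.Lmodule_isLalgebra.Build K sym
  (@palg_scalerAl _ _ sym_rel).
HB.instance Definition _ := GRing.Lalgebra_isAlgebra.Build K sym
  (@palg_scalerAr _ _ sym_rel).

Definition symgen (x : M) : sym := pgen sym_rel x.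

End Sym.

(* U(H) for a Lie subalgebra H of the Lie algebra (L, br) *)
Section Enveloping.
Variables (K : comNzRingType) (L : lmodType K) (br : L -> L -> L) (H : set L).
Local Notation gen := {x : L | H x}.

Inductive uea_rel : aterm K gen -> aterm K gen -> Prop :=
| uea_relD (x y z : gen) : sval z = sval x + sval y ->
    uea_rel (AGen z) (AAdd (AGen x) (AGen y))
| uea_relZ (k : K) (x z : gen) : sval z = k *: sval x ->
    uea_rel (AGen z) (AMul (AConst k) (AGen x))
| uea_relB (x y z : gen) : sval z = br (sval x) (sval y) ->
    uea_rel (AMul (AGen x) (AGen y)) (AAdd (AMul (AGen y) (AGen x)) (AGen z)).

Definition uea := palg uea_rel.

Lemma uea_rel_aug s t : uea_rel s t ->
  aeval (fun=> 0 : K^o) s = aeval (fun=> 0 : K^o) t.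
Proof. by case=> [x y z _|k x z _|x y z _] /=; rewrite ?(addr0, mulr0). Qed.

HB.instance Definition _ := GRing.Lmodule.on uea.
HB.instance Definition _ := GRing.PzRing.on uea.
HB.instance Definition _ :=
  GRing.PzSemiRing_isNonZero.Build uea (palg_nontrivial uea_rel_aug).
HB.instance Definition _ := GRing.Lmodule_isLalgebra.Build K uea
  (@palg_scalerAl _ _ uea_rel).
HB.instance Definition _ := GRing.Lalgebra_isAlgebra.Build K uea
  (@palg_scalerAr _ _ uea_rel).

(* the action of U(H) on the trivial module K, in which H acts by 0 *)
Definition uea_aug (b : uea) : K := plift (A := K^o) (fun=> 0) b.

End Enveloping.

Section UeaIncl.
Variables (K : comNzRingType) (L : lmodType K) (br : L -> L -> L) (H : set L).

Definition ueagen (x : L) : uea br [set: L] := pgen _ (exist _ x Logic.I).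

Definition uea_incl (b : uea br H) : uea br [set: L] :=
  plift (A := uea br [set: L]) (fun x => ueagen (sval x)) b.

End UeaIncl.

(* prd n a b is a_n b. The ring K is meant to contain the rationals (here it
   is C or C[h]), so that i! is a unit of K. *)
Record vertex_lie (K : comUnitRingType) (R : lmodType K)
    (del : R -> R) (prd : nat -> R -> R -> R) : Prop := VertexLie {
  vl_del_linear : linear del;
  vl_linearl : forall n b, linear (fun a => prd n a b);
  vl_linearr : forall n a, linear (prd n a);
  vl_C0 : forall a b, exists N, forall n, (N <= n)%N -> prd n a b = 0;
  vl_C1 : forall n a b, prd n (del a) b = - (prd n.-1 a b *+ n);
  vl_C2 : forall n a b, prd n a b =
    \sum_(i \in [set: nat])
      ((-1) ^+ (n + i + 1) * (i`!%:R)^-1) *: iter i del (prd (n + i)%N b a);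
  vl_C3 : forall m n a b c,
    prd m a (prd n b c) - prd n b (prd m a c) =
    \sum_(i < m.+1) prd (m + n - i)%N (prd i a b) c *+ 'C(m, i)
}.

Section Associated.
Variables (K : comNzRingType) (R : lmodType K).
Variables (del : R -> R) (prd : nat -> R -> R -> R).

(* R (x) K[t, 1/t] is fsfam int R; f stands for the sum of the f n (x) t^n.
   Below, the coefficient of t^n in (del (x) 1 + 1 (x) d/dt) f. *)
Definition hatdel (f : fsfam int R) : fsfam int R :=
  mkfs (fun n => del (f n) + f (n + 1) *~ (n + 1)).

Definition lieL := quotm [set hatdel f | f in [set: fsfam int R]].
HB.instance Definition _ := GRing.Lmodule.on lieL.

(* a(n) *)
Definition lmode (a : R) (n : int) : lieL := \pi_lieL (single n a).

(* the bilinear extension of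
   [a(m), b(n)] = \sum_i binz m i (a_i b)(m + n - i) *)
Definition lie_br (x y : lieL) : lieL :=
  let f := repr x in let g := repr y in
  \sum_(m \in [set: int]) \sum_(n \in [set: int]) \sum_(i \in [set: nat])
    lmode (prd i (f m) (g n)) (m + n - i%:Z) *~ binz m i.

Definition lieLplus : set lieL :=
  span [set x | exists a (n : nat), x = lmode a n%:Z].

Local Notation U := (uea lie_br [set: lieL]).
Local Notation Uplus := (uea lie_br lieLplus).

(* U (x)_(U+) K with K trivial: as u (x) k = (k u) (x) 1, it is the quotient of
   U by the relations u b (x) 1 = u (x) b 1 for b in U+ *)
Definition assocV := quotm [set v : U |
  exists (u : U) (b : Uplus), v = u * uea_incl b - uea_aug b *: u].
HB.instance Definition _ := GRing.Lmodule.on assocV.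

Definition assoc_vac : assocV := \pi_assocV 1.

(* the action of a(n) on assocV *)
Definition assoc_mode (a : R) (n : int) (v : assocV) : assocV :=
  \pi_assocV (ueagen lie_br (lmode a n) * repr v).

Definition assoc_emb (a : R) : assocV := assoc_mode a (-1) assoc_vac.

End Associated.

(* Y u n v is u_n v. The Jacobi identity is stated, after evaluation at w,
   through the coefficients of x_0^(- r - 1) x_1^(- p - 1) x_2^(- q - 1). *)
Record vertex_algebra (K : comNzRingType) (V : lmodType K)
    (Y : V -> int -> V -> V) (vac : V) : Prop := VertexAlgebra {
  va_linearl : forall n v, linear (fun u => Y u n v);
  va_linearr : forall u n, linear (Y u n);
  va_trunc : forall u v, exists N : int, forall n, (N <= n)%R -> Y u n v = 0;
  va_vacuum : forall n v, Y vac n v = if n == -1 then v else 0;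
  va_creation : forall v (n : nat), Y v n%:Z vac = 0;
  va_creationN1 : forall v, Y v (-1) vac = v;
  va_jacobi : forall u v w (p q r : int),
    \sum_(i \in [set: nat])
      Y u (p + r - i%:Z) (Y v (q + i%:Z) w) *~ ((-1) ^+ i * binz r i)
    - \sum_(i \in [set: nat])
        Y v (q + r - i%:Z) (Y u (p + i%:Z) w) *~ ((-1) ^ r * (-1) ^+ i * binz r i)
    = \sum_(i \in [set: nat])
        Y (Y u (r + i%:Z) v) (p + q - i%:Z) w *~ binz p i
}.

Definition va_commutative (V : Type) (Y : V -> int -> V -> V) :=
  forall u v m n w, Y u m (Y v n w) = Y v n (Y u m w).

Record va_iso (K : comNzRingType) (V W : lmodType K)
    (YV : V -> int -> V -> V) (vacV : V) (YW : W -> int -> W -> W) (vacW : W)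
    (f : V -> W) : Prop := VaIso {
  va_iso_linear : linear f;
  va_iso_bij : bijective f;
  va_iso_vac : f vacV = vacW;
  va_iso_Y : forall u n v, f (YV u n v) = YW (f u) n (f v)
}.

(* By uniqueness, the Y satisfying this is the vertex operator of V(R). *)
Record assoc_structure (K : comNzRingType) (R : lmodType K)
    (del : R -> R) (prd : nat -> R -> R -> R)
    (Y : assocV del prd -> int -> assocV del prd -> assocV del prd) : Prop :=
  AssocStructure {
    assoc_va : vertex_algebra Y (assoc_vac del prd);
    assoc_Y : forall a n v, Y (assoc_emb del prd a) n v = assoc_mode a n v
}.

Record vpData (A : Type) := VpData {
  vp_one : A;
  vp_mul : A -> A -> A;
  vp_del : A -> A;
  vp_prd : nat -> A -> A -> A
}.

Record vertex_poisson (C : comUnitRingType) (A : lmodType C) (P : vpData A) :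
    Prop := VertexPoisson {
  vp_mulA : associative (vp_mul P);
  vp_mulC : commutative (vp_mul P);
  vp_mul1 : left_id (vp_one P) (vp_mul P);
  vp_mul_linear : forall a, linear (vp_mul P a);
  vp_lie : vertex_lie (vp_del P) (vp_prd P);
  vp_delM : forall a b, vp_del P (vp_mul P a b) =
    vp_mul P (vp_del P a) b + vp_mul P a (vp_del P b);
  vp_prdM : forall n a b c, vp_prd P n a (vp_mul P b c) =
    vp_mul P (vp_prd P n a b) c + vp_mul P b (vp_prd P n a c)
}.

Record vp_iso (C : comUnitRingType) (A B : lmodType C)
    (P : vpData A) (Q : vpData B) (f : A -> B) : Prop := VpIso {
  vp_iso_linear : linear f;
  vp_iso_bij : bijective f;
  vp_iso_one : f (vp_one P) = vp_one Q;
  vp_iso_mul : forall a b, f (vp_mul P a b) = vp_mul Q (f a) (f b);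
  vp_iso_del : forall a, f (vp_del P a) = vp_del Q (f a);
  vp_iso_prd : forall n a b, f (vp_prd P n a b) = vp_prd Q n (f a) (f b)
}.

(* By uniqueness, the P satisfying this is the vertex Poisson algebra S(R). *)
Record sym_structure (C : comUnitRingType) (R : lmodType C)
    (del : R -> R) (prd : nat -> R -> R -> R) (P : vpData (sym R)) : Prop :=
  SymStructure {
    sym_one : vp_one P = 1;
    sym_mul : vp_mul P = *%R;
    sym_vp : vertex_poisson P;
    sym_del : forall a, vp_del P (symgen a) = symgen (del a);
    sym_prd : forall n a b,
      vp_prd P n (symgen a) (symgen b) = symgen (prd n a b)
}.

Section QuotientVA.
Variables (C : comNzRingType) (W : lmodType {poly C}).
Variables (Y : W -> int -> W -> W) (vac : W).

Definition quotY (p : {poly C}) (x : hquot W p) (n : int) (y : hquot W p) :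
  hquot W p := hclass p (Y (repr x) n (repr y)).

Definition torsion_in_h := forall w : W, 'X *: w = 0 -> exists z, w = 'X *: z.

(* some w such that h w = u *)
Definition hdiv (u : W) : W := xget 0 [set w | 'X *: w = u].

(* the operations of the vertex Poisson algebra W / hW, well defined when
   torsion_in_h holds and W / hW is commutative *)
Definition quot_vp : vpData (hquot W 'X) := {|
  vp_one := hclass 'X vac;
  vp_mul x y := hclass 'X (Y (repr x) (-1) (repr y));
  vp_del x := hclass 'X (Y (repr x) (-2) vac);
  vp_prd i x y := hclass 'X (hdiv (Y (repr x) i%:Z (repr y)))
|}.

End QuotientVA.

(* the vertex Lie algebra (R[h], h Y_-, del) and its associated V_h(R) *)

Section AssocVh.
Variables (C : comNzRingType) (R : lmodType C).
Variables (del : R -> R) (prd : nat -> R -> R -> R).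

Definition hprd (n : nat) (f g : hpoly R) : hpoly R := 'X *: hext2 (prd n) f g.

Definition assocVh := assocV (hext del) hprd.
HB.instance Definition _ := GRing.Lmodule.on assocVh.

Definition assoch_vac : assocVh := assoc_vac (hext del) hprd.
Definition assoch_emb (a : R) : assocVh := assoc_emb (hext del) hprd (hconst a).

End AssocVh.

(* Main.v *)
(* The algebra S(R) and the quotients of V_h(R) and V(R) are compared through
   maps defined on generators, V(R) being the L(R)-module induced from the
   trivial L(R)_+-module.  At h = 1 the maps V(R) -> V_h(R)/(h-1) and
   V_h(R) -> V(R) (with h acting as 1 on V(R)) obtained in this way are inverse
   to each other; they respect all the u_n because R generates V(R) and the
   iterate formula expresses (a_m u)_n through the modes of a and u.  Modulo h
   all a(n) commute, so V_h(R)/h is a commutative vertex algebra generated by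
   the a_{-1}, and S(R) maps onto it.

   Injectivity of this map and the absence of h-torsion both come from a
   Poincare-Birkhoff-Witt theorem over C[h].  No basis is needed in
   characteristic 0: let L be a Lie algebra with a splitting s : R -> L of
   L / L_+ = R.  On S(R) the conditions
     sum_j s(y_j) . (P / y_j) = n P  for P = y_1 ... y_n,
     a . (b . Q) - b . (a . Q) = [a, b] . Q
   determine the action of L by recursion on n, namely
     m (a . P - p(a) P) = sum_j (s(y_j) . l(a, P / y_j) + [a, s(y_j)] . (P / y_j))
   where l(a, Q) = a . Q - p(a) Q, with m = n + 1 for a in s(R) and m = n for a
   in L_+; the commutation relation then follows by induction from the Jacobi
   identity.  The recursion is carried out in dual form, on symmetric
   multilinear functions of words.  It produces a linear map
   V_h(R) -> S(R)[h] whose reduction modulo h inverts S(R) -> V_h(R)/h. *)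

(* The condition sum_j s(y_j) . (P / y_j) = n P makes P the average of the s(y_j) . (P / y_j), so a
   monomial stands for the symmetrized product of the s(y_j) applied to 1; this replaces an ordered
   basis and is where the integers must be invertible. It also explains m. For a in L_+, apply a to
   the condition for P and move it past each s(y_j): this gives the factor n. For a = s(y), use the
   condition for y P, a word of length n + 1.

   The dual form avoids a well-definedness problem: in a presented S(R), a recursion on the factors
   of a monomial would have to respect the relations before its values could be used. A function of
   words exists at once, and its symmetry and multilinearity are proved afterwards. In this notation
   [act (act phi a) b w] is phi (a . (b . w)).

   The products (1/h) u_i v are determined modulo h only in the absence of torsion. Hence S(R) ->
   V_h(R)/h is first treated as a map of commutative algebras and shown bijective, torsion is
   excluded next, and the Poisson products are compared last. *)
Require Import Defs.
From HB Require Import structures.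
From mathcomp Require Import all_boot all_order all_algebra.
From mathcomp Require Import generic_quotient ring zify.
From mathcomp Require Import boolp classical_sets functions cardinality fsbigop.
From mathcomp Require Import reals complex.

Set Implicit Arguments.
Unset Strict Implicit.
Unset Printing Implicit Defensive.

Import GRing.Theory Num.Theory.

Local Open Scope classical_set_scope.
Local Open Scope quotient_scope.
Local Open Scope ring_scope.

(** * Linear identities and finite sums *)

(* Reflexive decision of linear identities with integer coefficients in an
   abelian group. *)
Inductive zexp := ZVar of nat | ZZero | ZAdd of zexp & zexp | ZOpp of zexp
  | ZMuln of zexp & nat.

Fixpoint zeval (V : zmodType) (env : seq V) e : V :=
  match e with
  | ZVar i => nth 0 env i
  | ZZero => 0
  | ZAdd a b => zeval env a + zeval env b
  | ZOpp a => - zeval env a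
  | ZMuln a n => zeval env a *+ n
  end.

Fixpoint zcoef e i : int :=
  match e with
  | ZVar j => (j == i)%:R
  | ZZero => 0
  | ZAdd a b => zcoef a i + zcoef b i
  | ZOpp a => - zcoef a i
  | ZMuln a n => zcoef a i *+ n
  end.

Lemma zevalE (V : zmodType) (env : seq V) e :
  zeval env e = \sum_(i < size env) nth 0 env i *~ zcoef e i.
Proof.
elim: e => /= [j||a -> b ->|a ->|a -> n].
- have [lj|gj] := ltnP j (size env).
    rewrite (bigD1 (Ordinal lj)) //= eqxx big1 ?addr0 // => i ne.
    by rewrite (_ : (j == i) = false) //; apply: contraNF ne => /eqP ji; apply/eqP/val_inj.
  rewrite nth_default // big1 // => i _.
  by rewrite (_ : (j == i) = false) //; apply/eqP => ji; move: gj; rewrite ji leqNgt ltn_ord.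
- by rewrite big1.
- by rewrite -big_split; apply: eq_bigr => i _; rewrite mulrzDr.
- by rewrite -sumrN; apply: eq_bigr => i _; rewrite mulrNz.
- rewrite -sumrMnl; apply: eq_bigr => i _.
  by elim: n => [|n IH]; rewrite ?mulr0n ?mulr0z // !mulrS mulrzDr IH.
Qed.

Lemma zeval_eq (V : zmodType) (env : seq V) e e' :
  all (fun i => zcoef e i == zcoef e' i) (iota 0 (size env)) ->
  zeval env e = zeval env e'.
Proof.
move=> /allP ee; rewrite !zevalE; apply: eq_bigr => i _.
by rewrite (eqP (ee i _)) // mem_iota /=.
Qed.

(* Atoms are compared syntactically, except for the instance arguments of *:
   and of big operators. *)
Ltac zmod_same x y :=
  lazymatch constr:((x, y)) with
  | (?z, ?z) => constr:(true)
  | (@GRing.scale _ _ ?a ?u, @GRing.scale _ _ ?b ?v) =>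
    lazymatch zmod_same a b with
    | true => zmod_same u v
    | false => constr:(false)
    end
  | (@bigop.body _ _ _ ?r ?f, @bigop.body _ _ _ ?r ?g) =>
    match goal with
    | _ => let _ := constr:(erefl f : f = g) in constr:(true)
    | _ => constr:(false)
    end
  | _ => constr:(false)
  end.
Ltac zmod_find x env :=
  lazymatch env with
  | nil => constr:(@None nat)
  | cons ?y ?env' =>
    lazymatch zmod_same x y with
    | true => constr:(Some 0%N)
    | false =>
      lazymatch zmod_find x env' with
      | Some ?i => constr:(Some (S i))
      | None => constr:(@None nat)
      end
    end
  end.
Ltac zmod_atoms env t :=
  lazymatch t with
  | (?a + ?b)%R => let env := zmod_atoms env a in zmod_atoms env b
  | (- ?a)%R => zmod_atoms env a
  | 0%R => env
  | (?a *+ ?n)%R => zmod_atoms env a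
  | _ => lazymatch zmod_find t env with
         | Some _ => env
         | None => constr:(cons t env)
         end
  end.
Ltac zmod_reify env t :=
  lazymatch t with
  | (?a + ?b)%R => let a := zmod_reify env a in let b := zmod_reify env b in
                   constr:(ZAdd a b)
  | (- ?a)%R => let a := zmod_reify env a in constr:(ZOpp a)
  | 0%R => constr:(ZZero)
  | (?a *+ ?n)%R => let a := zmod_reify env a in constr:(ZMuln a n)
  | _ => lazymatch zmod_find t env with Some ?i => constr:(ZVar i) end
  end.
(* The type read off an atom, unlike that of the equation, is in a form from
   which the zmodType structure can be inferred. *)
Ltac zmod_type t :=
  lazymatch t with
  | (?a + ?b)%R => zmod_type a
  | (- ?a)%R => zmod_type a
  | (?a *+ ?n)%R => zmod_type a
  | _ => type of t
  end.
Ltac zmod :=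
  lazymatch goal with |- @eq _ ?x ?y =>
    let V := zmod_type x in
    let env := zmod_atoms (@nil V) x in
    let env := zmod_atoms env y in
    let ex := zmod_reify env x in
    let ey := zmod_reify env y in
    exact: (@zeval_eq _ env ex ey isT)
  end.

Section NatSums.

Lemma fsum_nat (M : zmodType) (F : nat -> M) N :
  (forall i, (N <= i)%N -> F i = 0) ->
  \sum_(i \in [set: nat]) F i = \sum_(i < N) F i.
Proof.
move=> F0; rewrite fsbig_ord; symmetry; apply: fsbig_widen => // i /= [_ /negP].
by rewrite -leqNgt => /F0.
Qed.

Lemma fsum_map (M N : zmodType) (f : M -> N) (F : nat -> M) :
  {morph f : x y / x + y} -> f 0 = 0 ->
  (exists n, forall i, (n <= i)%N -> F i = 0) ->
  f (\sum_(i \in [set: nat]) F i) = \sum_(i \in [set: nat]) f (F i).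
Proof.
move=> fD f0 [n Fn]; rewrite (fsum_nat Fn) (@fsum_nat _ _ n); last first.
  by move=> i /Fn ->.
by rewrite (big_morph f fD f0).
Qed.

(** The hypothesis kills the part of the square with i + j >= N, so square and triangle carry the
    same terms. *)
Lemma sum_triangle (M : zmodType) (G : nat -> nat -> M) N :
  (forall i j, (N <= i + j)%N -> G i j = 0) ->
  \sum_(i < N) \sum_(j < N) G i j =
  \sum_(l < N) \sum_(i < l.+1) G i (l - i)%N.
Proof.
move=> G0.
transitivity (\sum_(i < N) \sum_(l < N | (i <= l)%N) G i (l - i)%N).
  apply: eq_bigr => i _.
  rewrite -(big_mkord xpredT (G i)) -(big_mkord (leq i) (fun l => G i (l - i)%N)).
  rewrite [RHS](@big_cat_nat _ _ _ i) //=; last by apply: ltnW.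
  rewrite [X in _ = X + _]big_nat_cond [X in _ = X + _]big1; last first.
    by move=> l /andP[/andP[_ li] il]; rewrite ltnNge il in li.
  rewrite add0r -{2}[nat_of_ord i]add0n big_addn.
  rewrite (@big_cat_nat _ _ _ (N - i)) //=; last by rewrite leq_subr.
  rewrite [X in _ + X]big_nat_cond [X in _ + X]big1 ?addr0; last first.
    by move=> j /andP[/andP[jN _] _]; apply: G0; rewrite -leq_subLR.
  rewrite [RHS]big_mkcond /=; apply: eq_bigr => j _.
  by rewrite leq_addl addnK.
rewrite (exchange_big_dep predT) //=; apply: eq_bigr => l _.
rewrite -(big_mkord (fun i => i <= l)%N (fun i => G i (l - i)%N)).
rewrite (@big_cat_nat _ _ _ l.+1) //= [X in _ + X]big_nat_cond [X in _ + X]big1.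
  rewrite addr0 big_mkord; apply: eq_bigl => i.
  by rewrite -ltnS ltn_ord.
by move=> i /andP[/andP[li _] il]; rewrite ltnNge il in li.
Qed.

End NatSums.

(** * Additive and linear maps out of finitely supported families *)

Section FsExt.
Variables (I : choiceType) (M N : zmodType).
Implicit Types f g : fsfam I M.

Lemma fsfam0E i : (0 : fsfam I M) i = 0. Proof. by []. Qed.
Lemma fsfamDE f g i : (f + g) i = f i + g i. Proof. by []. Qed.
Lemma fsfamNE f i : (- f) i = - f i. Proof. by []. Qed.

Lemma singleE (i : I) (a : M) j : single i a j = if j == i then a else 0.
Proof.
rewrite /single mkfsE //; apply: (@sub_finite_set _ _ [set i]) => // k /=.
by case: eqP.
Qed.

Lemma singleD (i : I) : {morph @single I M i : a b / a + b}.
Proof.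
move=> a b; apply: fsfamP => j; rewrite fsfamDE !singleE.
by case: eqP => //; rewrite addr0.
Qed.

Lemma single0 (i : I) : @single I M i 0 = 0.
Proof. by apply: fsfamP => j; rewrite singleE if_same. Qed.

Lemma fsfam_sum f : exists r : seq I, [/\ uniq r, forall i, i \notin r -> f i = 0
  & f = \sum_(i <- r) single i (f i)].
Proof.
have /finite_seqP[r fr] := fsvalP f.
have r0 i : i \notin undup r -> f i = 0.
  rewrite mem_undup => ir; apply: contrapT => fi.
  by have : [set i | f i <> 0] i by []; rewrite fr /= (negbTE ir).
exists (undup r); split=> //; first exact: undup_uniq.
apply: fsfamP => j.
rewrite (big_morph (fun f : fsfam I M => f j) (fun f g => fsfamDE f g j) (fsfam0E j)).
have [jr|jr] := boolP (j \in undup r).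
  rewrite (bigD1_seq j) ?undup_uniq //= singleE eqxx big1 ?addr0 // => i ij.
  by rewrite singleE eq_sym (negbTE ij).
rewrite r0 // big1_seq // => i /andP[_ ir]; rewrite singleE.
by case: eqP => // ji; rewrite ji ir in jr.
Qed.

Lemma fsfam_ind (P : fsfam I M -> Prop) :
  P 0 -> (forall f g, P f -> P g -> P (f + g)) -> (forall i a, P (single i a)) ->
  forall f, P f.
Proof. by move=> P0 PD Ps f; have [r [_ _ ->]] := fsfam_sum f; apply: big_ind. Qed.

Definition fsext (Phi : I -> M -> N) f : N := \sum_(i \in [set: I]) Phi i (f i).

Lemma fsextE Phi f (r : seq I) : (forall i, Phi i 0 = 0) ->
  uniq r -> (forall i, i \notin r -> f i = 0) ->
  fsext Phi f = \sum_(i <- r) Phi i (f i).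
Proof.
move=> Phi0 ur fr; rewrite /fsext [RHS]fsbig_seq //.
by symmetry; apply: fsbig_widen => // i [_ /= /negP /fr ->].
Qed.

Lemma fsextD Phi : (forall i, {morph Phi i : a b / a + b}) ->
  {morph fsext Phi : f g / f + g}.
Proof.
move=> PhiD f g.
have Phi0 i : Phi i 0 = 0 by apply: (addrI (Phi i 0)); rewrite -PhiD !addr0.
have [r [_ fr _]] := fsfam_sum f; have [s [_ gs _]] := fsfam_sum g.
have rs (h : fsfam I M) : (forall i, i \notin r -> i \notin s -> h i = 0) ->
    fsext Phi h = \sum_(i <- undup (r ++ s)) Phi i (h i).
  move=> h0; apply: fsextE => //; first exact: undup_uniq.
  by move=> i; rewrite mem_undup mem_cat negb_or => /andP[]; apply: h0.
rewrite (rs f) => [|i /fr //]; rewrite (rs g) => [|i _ /gs //].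
rewrite (rs (f + g)) => [|i /fr fi /gs gi]; last by rewrite fsfamDE fi gi addr0.
by rewrite -big_split; apply: eq_bigr => i _; rewrite fsfamDE PhiD.
Qed.

Lemma fsext_single Phi i a : (forall i, Phi i 0 = 0) ->
  fsext Phi (single i a) = Phi i a.
Proof.
move=> Phi0; rewrite (@fsextE _ _ [:: i]) //; first by rewrite big_seq1 singleE eqxx.
by move=> j; rewrite inE singleE => /negbTE ->.
Qed.

End FsExt.

Section LinearFacts.
Variables (K : pzRingType) (M N : lmodType K) (f : M -> N).
Hypothesis fL : linear f.

Lemma linD : {morph f : x y / x + y}.
Proof. by move=> x y; rewrite -{1}[x]scale1r fL scale1r. Qed.
Lemma lin0 : f 0 = 0.
Proof. by apply: (addrI (f 0)); rewrite -linD !addr0. Qed.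
Lemma linZ a x : f (a *: x) = a *: f x.
Proof. by rewrite -[a *: x]addr0 fL lin0 addr0. Qed.
Lemma linN x : f (- x) = - f x.
Proof. by rewrite -scaleN1r linZ scaleN1r. Qed.
Lemma linB : {morph f : x y / x - y}.
Proof. by move=> x y; rewrite linD linN. Qed.
Lemma lin_sum (I : Type) (r : seq I) (P : pred I) (F : I -> M) :
  f (\sum_(i <- r | P i) F i) = \sum_(i <- r | P i) f (F i).
Proof. exact: (big_morph f linD lin0). Qed.
Lemma linMn x n : f (x *+ n) = f x *+ n.
Proof. by elim: n => [|n IH]; rewrite ?mulr0n ?lin0 // !mulrS linD IH. Qed.
Lemma linMz x (n : int) : f (x *~ n) = f x *~ n.
Proof. by case: n => n; rewrite ?NegzE ?mulrNz ?linN -!pmulrn linMn. Qed.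
Lemma lin_fsum (F : nat -> M) : (exists n, forall i, (n <= i)%N -> F i = 0) ->
  f (\sum_(i \in [set: nat]) F i) = \sum_(i \in [set: nat]) f (F i).
Proof. by apply: fsum_map; [apply: linD|apply: lin0]. Qed.

End LinearFacts.

Lemma scaleCA (K : comPzRingType) (M : lmodType K) (a b : K) (x : M) :
  a *: (b *: x) = b *: (a *: x).
Proof. by rewrite !scalerA mulrC. Qed.

Lemma linear_scale (K : comPzRingType) (M N : lmodType K) (a : K) (f : M -> N) :
  linear f -> linear (fun x => a *: f x).
Proof. by move=> fL k x y; rewrite fL scalerDr scaleCA. Qed.

Lemma linear_sub (K : pzRingType) (M N : lmodType K) (f g : M -> N) :
  linear f -> linear g -> linear (fun x => f x - g x).
Proof. by move=> fL gL a x y; rewrite fL gL scalerBr opprD addrACA. Qed.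

Lemma scalable_add (K : pzRingType) (M N : lmodType K) (F : M -> N) (a b : K) :
  {morph F : x y / x + y} -> (forall x, F (a *: x) = a *: F x) ->
  (forall x, F (b *: x) = b *: F x) -> forall x, F ((a + b) *: x) = (a + b) *: F x.
Proof. by move=> FD Fa Fb x; rewrite !scalerDl FD Fa Fb. Qed.

Lemma scalable_mul (K : pzRingType) (M N : lmodType K) (F : M -> N) (a b : K) :
  (forall x, F (a *: x) = a *: F x) ->
  (forall x, F (b *: x) = b *: F x) -> forall x, F ((a * b) *: x) = (a * b) *: F x.
Proof. by move=> Fa Fb x; rewrite -!scalerA Fa Fb. Qed.

Lemma linear_comp (K : pzRingType) (M N P : lmodType K) (g : N -> P) (f : M -> N) :
  linear g -> linear f -> linear (fun x => g (f x)).
Proof. by move=> gL fL a x y; rewrite fL gL. Qed.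

Lemma linearMz (K : pzRingType) (M N : lmodType K) (f : M -> N) (z : int) :
  linear f -> linear (fun x => f x *~ z).
Proof. by move=> fL a x y; rewrite fL mulrzDl scalerMzr. Qed.

Lemma mulrz_sum (M : zmodType) (x : M) (I : Type) (r : seq I) (P : pred I)
    (F : I -> int) :
  \sum_(i <- r | P i) x *~ F i = x *~ (\sum_(i <- r | P i) F i).
Proof. by rewrite (big_morph _ (mulrzDr x) (mulr0z x)). Qed.

Lemma sumMz (M : zmodType) (I : Type) (r : seq I) (P : pred I) (F : I -> M)
    (z : int) :
  (\sum_(i <- r | P i) F i) *~ z = \sum_(i <- r | P i) F i *~ z.
Proof. by rewrite (big_morph _ (mulrzDl z) (mul0rz _ z)). Qed.

Lemma fsext_linear (K : pzRingType) (I : choiceType) (M N : lmodType K)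
    (Phi : I -> M -> N) :
  (forall i, linear (Phi i)) -> linear (fsext Phi : fsfam I M -> N).
Proof.
move=> PhiL a f g.
rewrite (fsextD (fun i => linD (PhiL i))); congr (_ + _).
have Phi0 i := lin0 (PhiL i).
have [r [ur fr _]] := fsfam_sum f.
rewrite !(fsextE Phi0 ur) //; last first.
  by move=> i /fr fi; rewrite -[LHS]/(a *: f i) fi scaler0.
by rewrite scaler_sumr; apply: eq_bigr => i _; rewrite -(linZ (PhiL i)).
Qed.

Lemma singleZ (K : pzRingType) (I : choiceType) (M : lmodType K) (i : I) (k : K)
  (a : M) : single i (k *: a) = k *: single i a.
Proof.
apply: fsfamP => j; rewrite -[RHS]/(k *: single i a j) !singleE.
by case: eqP => // _; rewrite scaler0.
Qed.

Lemma fsum_linear (K : pzRingType) (A M : lmodType K) (F : A -> nat -> M) :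
  (forall i, linear (F^~ i)) ->
  (forall a, exists n, forall i, (n <= i)%N -> F a i = 0) ->
  linear (fun a => \sum_(i \in [set: nat]) F a i).
Proof.
move=> FL F0 k a b.
have [n Fa] := F0 a; have [m Fb] := F0 b.
rewrite !(@fsum_nat _ _ (maxn n m)).
- by rewrite scaler_sumr -big_split; apply: eq_bigr => i _; apply: FL.
- by move=> i; rewrite geq_max => /andP[_ /Fb].
- by move=> i; rewrite geq_max => /andP[/Fa].
- by move=> i; rewrite geq_max (FL i) => /andP[/Fa -> /Fb ->]; rewrite scaler0 addr0.
Qed.

Lemma sum_narrow (M : zmodType) (F : nat -> M) N P :
  (forall i, (N <= i)%N -> F i = 0) -> (N <= P)%N ->
  \sum_(i < P) F i = \sum_(i < N) F i.
Proof.
move=> F0 NP; rewrite -(fsum_nat F0) -fsum_nat // => i /(leq_trans NP).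
exact: F0.
Qed.

(** In its uses [X i j] is an iterated product in which only the inner index j is bounded uniformly.
    Below that bound finitely many values of j remain, and the maximum of their bounds serves. *)
Lemma bound2 (M : zmodType) (X : nat -> nat -> M) :
  (exists n, forall i j, (n <= j)%N -> X i j = 0) ->
  (forall j, exists n, forall i, (n <= i)%N -> X i j = 0) ->
  exists N, forall i j, (N <= i)%N || (N <= j)%N -> X i j = 0.
Proof.
move=> [n Xn] X0.
have [m Xm] : exists m, forall i j, (j < n)%N -> (m <= i)%N -> X i j = 0.
  elim: n {Xn} => [|n [m Xm]]; first by exists 0%N.
  have [p Xp] := X0 n; exists (maxn m p) => i j.
  rewrite ltnS leq_eqVlt geq_max => /orP[/eqP -> /andP[_ /Xp]//|jn /andP[mi _]].
  exact: Xm.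
exists (maxn n m) => i j; rewrite !geq_max.
have [nj _|jn] := leqP n j; first exact: Xn.
by case/orP=> /andP[ni mi] //; apply: Xm.
Qed.

Lemma fact_unit (K : unitRingType) :
  (forall n : nat, n.+1%:R \is a @GRing.unit K) ->
  forall n : nat, n`!%:R \is a @GRing.unit K.
Proof.
move=> natU; elim=> [|n IH]; first by rewrite unitr1.
rewrite factS natrM unitrM_comm ?natU //; first exact: commr_nat.
Qed.

Section BorcherdsDefect.
Variables (K : comPzRingType) (M : lmodType K) (P : nat -> M -> M -> M).
Hypothesis PLl : forall n y, linear (fun x => P n x y).
Hypothesis PLr : forall n x, linear (P n x).

(** Axiom C3 is the vanishing of this trilinear expression, which can therefore be tested on
    generators of the module. *)
Definition c3_defect m n f g k :=
  P m f (P n g k) - P n g (P m f k) -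
  \sum_(i < m.+1) P (m + n - i)%N (P i f g) k *+ 'C(m, i).

Lemma linear_sumMn (I : Type) (r : seq I) (f : I -> M -> M) (c : I -> nat) :
  (forall i, linear (f i)) -> linear (fun x => \sum_(i <- r) f i x *+ c i).
Proof.
move=> fL a x y; rewrite scaler_sumr -big_split; apply: eq_bigr => i _.
by rewrite fL mulrnDl scalerMnr.
Qed.

Lemma c3_defect_linear1 m n g k : linear (fun f => c3_defect m n f g k).
Proof.
apply: linear_sub; first by apply: linear_sub => //; apply: linear_comp (PLr n g) _.
apply: linear_sumMn => i.
exact: (linear_comp (PLl (m + n - i) k) (PLl i g)).
Qed.

Lemma c3_defect_linear2 m n f k : linear (fun g => c3_defect m n f g k).
Proof.
apply: linear_sub; first by apply: linear_sub => //; apply: linear_comp (PLr m f) _.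
apply: linear_sumMn => i.
exact: (linear_comp (PLl (m + n - i) k) (PLr i f)).
Qed.

Lemma c3_defect_linear3 m n f g : linear (fun k => c3_defect m n f g k).
Proof.
apply: linear_sub; last by apply: linear_sumMn.
by apply: linear_sub; apply: linear_comp.
Qed.

End BorcherdsDefect.

(** * Generalized binomial coefficients *)

Section Binz.

Lemma binz0 m : binz m 0 = 1.
Proof. by case: m => n /=; rewrite bin0 ?expr0 ?mul1r. Qed.

Lemma binzS m i : binz (m + 1) i.+1 = binz m i.+1 + binz m i.
Proof.
case: m => [n|[|n]].
- by rewrite -PoszD addn1 /= binS PoszD.
- by rewrite (_ : Negz 0 + 1 = 0) //= !add0n !binn bin0n exprS mulN1r !mulr1 addNr.
rewrite (_ : Negz n.+1 + 1 = Negz n); last by rewrite !NegzE; lia.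
rewrite /= !addnS !addSn (binS (n + i).+1 i) PoszD exprS; ring.
Qed.

Lemma binz0n i : binz 0 i = (i == 0)%N%:R.
Proof. by case: i. Qed.

Lemma binzN1 i : binz (- 1) i = (-1) ^+ i.
Proof. by rewrite (_ : -1 = Negz 0) //= add0n binn mulr1. Qed.

Lemma binzN2 i : binz (- 2) i = (-1) ^+ i * i.+1%:Z.
Proof. by rewrite (_ : -2 = Negz 1) //= add1n binSn. Qed.

Lemma binz_small (n i : nat) : (n < i)%N -> binz n i = 0.
Proof. by move=> ni; rewrite /= bin_small. Qed.

Lemma int_ind2 (P : int -> Prop) : P 0 -> (forall m, P m <-> P (m + 1)) ->
  forall m, P m.
Proof.
move=> P0 PS; have PN n : P (- n%:Z).
  elim: n => [//|n IH]; apply/PS.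
  by rewrite (_ : - n.+1%:Z + 1 = - n%:Z) //; lia.
case=> n; last by rewrite NegzE.
by elim: n => // n /PS; rewrite -addn1 PoszD.
Qed.

(** Pascal's rule recovers the row of m + 1 from that of m and conversely, so a solution is
    determined by its row m = 0 and its column i = 0. *)
Lemma int_pascal_ext (f g : int -> nat -> int) :
  (forall m, f m 0%N = g m 0%N) -> (forall i, f 0 i.+1 = g 0 i.+1) ->
  (forall m i, f (m + 1) i.+1 = f m i.+1 + f m i) ->
  (forall m i, g (m + 1) i.+1 = g m i.+1 + g m i) ->
  forall m i, f m i = g m i.
Proof.
move=> fg0 f0g fS gS m i; elim: i m => [//|i IH].
apply: int_ind2 => [//|m]; rewrite fS gS IH.
by split=> [->//|/addIr].
Qed.

Lemma binz_mul m i : i.+1%:Z * binz m i.+1 = m * binz (m - 1) i.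
Proof.
have E1 k j : binz k j.+1 = binz (k - 1) j.+1 + binz (k - 1) j.
  by rewrite -binzS subrK.
elim: i m => [|i IH].
  apply: int_ind2 => [|m]; first by rewrite binz0n mul0r mulr0.
  rewrite binzS !binz0 !mulr1 mul1r; split; lia.
apply: int_ind2 => [|m]; first by rewrite binz0n mul0r mulr0.
rewrite binzS addrK [binz m i.+1]E1.
have := IH m; rewrite [binz m i.+1]E1.
have -> : i.+2%:Z = i.+1%:Z + 1 by lia.
move: (binz (m - 1) i.+1) (binz (m - 1) i) (binz m i.+2) (i.+1%:Z) => u v w a.
by move=> H; split=> H'; move: H H'; rewrite !mulrDl !mulrDr !mul1r; lia.
Qed.

Lemma binz_vandermonde m n r :
  \sum_(i < r.+1) binz m i * binz n (r - i)%N = binz (m + n) r.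
Proof.
apply: (int_pascal_ext (f := fun m r => \sum_(i < r.+1) binz m i * binz n (r - i)%N)
   (g := fun m r => binz (m + n) r)) => {m r}.
- by move=> m; rewrite big_ord1 !binz0.
- move=> r; rewrite big_ord_recl big1 => [|i _]; last by rewrite lift0 binz0n mul0r.
  by rewrite binz0 mul1r addr0 add0r subn0.
- move=> m r; rewrite big_ord_recl [in RHS]big_ord_recl /= !binz0 -addrA; congr (_ + _).
  rewrite -big_split; apply: eq_bigr => i _.
  by rewrite subSS binzS mulrDl.
- by move=> m r; rewrite addrAC binzS.
Qed.

(** Compare the coefficients of x^l in (1+x)^k (1 - x/(1+x))^m = (1+x)^(k-m). The proof replaces the
    power series by induction on l and, in both directions, on m. *)
Lemma binz_alternating (m k : int) l :
  \sum_(i < l.+1) (-1) ^+ i * binz m i * binz (k - i%:Z) (l - i)%N = binz (k - m) l.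
Proof.
elim: l k m => [|l IH] k m; first by rewrite big_ord1 subr0 !binz0 expr0 !mul1r.
apply/eqP; rewrite -subr_eq0; apply/eqP.
move: m; apply: int_ind2 => [|m].
  rewrite big_ord_recl big1 => [|i _]; last by rewrite lift0 binz0n mulr0 mul0r.
  by rewrite expr0 binz0 !mul1r !subr0 subn0 subrr.
have E : binz (k - m) l.+1 = binz (k - (m + 1)) l.+1 + binz (k - (m + 1)) l.
  by rewrite -binzS; congr binz; lia.
suff -> : \sum_(i < l.+2) (-1) ^+ i * binz (m + 1) i * binz (k - i%:Z) (l.+1 - i)%N
  = \sum_(i < l.+2) (-1) ^+ i * binz m i * binz (k - i%:Z) (l.+1 - i)%N
    - binz (k - (m + 1)) l.
  by rewrite E; split; lia.
rewrite (_ : k - (m + 1) = (k - 1) - m) -?IH; last by lia.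
rewrite [LHS]big_ord_recl [X in _ = X - _]big_ord_recl !binz0 -addrA; congr (_ + _).
rewrite -sumrB; apply: eq_bigr => i _.
rewrite lift0 subSS binzS exprS.
rewrite (_ : k - 1 - i%:Z = k - i.+1%:Z); last by lia.
ring.
Qed.

Lemma binz_absorb m i l :
  binz m (l + i)%N * binz (l + i)%N l = binz m l * binz (m - l%:Z) i.
Proof.
elim: l m => [|l IH] m; first by rewrite !binz0 subr0 mulr1 mul1r add0n.
(* This nonzero factor, cancelled in the integers, brings the binomials into the form to which
   [binz_mul] applies. *)
have H : l.+1%:Z * (l + i).+1%:Z != 0 by [].
apply: (mulfI H).
transitivity (((l + i).+1%:Z * binz m (l + i).+1) * (l.+1%:Z * binz (l + i).+1%N l.+1)).
  by rewrite addSn; ring.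
rewrite !binz_mul.
have -> : (l + i).+1%:Z - 1 = (l + i)%N by rewrite -addn1 PoszD addrK.
transitivity ((l + i).+1%:Z * m * (binz (m - 1) (l + i) * binz (l + i)%N l)); first by ring.
rewrite IH; have -> : m - 1 - l%:Z = m - l.+1%:Z by lia.
transitivity ((l + i).+1%:Z * (m * binz (m - 1) l) * binz (m - l.+1%:Z) i); first by ring.
by rewrite -binz_mul; ring.
Qed.

End Binz.

(** * The Lie algebra of modes of a vertex Lie algebra *)

Section LoopLie.
Variables (K : comUnitRingType) (R : lmodType K).
Variables (del : R -> R) (prd : nat -> R -> R -> R).
Hypothesis RP : vertex_lie del prd.
Hypothesis natU : forall n : nat, n.+1%:R \is a @GRing.unit K.

Local Notation L := (lieL del).
Local Notation lm := (lmode del).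

Let delL : linear del := vl_del_linear RP.
Let prdLl n b : linear (fun a => prd n a b) := vl_linearl RP n b.
Let prdLr n a : linear (prd n a) := vl_linearr RP n a.

Lemma lmode_linear n : linear (fun a => lm a n).
Proof.
move=> k a b; rewrite /lmode singleD singleZ.
by rewrite -[LHS]/(\pi_(quotm _) _) quotmD quotmZ.
Qed.

Lemma hatdel_single n a :
  hatdel del (single n a) = single n (del a) + single (n - 1) (a *~ n).
Proof.
have H i : del (single n a i) + single n a (i + 1) *~ (i + 1) =
    (single n (del a) + single (n - 1) (a *~ n)) i.
  rewrite fsfamDE !singleE.
  rewrite (_ : (i + 1 == n) = (i == n - 1)); last by rewrite -subr_eq0 -[in RHS]subr_eq0; congr (_ == _); ring.
  congr (_ + _); first by case: eqP => // _; rewrite (lin0 delL).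
  by case: eqP => [->|]; rewrite ?mul0rz // subrK.
apply: fsfamP => i; rewrite /hatdel mkfsE ?H //.
apply: sub_finite_set (fsvalP (single n (del a) + single (n - 1) (a *~ n))) => j /=.
by rewrite H.
Qed.

Lemma hatdel_linear : linear (hatdel del).
Proof.
have HE f i : hatdel del f i = del (f i) + f (i + 1) *~ (i + 1).
  rewrite /hatdel mkfsE //.
  have fs0 := fsvalP f.
  have fs1 : finite_set [set i : int | f (i + 1) <> 0].
    rewrite (_ : [set _ | _] = (fun i : int => i - 1) @` [set i | f i <> 0]); first exact: finite_image.
    apply/seteqP; split=> [j /= fj|_ [j /= fj <-]]; last by rewrite /= subrK.
    by exists (j + 1) => //=; rewrite addrK.
  apply: (@sub_finite_set _ _ ([set i | f i <> 0] `|` [set i : int | f (i + 1) <> 0])); last by rewrite finite_setU.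
  move=> j /= H; have [f0|/eqP fN0] := eqVneq (f j) 0; last by left.
  by right=> g0; apply: H; rewrite f0 g0 (lin0 delL) mul0rz addr0.
move=> k f g; apply: fsfamP => i.
rewrite HE -[RHS]/(k *: hatdel del f i + hatdel del g i) !HE.
rewrite -[(k *: f + g) i]/(k *: f i + g i) -[(k *: f + g) (i + 1)]/(k *: f (i + 1) + g (i + 1)).
by rewrite delL mulrzDl scalerDr scalerMzr addrACA.
Qed.

Lemma lmode_del a n : lm (del a) n = - lm a (n - 1) *~ n.
Proof.
apply/eqP; rewrite mulNrz -addr_eq0; apply/eqP.
rewrite -(linMz (lmode_linear (n - 1))) /lmode.
rewrite -[LHS]/(\pi_(quotm _) _ + \pi_(quotm _) _ : quotm _) -quotmD -hatdel_single.
have /quotm_eqP/eqP : Defs.span [set hatdel del f | f in [set: fsfam int R]] (hatdel del (single n a) - 0).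
  by rewrite subr0; apply: span_gen; exists (single n a).
by move=> ->.
Qed.

Lemma lieL_ind (P : L -> Prop) : P 0 -> (forall x y, P x -> P y -> P (x + y)) ->
  (forall a n, P (lm a n)) -> forall x, P x.
Proof.
move=> P0 PD Pl; elim/quotW => f; elim/fsfam_ind: f => [//|f g Pf Pg|n a]; last exact: Pl.
have -> : \pi_(lieL del) (f + g) = \pi_(lieL del) f + \pi_(lieL del) g by exact: quotmD.
exact: PD.
Qed.

Section Lift.
Variables (M : lmodType K) (Phi : R -> int -> M).
Hypothesis PhiL : forall n, linear (Phi^~ n).
Hypothesis Phidel : forall a n, Phi (del a) n = - Phi a (n - 1) *~ n.

Definition lie_lift (x : L) : M := fsext (fun n a => Phi a n) (repr x).

(** Universal property of L(R): [Phidel] says that the extension of [Phi] kills the image of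
    [hatdel], which by additivity is checked on families with one entry. *)
Lemma lie_liftE f : lie_lift (\pi_(lieL del) f) = fsext (fun n a => Phi a n) f.
Proof.
have extL := fsext_linear (fun n => PhiL n).
apply/eqP; rewrite -subr_eq0 -(linB extL); apply/eqP.
have := quotm_reprP [set hatdel del f | f in [set: fsfam int R]] f.
elim=> [_ [g _ <-]||x y _ Hx _ Hy|k x _ Hx]; last first.
- by rewrite (linZ extL) Hx scaler0.
- by rewrite (linD extL) Hx Hy addr0.
- exact: (lin0 extL).
elim/fsfam_ind: g => [|f1 g Hf Hg|n a].
- by rewrite (lin0 hatdel_linear) (lin0 extL).
- by rewrite (linD hatdel_linear) (linD extL) Hf Hg addr0.
rewrite hatdel_single (linD extL) !fsext_single; try by move=> i; apply: (lin0 (PhiL i)).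
by rewrite Phidel (linMz (PhiL _)) mulNrz addNr.
Qed.

Lemma lie_lift_linear : linear lie_lift.
Proof.
move=> k; elim/quotW => f; elim/quotW => g.
have -> : k *: \pi_(lieL del) f + \pi_(lieL del) g = \pi_(lieL del) (k *: f + g).
  by rewrite -[RHS]/(\pi_(quotm _) _) quotmD quotmZ.
by rewrite !lie_liftE (fsext_linear (fun n => PhiL n)).
Qed.

Lemma lie_lift_lmode a n : lie_lift (lm a n) = Phi a n.
Proof. by rewrite lie_liftE fsext_single // => i; apply: (lin0 (PhiL i)). Qed.

End Lift.


(** The bracket formula on representatives. To descend to [lieL] it must respect [del] in both
    arguments; the second argument is reduced to the first by skew-symmetry. *)
Definition loop_br (a : R) (m : int) (b : R) (n : int) : L :=
  \sum_(i \in [set: nat]) lm (prd i a b) (m + n - i%:Z) *~ binz m i.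

Lemma loop_br_fin a m b n : exists N, forall i, (N <= i)%N ->
  lm (prd i a b) (m + n - i%:Z) *~ binz m i = 0.
Proof.
have [N prd0] := vl_C0 RP a b; exists N => i /prd0 ->.
by rewrite (lin0 (lmode_linear _)) mul0rz.
Qed.

Lemma loop_br_linearl m b n : linear (fun a => loop_br a m b n).
Proof.
apply: fsum_linear => [i|a]; last exact: loop_br_fin.
by apply: linearMz; apply: linear_comp (lmode_linear _) (prdLl _ _).
Qed.

Lemma loop_br_linearr a m n : linear (fun b => loop_br a m b n).
Proof.
apply: fsum_linear => [i|b]; last exact: loop_br_fin.
by apply: linearMz; apply: linear_comp (lmode_linear _) (prdLr _ _).
Qed.

(** Iterating the rule gives a falling factorial of p, written as [j!] times [binz p j]. The family
    is arbitrary because the formula serves for L(R) and for the modes on V_h(R). *)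
Lemma iter_del_modes (M : lmodType K) (Phi : R -> int -> M) :
  (forall a n, Phi (del a) n = - Phi a (n - 1) *~ n) -> forall j a p,
  Phi (iter j del a) p = j`!%:R *: (Phi a (p - j%:Z) *~ ((-1) ^+ j * binz p j)).
Proof.
move=> Phidel; elim=> [|j IH] a p; first by rewrite /= subr0 binz0 expr0 scale1r.
rewrite iterS Phidel IH factS natrM [_.+1%:R * _]mulrC.
rewrite (_ : p - 1 - j%:Z = p - j.+1%:Z); last by lia.
rewrite mulNrz -mulrNz scalerMzr -mulrzA -scalerA; congr (_ *: _).
rewrite scaler_nat pmulrn -mulrzA; congr (_ *~ _).
have := binz_mul p j; rewrite exprS => E.
transitivity (- (-1) ^+ j * (p * binz (p - 1) j)); first by ring.
by rewrite -E; ring.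
Qed.

Lemma lmode_iter j a p :
  lm (iter j del a) p = j`!%:R *: (lm a (p - j%:Z) *~ ((-1) ^+ j * binz p j)).
Proof. exact: iter_del_modes lmode_del j a p. Qed.

(** Axiom C2 seen through modes: the j! produced by j derivatives cancels the 1/j! of C2, and only
    integer coefficients remain. *)
Lemma lmode_skew a b i p : lm (prd i a b) p =
  \sum_(j \in [set: nat]) lm (prd (i + j) b a) (p - j%:Z) *~ (- (-1) ^+ i * binz p j).
Proof.
rewrite (vl_C2 RP) (lin_fsum (lmode_linear _)); last first.
  have [N prd0] := vl_C0 RP b a; exists N => j Nj.
  rewrite prd0; last by apply: leq_trans Nj _; rewrite leq_addl.
  rewrite (_ : iter j del 0 = 0) ?scaler0 //.
  by elim: j {Nj} => //= j ->; rewrite (lin0 delL).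
apply: eq_fsbigr => j _; rewrite (linZ (lmode_linear p)) lmode_iter scalerA.
rewrite -mulrA mulVr ?fact_unit // mulr1.
rewrite (_ : (-1) ^+ (i + j + 1) = ((-1) ^+ (i + j + 1))%:~R); last by rewrite rmorphXn rmorphN1.
rewrite scaler_int -mulrzA !exprD mulrAC; congr (_ *~ _).
have : ((-1) ^+ j * (-1) ^+ j = 1 :> int) by rewrite -expr2 sqrr_sign.
by rewrite expr1 => E; transitivity (- (-1) ^+ i * ((-1) ^+ j * (-1) ^+ j) * binz p j); [ring|rewrite E mulr1].
Qed.

(** Inserting C2 in each term gives a double sum over i and j. Collected along l = i + j, the
    coefficient of (b_l a)(m + n - l) is an alternating convolution, which [binz_alternating]
    evaluates to [- binz n l]. *)
Lemma loop_br_skew a m b n : loop_br a m b n = - loop_br b n a m.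
Proof.
have [N0 ab0] := vl_C0 RP a b; have [N1 ba0] := vl_C0 RP b a.
pose N := maxn N0 N1.
have abN i : (N <= i)%N -> prd i a b = 0 by rewrite geq_max => /andP[/ab0].
have baN i : (N <= i)%N -> prd i b a = 0 by rewrite geq_max => /andP[_ /ba0].
have lm0 p : lm 0 p = 0 := lin0 (lmode_linear p).
rewrite /loop_br !(@fsum_nat _ _ N); last 2 first.
- by move=> i /baN ->; rewrite lm0 mul0rz.
- by move=> i /abN ->; rewrite lm0 mul0rz.
pose G (i j : nat) := lm (prd (i + j) b a) (m + n - (i + j)%N%:Z) *~
   (- ((-1) ^+ i * binz m i * binz (m + n - i%:Z) j)).
transitivity (\sum_(i < N) \sum_(j < N) G i j).
  apply: eq_bigr => i _; rewrite lmode_skew (@fsum_nat _ _ N); last first.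
    move=> j Nj; rewrite baN ?lm0 ?mul0rz //.
    by apply: leq_trans Nj _; rewrite leq_addl.
  rewrite sumMz; apply: eq_bigr => j _; rewrite -mulrzA /G PoszD opprD addrA.
  by congr (_ *~ _); ring.
rewrite sum_triangle => [|i j /baN E]; last by rewrite /G E lm0 mul0rz.
rewrite -sumrN; apply: eq_bigr => l _.
transitivity (\sum_(i < l.+1) lm (prd l b a) (m + n - l%:Z) *~
   (- ((-1) ^+ i * binz m i * binz (m + n - i%:Z) (l - i)%N))).
  by apply: eq_bigr => i _; rewrite /G subnKC // -ltnS.
rewrite mulrz_sum sumrN binz_alternating mulrNz.
by rewrite [n + m]addrC (_ : m + n - m = n) //; ring.
Qed.

Lemma loop_br_dell a m b n : loop_br (del a) m b n = - loop_br a (m - 1) b n *~ m.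
Proof.
have [N ab0] := vl_C0 RP a b.
have lm0 p : lm 0 p = 0 := lin0 (lmode_linear p).
rewrite /loop_br (@fsum_nat _ _ N.+1); last first.
  by move=> [|i] // Ni; rewrite (vl_C1 RP) ab0 // mul0rn oppr0 lm0 mul0rz.
rewrite (@fsum_nat _ _ N) => [|i /ab0 ->]; last by rewrite lm0 mul0rz.
rewrite big_ord_recl (vl_C1 RP) mulr0n oppr0 lm0 mul0rz add0r.
rewrite mulNrz -mulrNz sumMz; apply: eq_bigr => i _.
rewrite lift0 (vl_C1 RP) -mulNrn (linMn (lmode_linear _)) (linN (lmode_linear _)) /=.
rewrite (_ : m + n - i.+1%:Z = m - 1 + n - i%:Z); last by lia.
rewrite pmulrn -mulrzA mulNrz -mulrNz -mulrzA; congr (_ *~ _).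
by rewrite mulNr binz_mul; ring.
Qed.

Lemma loop_br_delr a m b n : loop_br a m (del b) n = - loop_br a m b (n - 1) *~ n.
Proof. by rewrite loop_br_skew loop_br_dell loop_br_skew opprK mulNrz. Qed.

Local Notation br := (@lie_br K R del prd).

Let B1 a m := lie_lift (loop_br a m).

Let B1L a m : linear (B1 a m).
Proof. by apply: lie_lift_linear => *; [apply: loop_br_linearr|apply: loop_br_delr]. Qed.

Let B1_lm a m b n : B1 a m (lm b n) = loop_br a m b n.
Proof. by apply: lie_lift_lmode => *; [apply: loop_br_linearr|apply: loop_br_delr]. Qed.

Let B1Ll m y : linear (fun a => B1 a m y).
Proof.
move=> k a b; elim/lieL_ind: y => [|x y Hx Hy|c n].
- by rewrite !(lin0 (B1L _ _)) scaler0 addr0.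
- by rewrite !(linD (B1L _ _)) Hx Hy scalerDr addrACA.
- by rewrite !B1_lm loop_br_linearl.
Qed.

Let B1del a m y : B1 (del a) m y = - B1 a (m - 1) y *~ m.
Proof.
elim/lieL_ind: y => [|x y Hx Hy|c n].
- by rewrite !(lin0 (B1L _ _)) oppr0 mul0rz.
- by rewrite !(linD (B1L _ _)) Hx Hy opprD mulrzDl.
- by rewrite !B1_lm loop_br_dell.
Qed.

(** The sum over representatives of both arguments is by definition a lift in x of lifts in y, so
    independence of the representatives is inherited from [lie_liftE]. *)
Let lie_brE x y : br x y = lie_lift (fun a m => B1 a m y) x.
Proof. rewrite /B1 /lie_lift /fsext /loop_br /lie_br. reflexivity. Qed.

Lemma lie_br_linearl y : linear (br^~ y).
Proof.
move=> k x x'; rewrite !lie_brE.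
exact: (lie_lift_linear (B1Ll^~ y) (fun a m => B1del a m y)).
Qed.

Lemma lie_br_lmode_l a m y : br (lm a m) y = B1 a m y.
Proof.
by rewrite lie_brE (lie_lift_lmode (B1Ll^~ y) (fun a m => B1del a m y)).
Qed.

Lemma lie_br_lmode a m b n : br (lm a m) (lm b n) = loop_br a m b n.
Proof. by rewrite lie_br_lmode_l B1_lm. Qed.

Lemma lie_br_linearr x : linear (br x).
Proof.
move=> k y z; elim/lieL_ind: x => [|x x' Hx Hx'|a m].
- by rewrite !(lin0 (lie_br_linearl _)) scaler0 addr0.
- by rewrite !(linD (lie_br_linearl _)) Hx Hx' scalerDr addrACA.
- by rewrite !lie_br_lmode_l B1L.
Qed.

Lemma lie_br_skew x y : br x y = - br y x.
Proof.
elim/lieL_ind: x => [|x x' Hx Hx'|a m].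
- by rewrite (lin0 (lie_br_linearl _)) (lin0 (lie_br_linearr _)) oppr0.
- by rewrite (linD (lie_br_linearl _)) (linD (lie_br_linearr _)) Hx Hx' opprD.
elim/lieL_ind: y => [|y y' Hy Hy'|b n].
- by rewrite (lin0 (lie_br_linearl _)) (lin0 (lie_br_linearr _)) oppr0.
- by rewrite (linD (lie_br_linearl _)) (linD (lie_br_linearr _)) Hy Hy' opprD.
by rewrite !lie_br_lmode loop_br_skew.
Qed.


(** Put i = l + s. Then [binz_absorb] turns binom(l+s,l) binom(m,l+s) into binom(m,l) binom(m-l,s),
    and Vandermonde's identity sums over s + j = r. As l and s stay below N, the range N + N
    suffices for i. *)
Lemma jacobi_sum (V : zmodType) (X : nat -> nat -> V) N m n :
  (forall l r, (N <= l)%N || (N <= r)%N -> X l r = 0) ->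
  \sum_(i < N + N) \sum_(j < N + N) \sum_(l < i.+1)
    X l (i + j - l)%N *~ (binz i l * (binz m i * binz n j)) =
  \sum_(l < N) \sum_(r < N) X l r *~ (binz m l * binz (m + n - l%:Z) r).
Proof.
move=> X0; set M := (N + N)%N.
pose G l s j := X l (s + j)%N *~ (binz m l * (binz (m - l%:Z) s * binz n j)).
transitivity (\sum_(l < N) \sum_(s < N) \sum_(j < N) G l s j); last first.
  apply: eq_bigr => l _; rewrite (sum_triangle (G := G l)) => [|s j sj]; last first.
    by rewrite /G X0 ?mul0rz // sj orbT.
  apply: eq_bigr => r _; rewrite addrAC -binz_vandermonde mulr_sumr -mulrz_sum.
  by apply: eq_bigr => s _; rewrite /G subnKC // -ltnS.
transitivity (\sum_(i < M) \sum_(l < M | (l <= i)%N) \sum_(j < M)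
    X l (i + j - l)%N *~ (binz i l * (binz m i * binz n j))).
  apply: eq_bigr => i _; rewrite exchange_big /=.
  rewrite (big_ord_widen M (fun l => \sum_(j < M) X l (i + j - l)%N *~
     (binz i l * (binz m i * binz n j)))) //.
rewrite (exchange_big_dep predT) //=.
pose F l := \sum_(i < M | (l <= i)%N) \sum_(j < M)
  X l (i + j - l)%N *~ (binz i l * (binz m i * binz n j)).
rewrite (sum_narrow (F := F) (N := N)) ?leq_addr // => [|l Nl]; last first.
  by rewrite /F big1 // => i _; rewrite big1 // => j _; rewrite X0 ?Nl // mul0rz.
apply: eq_bigr => l _; rewrite /F.
rewrite -(big_mkord (leq l) (fun i => \sum_(j < M)
  X l (i + j - l)%N *~ (binz i l * (binz m i * binz n j)))).
have lM : (l <= M)%N by apply: leq_trans (leq_addr _ _); apply: ltnW.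
rewrite (@big_cat_nat _ _ _ l) //= big_nat_cond big1 => [|i /andP[/andP[_ il] li]]; last first.
  by rewrite ltnNge li in il.
rewrite add0r.
rewrite -{1}[nat_of_ord l]add0n big_addn big_mkord.
transitivity (\sum_(i < M - l) \sum_(j < N) G l i j).
  apply: eq_big => [i|i _]; first by rewrite leq_addl.
  rewrite -(sum_narrow (P := M)) ?leq_addr // => [|j Nj]; last first.
    by rewrite /G X0 ?mul0rz // (leq_trans Nj (leq_addl _ _)) orbT.
  apply: eq_bigr => j _; rewrite /G addnAC addnK; congr (_ *~ _).
  have := binz_absorb m i l; rewrite [(l + i)%N]addnC => E.
  transitivity (binz m (i + l) * binz (i + l)%N l * binz n j); first by ring.
  by rewrite E; ring.
rewrite (sum_narrow (F := fun i => \sum_(j < N) G l i j) (N := N)) // => [i Ni|].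
  by rewrite big1 // => j _; rewrite /G X0 ?mul0rz // (leq_trans Ni (leq_addr _ _)) orbT.
by rewrite leq_subRL // addnC leq_add2l ltnW.
Qed.

Lemma loop_brE a m b n N : (forall i, (N <= i)%N -> prd i a b = 0) ->
  loop_br a m b n = \sum_(i < N) lm (prd i a b) (m + n - i%:Z) *~ binz m i.
Proof.
move=> ab0; apply: fsum_nat => i /ab0 ->.
by rewrite (lin0 (lmode_linear _)) mul0rz.
Qed.

(** Both iterated brackets on the left are expanded over the same pairs (i, j); C3 applies to the
    coefficient of each pair, and [jacobi_sum] collects the result into the bracket on the right. *)
Lemma lie_br_jacobi_lmode a m b n c k :
  br (lm a m) (br (lm b n) (lm c k)) - br (lm b n) (br (lm a m) (lm c k)) =
  br (br (lm a m) (lm b n)) (lm c k).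
Proof.
have lm0 p : lm 0 p = 0 := lin0 (lmode_linear p).
have boundR a' b' c' : exists N, forall i j, (N <= i)%N || (N <= j)%N ->
    prd i a' (prd j b' c') = 0.
  apply: bound2 => [|j]; last exact: (vl_C0 RP).
  by have [N0 ab0] := vl_C0 RP b' c'; exists N0 => i j /ab0 ->; rewrite (lin0 (prdLr _ _)).
have [N0 H0] := boundR a b c; have [N1 H1] := boundR b a c.
have [N2 H2] : exists N, forall r l, (N <= r)%N || (N <= l)%N ->
    prd r (prd l a b) c = 0.
  apply: bound2 => [|j]; last exact: (vl_C0 RP).
  by have [N' ab0] := vl_C0 RP a b; exists N' => i j /ab0 ->; rewrite (lin0 (prdLl _ _)).
have [Nab Hab] := vl_C0 RP a b; have [Nbc Hbc] := vl_C0 RP b c.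
have [Nac Hac] := vl_C0 RP a c.
pose N := maxn (maxn N0 N1) (maxn N2 (maxn Nab (maxn Nbc Nac))).
have bigN i : (N <= i)%N -> [/\ (N0 <= i)%N, (N1 <= i)%N, (N2 <= i)%N &
    [/\ (Nab <= i)%N, (Nbc <= i)%N & (Nac <= i)%N]].
  by rewrite !geq_max -!andbA => /and5P[-> -> -> -> /andP[-> ->]].
have NM i : (N + N <= i)%N -> (N <= i)%N by apply: leq_trans; rewrite leq_addr.
rewrite !lie_br_lmode (@loop_brE b n c k (N + N)); last by move=> i /NM/bigN[_ _ _ [_ /Hbc]].
rewrite (@loop_brE a m c k (N + N)); last by move=> i /NM/bigN[_ _ _ [_ _ /Hac]].
rewrite (@loop_brE a m b n N); last by move=> i /bigN[_ _ _ [/Hab]].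
rewrite !(lin_sum (lie_br_linearr _)) (lin_sum (lie_br_linearl _)).
transitivity (\sum_(l < N) \sum_(r < N)
  lm (prd r (prd l a b) c) (m + n + k - l%:Z - r%:Z) *~ (binz m l * binz (m + n - l%:Z) r)).
  rewrite -(jacobi_sum (X := fun l r => lm (prd r (prd l a b) c) (m + n + k - l%:Z - r%:Z))); last first.
    by move=> l r lr; rewrite H2 // orbC; apply/orP; case/orP: lr => /bigN[_ _ ? _]; [left|right].
  transitivity (\sum_(i < N + N) \sum_(j < N + N)
     lm (prd i a (prd j b c) - prd j b (prd i a c)) (m + n + k - i%:Z - j%:Z)
       *~ (binz m i * binz n j)).
    rewrite exchange_big /= -sumrB.
    transitivity (\sum_(j < N + N) \sum_(i < N + N) lm (prd i a (prd j b c))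
        (m + n + k - i%:Z - j%:Z) *~ (binz m i * binz n j)
      - \sum_(j < N + N) \sum_(i < N + N) lm (prd i b (prd j a c))
        (m + n + k - j%:Z - i%:Z) *~ (binz m j * binz n i)).
      rewrite -sumrB; apply: eq_bigr => j _; congr (_ - _).
        rewrite (linMz (lie_br_linearr _)) lie_br_lmode (@loop_brE _ _ _ _ (N + N)).
          rewrite sumMz; apply: eq_bigr => i _.
          rewrite -mulrzA (_ : m + (n + k - j%:Z) - i%:Z = m + n + k - i%:Z - j%:Z) //.
          by ring.
        by move=> i /NM/bigN[Ni _ _ _]; rewrite H0 ?Ni.
      rewrite (linMz (lie_br_linearr _)) lie_br_lmode (@loop_brE _ _ _ _ (N + N)).
        rewrite sumMz; apply: eq_bigr => i _.
        rewrite -mulrzA [binz n i * _]mulrC.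
        by rewrite (_ : n + (m + k - j%:Z) - i%:Z = m + n + k - j%:Z - i%:Z) //; ring.
      by move=> i /NM/bigN[_ Ni _ _]; rewrite H1 ?Ni.
    rewrite [X in _ - X]exchange_big -sumrB; apply: eq_bigr => j _.
    rewrite -sumrB; apply: eq_bigr => i _.
    by rewrite (linB (lmode_linear _)) mulrzBl.
  apply: eq_bigr => i _; apply: eq_bigr => j _.
  rewrite (vl_C3 RP) (lin_sum (lmode_linear _)) sumMz; apply: eq_bigr => l _.
  have -> : m + n + k - i%:Z - j%:Z = m + n + k - l%:Z - (i + j - l)%N%:Z.
    have aux (l' i' j' : nat) : (l' <= i')%N -> m + n + k - i'%:Z - j'%:Z =
        m + n + k - l'%:Z - (i' + j' - l')%N%:Z by clear; lia.
    by apply: aux; rewrite -ltnS.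
  by rewrite (linMn (lmode_linear _)) pmulrn -mulrzA.
apply: eq_bigr => l _; rewrite (linMz (lie_br_linearl _)) lie_br_lmode.
rewrite (@loop_brE _ _ _ _ N) => [|i /bigN[_ _ Ni _]]; last by rewrite H2 ?Ni.
rewrite sumMz; apply: eq_bigr => r _; rewrite -mulrzA mulrC.
by rewrite (_ : m + n - l%:Z + k - r%:Z = m + n + k - l%:Z - r%:Z) //; ring.
Qed.

Lemma lie_br_jacobi x y z :
  br x (br y z) - br y (br x z) = br (br x y) z.
Proof.
have brL := lie_br_linearl; have brR := lie_br_linearr.
elim/lieL_ind: x => [|x x' Hx Hx'|a m].
- by rewrite !(lin0 (brL _)) !(lin0 (brR _)) subrr.
- by rewrite !(linD (brL _)) !(linD (brR _)) -Hx -Hx'; zmod.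
elim/lieL_ind: y => [|y y' Hy Hy'|b n].
- by rewrite ?(lin0 (brL _), lin0 (brR _)) subrr.
- by rewrite !(linD (brL _)) !(linD (brR _)) !(linD (brL _)) -Hy -Hy'; zmod.
elim/lieL_ind: z => [|z z' Hz Hz'|c k].
- by rewrite !(lin0 (brR _)) subrr.
- by rewrite !(linD (brR _)) -Hz -Hz'; zmod.
exact: lie_br_jacobi_lmode.
Qed.

(** In L(R) one has a(-k-1) = (1/k!) (del^k a)(-1), whereas a(n) with n >= 0 lies in L_+; this is
    the R-component of a(n) in the splitting of L(R). *)
Definition neg_mode (a : R) (n : int) : R :=
  match n with
  | Posz _ => 0
  | Negz k => (k`!%:R)^-1 *: iter k del a
  end.

Let iter_delL k : linear (iter k del).
Proof. by elim: k => // k IH a x y; rewrite !iterS IH delL. Qed.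

Lemma neg_mode_linear n : linear (neg_mode^~ n).
Proof.
move=> k a b; case: n => n /=; first by rewrite scaler0 addr0.
by rewrite iter_delL scalerDr !scalerA mulrC.
Qed.

Lemma neg_mode_del a n : neg_mode (del a) n = - neg_mode a (n - 1) *~ n.
Proof.
case: n => [[|n]|n]; first by rewrite mulr0z.
  by rewrite (_ : n.+1%:Z - 1 = n%:Z) ?oppr0 ?mul0rz //; lia.
rewrite (_ : Negz n - 1 = Negz n.+1); last by rewrite !NegzE; lia.
rewrite NegzE mulrNz mulNrz opprK /= -iterSr factS natrM.
rewrite invrM ?natU ?fact_unit // -scalerA -pmulrn -scaler_nat !scalerA.
by rewrite [_.+1%:R * _]mulrC mulrVK.
Qed.

Definition lie_proj : L -> R := lie_lift neg_mode.

Lemma lie_proj_linear : linear lie_proj.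
Proof. exact: lie_lift_linear neg_mode_linear neg_mode_del. Qed.

Lemma lie_proj_lmode a n : lie_proj (lm a n) = neg_mode a n.
Proof. exact: lie_lift_lmode neg_mode_linear neg_mode_del a n. Qed.

Lemma lie_proj_lmodeN1 a : lie_proj (lm a (-1)) = a.
Proof. by rewrite lie_proj_lmode /= invr1 scale1r. Qed.

(** With [lie_proj_lmodeN1] and [lie_proj_plus] this splits L(R) as the sum of the a(-1) and of L_+,
    the latter being the kernel of [lie_proj]. *)
Lemma lie_projK x : lieLplus (x - lm (lie_proj x) (-1)).
Proof.
elim/lieL_ind: x => [|x y Hx Hy|a n].
- by rewrite (lin0 lie_proj_linear) (lin0 (lmode_linear _)) subrr; apply: span_0.
- rewrite (linD lie_proj_linear) (linD (lmode_linear _)) opprD addrACA.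
  exact: span_D.
rewrite lie_proj_lmode; case: n => n /=.
  by rewrite (lin0 (lmode_linear _)) subr0; apply: span_gen; exists a, n.
rewrite (linZ (lmode_linear _)) lmode_iter binzN1 -expr2 sqrr_sign mulr1z.
rewrite scalerA mulVr ?fact_unit // scale1r (_ : -1 - n%:Z = Negz n) ?subrr; last first.
  by rewrite NegzE; lia.
exact: span_0.
Qed.

Lemma lie_proj_plus x : lieLplus x -> lie_proj x = 0.
Proof.
elim=> [_ [a [n ->]]||y z _ Hy _ Hz|k y _ Hy]; first by rewrite lie_proj_lmode.
- exact: lin0 lie_proj_linear.
- by rewrite (linD lie_proj_linear) Hy Hz addr0.
- by rewrite (linZ lie_proj_linear) Hy scaler0.
Qed.

Lemma lieLplus_br x y : lieLplus x -> lieLplus y -> lieLplus (br x y).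
Proof.
move=> + Hy; elim=> [_ [a [m ->]]||x' z _ Hx _ Hz|k z _ Hz].
- elim: Hy => [_ [b [n ->]]||y' z _ Hy _ Hz|k z _ Hz].
  + have [N ab0] := vl_C0 RP a b.
    rewrite lie_br_lmode (loop_brE _ _ ab0).
    apply: big_ind => [|u v|i _]; [exact: span_0|exact: span_D|].
    (* The binomial coefficient kills the terms with i > m; for the others m + n - i is a natural
       number. *)
    have [mi|im] := ltnP m i; first by rewrite binz_small // mulr0z; apply: span_0.
    rewrite -scaler_int; apply: span_Z; apply: span_gen.
    by exists (prd i a b), (m + n - i)%N; congr (lm _ _); lia.
  + by rewrite (lin0 (lie_br_linearr _)); apply: span_0.
  + by rewrite (linD (lie_br_linearr _)); apply: span_D.
  + by rewrite (linZ (lie_br_linearr _)); apply: span_Z.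
- by rewrite (lin0 (lie_br_linearl _)); apply: span_0.
- by rewrite (linD (lie_br_linearl _)); apply: span_D.
- by rewrite (linZ (lie_br_linearl _)); apply: span_Z.
Qed.

(** The kernel of [lie_proj] is L_+, a subalgebra. *)
Lemma lie_proj_br x y : lie_proj x = 0 -> lie_proj y = 0 -> lie_proj (br x y) = 0.
Proof.
move=> x0 y0; apply/lie_proj_plus/lieLplus_br.
  by have := lie_projK x; rewrite x0 (lin0 (lmode_linear _)) subr0.
by have := lie_projK y; rewrite y0 (lin0 (lmode_linear _)) subr0.
Qed.

End LoopLie.

(** * Extension of scalars to C[h] *)

Section HPolyFacts.
Variable C : fieldType.
Implicit Types R S T : lmodType C.

Lemma hscale_fE R (p : {poly C}) (f : hpoly R) n :
  (p *: f) n = \sum_(i < n.+1) p`_i *: f (n - i)%N.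
Proof. exact: hscaleE. Qed.

Lemma hpolyDE R (f g : hpoly R) n : (f + g) n = f n + g n.
Proof. by []. Qed.

Lemma hscaleX R (f : hpoly R) n : ('X *: f) n = if n is k.+1 then f k else 0.
Proof.
rewrite hscale_fE big_ord_recl coefX scale0r add0r.
case: n => [|n]; first by rewrite big_ord0.
rewrite big_ord_recl big1 ?addr0 => [|i _]; rewrite coefX !lift0 /=.
  by rewrite subn1 scale1r.
by rewrite scale0r.
Qed.

Lemma hscaleC R (c : C) (f : hpoly R) n : (c%:P *: f) n = c *: f n.
Proof.
rewrite hscale_fE big_ord_recl coefC subn0 big1 ?addr0 // => i _.
by rewrite coefC lift0 scale0r.
Qed.

Lemma hconstE R (a : R) n : hconst a n = if n is 0%N then a else 0.
Proof. by rewrite /hconst singleE; case: n. Qed.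

Lemma hpoly_linear R (M : lmodType {poly C}) (F : hpoly R -> M) :
  {morph F : f g / f + g} -> (forall f, F ('X *: f) = 'X *: F f) ->
  (forall (c : C) f, F (c%:P *: f) = c%:P *: F f) -> linear F.
Proof.
move=> FD FX FC p f g; rewrite FD; congr (_ + _); elim/poly_ind: p f => [|p c IH] f.
  by rewrite (_ : 0 = (0 : C)%:P).
by apply: scalable_add f => // f; apply: scalable_mul.
Qed.

Lemma hconst_linear R (c : C) (a b : R) :
  hconst (c *: a + b) = c%:P *: hconst a + hconst b.
Proof.
apply: fsfamP => n; rewrite hpolyDE hscaleC !hconstE.
by case: n => // n; rewrite scaler0 addr0.
Qed.

Lemma hpoly_split R (f : hpoly R) : exists g, f = hconst (f 0%N) + 'X *: g.
Proof.
have /(finite_natP (fun n => _ <> 0))[N fN] := fsvalP f.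
have gE : finite_set [set n | f n.+1 <> 0].
  by apply/(finite_natP (fun n => _ <> 0)); exists N => i Ni; apply/fN/leqW.
exists (mkfs (fun n => f n.+1) : hpoly R); apply: fsfamP => n.
rewrite hpolyDE hscaleX hconstE; case: n => [|n]; first by rewrite addr0.
by rewrite add0r mkfsE.
Qed.

Lemma hpoly_ind R (P : hpoly R -> Prop) :
  (forall f g, P f -> P g -> P (f + g)) -> (forall f, P f -> P ('X *: f)) ->
  (forall a, P (hconst a)) -> forall f, P f.
Proof.
move=> PD PX Pc f.
have /(finite_natP (fun n => _ <> 0))[N fN] := fsvalP f.
elim: N f fN => [|N IH] f fN.
  suff -> : f = hconst 0 by [].
  apply: fsfamP => n; rewrite hconstE; have := fN n isT.
  by case: n => [|n] /contrapT.
have [g fg] := hpoly_split f; rewrite fg; apply: (PD) => //; apply: PX; apply: IH => i Ni.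
have := fN i.+1 Ni; rewrite {1}fg; apply: contra_not => gi.
by rewrite hpolyDE hscaleX hconstE add0r.
Qed.

(** Constants generate R[h] over C[h]; applied to one argument after another, this reduces
    multilinear identities over R[h] to R. *)
Lemma hpoly_lin0 R (M : lmodType {poly C}) (F : hpoly R -> M) :
  linear F -> (forall a, F (hconst a) = 0) -> forall f, F f = 0.
Proof.
move=> FL F0; elim/hpoly_ind => // [f g Hf Hg|f Hf].
- by rewrite (linD FL) Hf Hg addr0.
- by rewrite (linZ FL) Hf scaler0.
Qed.

Section Conv.
Variables (R S T : lmodType C) (b : R -> S -> T).
Hypothesis bLl : forall y, linear (b^~ y).
Hypothesis bLr : forall x, linear (b x).

(** This is [hext2] for a bilinear map between three different modules; besides the products of R[h]
    it yields the multiplication of S(R)[h] by elements of R[h]. *)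
Definition hconv (f : hpoly R) (g : hpoly S) : hpoly T :=
  mkfs (fun k => \sum_(i < k.+1) b (f i) (g (k - i)%N)).

Lemma hconvE f g k : hconv f g k = \sum_(i < k.+1) b (f i) (g (k - i)%N).
Proof.
rewrite /hconv mkfsE //; apply/(finite_natP (fun n => _ <> 0)).
have /(finite_natP (fun n => _ <> 0))[N fN] := fsvalP f.
have /(finite_natP (fun n => _ <> 0))[M gM] := fsvalP g.
exists (N + M)%N => n Nn; apply; apply: big1 => i _.
have [Ni|iN] := leqP N i; first by rewrite (contrapT (fN i Ni)) (lin0 (bLl _)).
rewrite (contrapT (gM (n - i)%N _)) ?(lin0 (bLr _)) // leq_subRL -1?ltnS //.
by apply: leq_trans Nn; rewrite leq_add2r ltnW.
Qed.

Lemma hconv_linearl g : linear (hconv^~ g).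
Proof.
apply: hpoly_linear => [f f'|f|c f]; apply: fsfamP => n.
- rewrite hpolyDE !hconvE -big_split.
  by apply: eq_bigr => i _; rewrite hpolyDE (linD (bLl _)).
- rewrite hscaleX hconvE big_ord_recl hscaleX (lin0 (bLl _)) add0r.
  case: n => [|n]; first by rewrite big_ord0.
  by rewrite hconvE; apply: eq_bigr => i _; rewrite lift0 hscaleX subSS.
- rewrite hscaleC !hconvE scaler_sumr.
  by apply: eq_bigr => i _; rewrite hscaleC (linZ (bLl _)).
Qed.

Lemma hconv_linearr f : linear (hconv f).
Proof.
apply: hpoly_linear => [g g'|g|c g]; apply: fsfamP => n.
- rewrite hpolyDE !hconvE -big_split.
  by apply: eq_bigr => i _; rewrite hpolyDE (linD (bLr _)).
- rewrite hscaleX hconvE big_ord_recr /= subnn hscaleX (lin0 (bLr _)) addr0.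
  case: n => [|n]; first by rewrite big_ord0.
  rewrite hconvE; apply: eq_bigr => i _; rewrite hscaleX subSn //.
  by rewrite -ltnS.
- rewrite hscaleC !hconvE scaler_sumr.
  by apply: eq_bigr => i _; rewrite hscaleC (linZ (bLr _)).
Qed.

Lemma hconv_const x y : hconv (hconst x) (hconst y) = hconst (b x y).
Proof.
apply: fsfamP => n; rewrite hconvE hconstE; case: n => [|n].
  by rewrite big_ord1 !hconstE.
by apply: big1 => [[[|i] Hi]] _; rewrite !hconstE /= ?(lin0 (bLr _)) ?(lin0 (bLl _)).
Qed.

End Conv.

Section Ext.
Variables (R : lmodType C) (del : R -> R).
Hypothesis delL : linear del.

Lemma hextE f k : hext del f k = del (f k).
Proof.
rewrite /hext mkfsE //; apply: sub_finite_set (fsvalP f) => i /= dfi f0.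
by apply: dfi; rewrite f0 (lin0 delL).
Qed.

Lemma hext_linear : linear (hext del).
Proof.
apply: hpoly_linear => [f g|f|c f]; apply: fsfamP => n.
- by rewrite hpolyDE !hextE hpolyDE (linD delL).
- by rewrite hextE !hscaleX; case: n => [|n]; rewrite ?hextE ?(lin0 delL).
- by rewrite hextE !hscaleC hextE (linZ delL).
Qed.

Lemma hext_const a : hext del (hconst a) = hconst (del a).
Proof.
by apply: fsfamP => n; rewrite hextE !hconstE; case: n => // n; rewrite (lin0 delL).
Qed.

End Ext.

Section HVertexLie.
Variables (R : lmodType C) (del : R -> R) (prd : nat -> R -> R -> R).
Hypothesis RP : vertex_lie del prd.
Hypothesis natC : forall n : nat, n.+1%:R \is a @GRing.unit C.

Let prdLl n b : linear (fun a => prd n a b) := vl_linearl RP n b.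
Let prdLr n a : linear (prd n a) := vl_linearr RP n a.
Let delL : linear del := vl_del_linear RP.

Let hprd_conv n f g : hprd prd n f g = 'X *: hconv (prd n) f g.
Proof. by []. Qed.

Lemma hprd_linearl n g : linear (fun f => hprd prd n f g).
Proof.
exact: (linear_scale 'X (hconv_linearl (prdLl n) (prdLr n) g)).
Qed.

Lemma hprd_linearr n f : linear (hprd prd n f).
Proof.
exact: (linear_scale 'X (hconv_linearr (prdLl n) (prdLr n) f)).
Qed.

Lemma hprd_const n a b : hprd prd n (hconst a) (hconst b) = 'X *: hconst (prd n a b).
Proof. by rewrite hprd_conv (hconv_const (prdLl n) (prdLr n)). Qed.

Lemma hprdE n f g k : hprd prd n f g k =
  if k is k'.+1 then \sum_(i < k) prd n (f i) (g (k' - i)%N) else 0.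
Proof.
rewrite hprd_conv hscaleX; case: k => // k.
by rewrite (hconvE (prdLl n) (prdLr n)).
Qed.

Lemma hprd_C0 f g : exists N, forall n, (N <= n)%N -> hprd prd n f g = 0.
Proof.
elim/hpoly_ind: f g => [f f' Hf Hf'|f Hf|a] g.
- have [N fN] := Hf g; have [M fM] := Hf' g; exists (maxn N M) => n.
  by rewrite geq_max (linD (hprd_linearl _ _)) => /andP[/fN -> /fM ->]; rewrite addr0.
- by have [N fN] := Hf g; exists N => n /fN E; rewrite (linZ (hprd_linearl _ _)) E scaler0.
elim/hpoly_ind: g => [g g' [N gN] [M gM]|g [N gN]|b].
- exists (maxn N M) => n.
  by rewrite geq_max (linD (hprd_linearr _ _)) => /andP[/gN -> /gM ->]; rewrite addr0.
- by exists N => n /gN E; rewrite (linZ (hprd_linearr _ _)) E scaler0.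
have [N abN] := vl_C0 RP a b; exists N => n /abN E.
by rewrite hprd_const E (_ : hconst 0 = 0) ?scaler0 // /hconst single0.
Qed.

(** Compared at each power of h, both sides are finite sums of instances of C2 in R; the convolution
    index is reversed because f and g change places. *)
Lemma hprd_C2 n f g : hprd prd n f g = \sum_(i \in [set: nat])
  ((-1) ^+ (n + i + 1) * (i`!%:R)^-1) *: iter i (hext del) (hprd prd (n + i)%N g f).
Proof.
have iter0 i : iter i (hext del) 0 = 0 by elim: i => //= i ->; rewrite (lin0 (hext_linear delL)).
have iterE i f' k : iter i (hext del) f' k = iter i del (f' k).
  by elim: i => //= i IH; rewrite hextE // IH.
have iterL i : linear (iter i del).
  by elim: i => // i IH x y z; rewrite !iterS IH delL.
have [N0 gfN] := hprd_C0 g f.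
apply: fsfamP => k.
have coefE i : (((-1) ^+ (n + i + 1) * (i`!%:R)^-1) *:
    iter i (hext del) (hprd prd (n + i)%N g f)) k =
    ((-1) ^+ (n + i + 1) * (i`!%:R)^-1 : C) *: iter i del (hprd prd (n + i) g f k).
  rewrite -iterE -hscaleC.
  have -> // : ((-1) ^+ (n + i + 1) * (i`!%:R)^-1 : C)%:P =
    (-1) ^+ (n + i + 1) * (i`!%:R)^-1.
  rewrite polyCM rmorphXn rmorphN1 rmorphV ?fact_unit //.
  by rewrite (rmorph_nat polyC).
transitivity (\sum_(i \in [set: nat]) ((-1) ^+ (n + i + 1) * (i`!%:R)^-1 : C) *:
    iter i del (hprd prd (n + i) g f k)); last first.
  symmetry; apply: etrans; last by apply: eq_fsbigr => i _; apply: coefE.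
  apply: (@fsum_map _ _ (fun h : hpoly R => h k)) => //.
  exists N0 => i Ni; rewrite gfN ?iter0 ?scaler0 //.
  by apply: leq_trans Ni _; rewrite leq_addl.
rewrite hprdE; case: k coefE => [|k] _.
  by rewrite fsbig1 // => i _; rewrite hprdE (lin0 (iterL i)) scaler0.
pose F i (j : 'I_k.+1) := ((-1) ^+ (n + i + 1) * (i`!%:R)^-1 : C) *:
   iter i del (prd (n + i) (g (k - j)%N) (f j)).
rewrite (eq_fsbigr (fun i => \sum_(j < k.+1) F i j)); last first.
  move=> i _; rewrite hprdE (lin_sum (iterL i)) scaler_sumr.
  rewrite (reindex_inj rev_ord_inj) /=; apply: eq_bigr => j _.
  by rewrite /F subSS subKn // -ltnS.
have [N FN] : exists N, forall i j, (N <= i)%N -> F i j = 0.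
  have : forall j, exists N, forall i, (N <= i)%N -> F i j = 0.
    move=> j; have [N fgN] := vl_C0 RP (g (k - j)%N) (f j).
    exists N => i Ni; rewrite /F fgN ?(lin0 (iterL _)) ?scaler0 //.
    by apply: leq_trans Ni _; rewrite leq_addl.
  move=> /choice[N FN]; exists (\max_j N j) => i j Ni; apply: FN.
  by apply: leq_trans Ni; apply: leq_bigmax.
rewrite (fsum_nat (N := N)) => [|i Ni]; last by apply: big1 => j _; apply: FN.
rewrite exchange_big; apply: eq_bigr => j _; rewrite (vl_C2 RP).
by rewrite (fsum_nat (N := N)) // => i Ni; apply: FN.
Qed.

(** On constants every term is a twofold product and carries the same factor h^2, so the identity is
    h^2 times C3 in R. *)
Lemma hprd_C3 m n f g k :
  hprd prd m f (hprd prd n g k) - hprd prd n g (hprd prd m f k) =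
  \sum_(i < m.+1) hprd prd (m + n - i)%N (hprd prd i f g) k *+ 'C(m, i).
Proof.
have Ll := hprd_linearl; have Lr := hprd_linearr.
apply/eqP; rewrite -subr_eq0; apply/eqP.
apply: (hpoly_lin0 (c3_defect_linear1 Ll Lr m n g k)) => a.
apply: (hpoly_lin0 (c3_defect_linear2 Ll Lr m n (hconst a) k)) => b.
apply: (hpoly_lin0 (c3_defect_linear3 Lr m n (hconst a) (hconst b))) => c.
have hcD (x y : R) : hconst (x + y) = hconst x + hconst y :> hpoly R by apply: singleD.
have hcN (x : R) : hconst (- x) = - hconst x :> hpoly R.
  by apply: (addrI (hconst x)); rewrite -hcD !subrr; apply: single0.
have hcMn (x : R) i : hconst (x *+ i) = hconst x *+ i :> hpoly R.
  by elim: i => [|i IH]; [exact: single0|rewrite !mulrS hcD IH].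
have hc_sum (F : 'I_m.+1 -> R) : \sum_(i < m.+1) hconst (F i) = hconst (\sum_(i < m.+1) F i) :> hpoly R.
  by rewrite (big_morph _ hcD (single0 _ _)).
pose X2 (x : hpoly R) : hpoly R := 'X *: ('X *: x).
have X2L : linear X2 by apply: linear_scale; apply: linear_scale.
have H i j x y z : hprd prd i (hprd prd j (hconst x) (hconst y)) (hconst z) =
    X2 (hconst (prd i (prd j x y) z)).
  by rewrite hprd_const (linZ (Ll i _)) hprd_const.
have H' i j x y z : hprd prd i (hconst x) (hprd prd j (hconst y) (hconst z)) =
    X2 (hconst (prd i x (prd j y z))).
  by rewrite hprd_const (linZ (Lr i _)) hprd_const.
rewrite /c3_defect !H' -(linB X2L) -hcN -hcD.
under eq_bigr do rewrite H -(linMn X2L) -hcMn.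
by rewrite -(lin_sum X2L) -(linB X2L) hc_sum (vl_C3 RP) subrr (lin0 X2L).
Qed.

Lemma hvertex_lie : vertex_lie (hext del) (hprd prd).
Proof.
split=> [||||n f g||].
- exact: hext_linear.
- exact: hprd_linearl.
- exact: hprd_linearr.
- exact: hprd_C0.
- have MnE (h : hpoly R) j : (h *+ n) j = h j *+ n.
    by elim: n => // n IH; rewrite !mulrS hpolyDE IH.
  apply: fsfamP => k; rewrite fsfamNE MnE !hprdE.
  case: k => [|k]; first by rewrite mul0rn oppr0.
  rewrite -sumrMnl -sumrN; apply: eq_bigr => i _.
  by rewrite hextE // (vl_C1 RP).
- exact: hprd_C2.
- exact: hprd_C3.
Qed.

End HVertexLie.
End HPolyFacts.

(** * A basis-free Poincare-Birkhoff-Witt theorem *)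

Section RemSums.
Variables (R : eqType) (N : zmodType).
Implicit Types (w v : seq R) (G : R -> seq R -> N).

Lemma perm_rem z w w' : perm_eq w w' -> perm_eq (rem z w) (rem z w').
Proof.
move=> ww'; have [zw|zw] := boolP (z \in w).
  rewrite -(perm_cons z) -(permPl (perm_to_rem zw)) (perm_trans ww') //.
  by rewrite perm_to_rem // -(perm_mem ww').
by rewrite !rem_id // -(perm_mem ww').
Qed.

Lemma perm_swap x y w : perm_eq [:: x, y & w] [:: y, x & w].
Proof. by have := perm_catCA [:: x] [:: y] w [:: y, x & w]; rewrite perm_refl. Qed.

Lemma sum_rem_perm G w w' : (forall z v v', perm_eq v v' -> G z v = G z v') ->
  perm_eq w w' -> \sum_(z <- w) G z (rem z w) = \sum_(z <- w') G z (rem z w').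
Proof.
move=> GP ww'; rewrite (perm_big _ ww') /=; apply: eq_bigr => z _.
by apply: GP; apply: perm_rem.
Qed.

(** For a letter z of w equal to y, [rem z (y :: w)] is w and not [y :: rem z w]; the two are
    permutations of each other, which [G] does not distinguish. *)
Lemma sum_rem_cons G y w : (forall z v v', perm_eq v v' -> G z v = G z v') ->
  \sum_(z <- y :: w) G z (rem z (y :: w)) =
  G y w + \sum_(z <- w) G z (y :: rem z w).
Proof.
move=> GP; rewrite big_cons /= eqxx; congr (_ + _); apply: eq_big_seq => z zw.
by case: eqP => // ->; apply: GP; apply: perm_to_rem.
Qed.

(** Both sides run over the ordered pairs of distinct positions in w; the two positions exchange
    their roles. *)
Lemma sum_rem_swap (G : R -> R -> seq R -> N) w :
  (forall z z' v v', perm_eq v v' -> G z z' v = G z z' v') ->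
  \sum_(z <- w) \sum_(z' <- rem z w) G z z' (rem z' (rem z w)) =
  \sum_(z <- w) \sum_(z' <- rem z w) G z' z (rem z' (rem z w)).
Proof.
elim: w G => [|y w IH] G GP; first by rewrite !big_nil.
have consE (H : R -> R -> seq R -> N) :
    (forall z z' v v', perm_eq v v' -> H z z' v = H z z' v') ->
  \sum_(z <- y :: w) \sum_(z' <- rem z (y :: w)) H z z' (rem z' (rem z (y :: w))) =
  \sum_(z <- w) H y z (rem z w) + (\sum_(z <- w) H z y (rem z w) +
  \sum_(z <- w) \sum_(z' <- rem z w) H z z' (y :: rem z' (rem z w))).
  move=> HP; rewrite (sum_rem_cons (G := fun z v => \sum_(z' <- v) H z z' (rem z' v))).
    congr (_ + _); rewrite -big_split; apply: eq_bigr => z _.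
    by rewrite (sum_rem_cons (G := H z)) // => z' v v'; apply: HP.
  by move=> z v v' vv'; apply: sum_rem_perm => // z' u u'; apply: HP.
rewrite (consE G) // (consE (fun z z' => G z' z)) => [|z z' v v']; last exact: GP.
rewrite (IH (fun z z' v => G z z' (y :: v))) => [|z z' v v' vv']; first exact: addrCA.
by apply: GP; rewrite perm_cons.
Qed.

End RemSums.

(** * The action of a split Lie algebra on symmetric multilinear functions *)

Section PBW.
Variables (K : comUnitRingType) (L R N : lmodType K).
Hypothesis natU : forall n : nat, n.+1%:R \is a @GRing.unit K.
Variables (br : L -> L -> L) (p : L -> R) (s : R -> L).
Hypotheses (brLl : forall y, linear (br^~ y)) (brLr : forall x, linear (br x)).
Hypothesis brN : forall x y, br x y = - br y x.
Hypothesis brJ : forall x y z, br x (br y z) - br y (br x z) = br (br x y) z.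
Hypotheses (pL : linear p) (sL : linear s) (sK : cancel s p).
Hypothesis p_br : forall x y, p x = 0 -> p y = 0 -> p (br x y) = 0.

Implicit Types (phi psi : seq R -> N) (w v : seq R) (x y z : R) (a b c : L).

(** Such functions are the linear maps from the symmetric algebra of R to N, given by their values
    on monomials; by symmetry, linearity in the first letter is linearity in every letter. *)
Definition symlin phi :=
  (forall w w', perm_eq w w' -> phi w = phi w') /\
  (forall w, linear (fun x => phi (x :: w))).

(* The two cases m = n + 1 on s(R) and m = n on ker p of the recursion, with
   1/m absorbed in the Lie algebra element; for n = 0 it is applied to an empty
   sum only. *)
Definition rescale n a : L :=
  (n.+1%:R : K)^-1 *: s (p a) + (n%:R : K)^-1 *: (a - s (p a)).

(* k bounds the recursion depth: the value is the intended one on words of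
   length at most k. In dual notation phi.a is act phi a, and corr phi a w
   stands for phi (l (a, w)). *)
Fixpoint corrk k phi a w : N :=
  if k is k'.+1 then
    \sum_(z <- w)
      (corrk k' (fun v => phi (z :: v) + corrk k' phi (s z) v)
         (rescale (size w) a) (rem z w)
       + (phi (p (br (rescale (size w) a) (s z)) :: rem z w)
          + corrk k' phi (br (rescale (size w) a) (s z)) (rem z w)))
  else 0.

Definition corr phi a w : N := corrk (size w) phi a w.

Definition act phi a w : N := phi (p a :: w) + corr phi a w.

Lemma rescale_linear n : linear (rescale n).
Proof.
move=> k a b; rewrite /rescale pL sL !(scalerDr, scalerN, opprD) !(scaleCA k).
by zmod.
Qed.

Lemma corrk_linear k (c : K) phi psi a w :
  corrk k (fun v => c *: phi v + psi v) a w = c *: corrk k phi a w + corrk k psi a w.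
Proof.
elim: k phi psi a w => [|k IH] phi psi a w /=; first by rewrite scaler0 addr0.
rewrite scaler_sumr -big_split; apply: eq_bigr => z _ /=; rewrite !scalerDr !IH.
have -> : (fun v => c *: phi (z :: v) + psi (z :: v) +
    corrk k (fun v => c *: phi v + psi v) (s z) v) =
  (fun v => c *: (phi (z :: v) + corrk k phi (s z) v) +
            (psi (z :: v) + corrk k psi (s z) v)).
  by apply: funext => v; rewrite IH scalerDr; zmod.
by rewrite IH; zmod.
Qed.

(** All properties go through one induction: the recursive call is made on [psi z], which must again
    be symmetric and multilinear, and linearity in the removed letter z uses linearity in the Lie
    algebra element. *)
Lemma corrk_facts k phi : symlin phi ->
  (forall a, symlin (corrk k phi a)) /\ (forall w, linear (fun a => corrk k phi a w)).
Proof.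
elim: k phi => [|k IH] phi phiS.
  by split=> [a|w c a b /=]; [split=> // w c x y /=|]; rewrite scaler0 addr0.
have [corS corL] := IH _ phiS; have [phiP phiL] := phiS.
pose psi z v := phi (z :: v) + corrk k phi (s z) v.
have psiL v : linear (psi^~ v).
  by move=> c x y; rewrite /psi phiL sL corL scalerDr addrACA.
have psiS z : symlin (psi z).
  split=> [w w' ww'|w c x y]; rewrite /psi.
    by rewrite (phiP _ (z :: w')) ?perm_cons // (proj1 (corS _) _ _ ww').
  have sw u : phi [:: z, u & w] = phi [:: u, z & w] by exact/phiP/perm_swap.
  by rewrite !sw phiL (proj2 (corS _)) !scalerDr; zmod.
pose G a z v := corrk k (psi z) a v +
   (phi (p (br a (s z)) :: v) + corrk k phi (br a (s z)) v).
have GP a z v v' : perm_eq v v' -> G a z v = G a z v'.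
  move=> vv'; rewrite /G (proj1 (proj1 (IH _ (psiS z)) a) _ _ vv').
  by rewrite (proj1 (corS _) _ _ vv') (phiP _ (p (br a (s z)) :: v')) ?perm_cons.
have GLa z v : linear (fun a => G a z v).
  move=> c a b; rewrite /G (proj2 (IH _ (psiS z))) brLl pL phiL corL !scalerDr.
  by zmod.
have GLv a z v : linear (fun y => G a z (y :: v)).
  move=> c x y; rewrite /G (proj2 (proj1 (IH _ (psiS z)) _)) (proj2 (corS _)).
  have sw u : phi [:: p (br a (s z)), u & v] = phi [:: u, p (br a (s z)) & v].
    exact/phiP/perm_swap.
  by rewrite !sw phiL !scalerDr; zmod.
have GLz a v : linear (fun z => G a z v).
  move=> c x y; rewrite /G.
  have -> : psi (c *: x + y) = (fun v => c *: psi x v + psi y v).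
    by apply: funext => u; apply: psiL.
  by rewrite corrk_linear sL brLr pL phiL corL !scalerDr; zmod.
have corE a w : corrk k.+1 phi a w = \sum_(z <- w) G (rescale (size w) a) z (rem z w).
  by [].
split=> [a|w c a b]; last first.
  rewrite !corE scaler_sumr -big_split; apply: eq_bigr => z _.
  by rewrite rescale_linear GLa.
split=> [w w' ww'|w c x y].
  rewrite !corE (perm_size ww'); apply: sum_rem_perm => // z v v'; exact: GP.
rewrite !corE !(sum_rem_cons _ _ (GP _)) GLz ![size (_ :: _)]/=.
under eq_bigr do rewrite GLv.
by rewrite big_split /= -scaler_sumr !scalerDr; zmod.
Qed.

(** Each step of the recursion removes a letter before one is put back, so [phi] is read only on
    words no longer than w, and as many steps as w has letters exhaust the recursion. *)
Lemma corrk_stable k k' phi psi a w : (size w <= k)%N -> (size w <= k')%N ->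
  (forall v, (size v <= size w)%N -> phi v = psi v) ->
  corrk k phi a w = corrk k' psi a w.
Proof.
elim: k k' phi psi a w => [|k IH] k' phi psi a w.
  by rewrite leqn0 size_eq0 => /eqP -> _ _; case: k' => [|k'] //=; rewrite big_nil.
case: k' => [|k'].
  by move=> _; rewrite leqn0 size_eq0 => /eqP -> _ /=; rewrite big_nil.
move=> wk wk' pp /=; apply: eq_big_seq => z zw.
have sr : (size (rem z w)).+1 = size w.
  by rewrite size_rem // prednK //; case: w zw {wk wk' pp}.
have rk : (size (rem z w) <= k)%N by rewrite -ltnS sr.
have rk' : (size (rem z w) <= k')%N by rewrite -ltnS sr.
rewrite pp /= ?sr // (IH k' phi psi) // => [|v vr]; last by rewrite pp // -sr ltnW.
congr (_ + _); apply: (IH) => // v vr.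
rewrite pp ?[size _]/= -?sr ?ltnS //; congr (_ + _); apply: IH => //.
- exact: leq_trans vr rk.
- exact: leq_trans vr rk'.
- by move=> u uv; rewrite pp // -sr; apply: leq_trans (leq_trans uv vr) _.
Qed.

Lemma corr_ext phi psi a w :
  (forall v, (size v <= size w)%N -> phi v = psi v) -> corr phi a w = corr psi a w.
Proof. by move=> pp; apply: corrk_stable. Qed.

Lemma size_rem_lt z w : z \in w -> (size (rem z w) < size w)%N.
Proof. by move=> zw; rewrite size_rem // prednK //; case: w zw. Qed.

Lemma corr_rec phi a w : corr phi a w = \sum_(z <- w)
  (corr (act phi (s z)) (rescale (size w) a) (rem z w) +
   act phi (br (rescale (size w) a) (s z)) (rem z w)).
Proof.
rewrite {1}/corr; case sw : (size w) => [|n].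
  by rewrite (size0nil sw) big_nil.
rewrite /= sw; apply: eq_big_seq => z zw.
have sr : size (rem z w) = n by rewrite size_rem // sw.
congr (_ + _); last by rewrite /act /corr sr.
rewrite /corr sr; apply: corrk_stable; rewrite ?sr // => v vn.
rewrite /act sK /corr; congr (_ + _); apply: corrk_stable => //.
Qed.

Lemma corr_linear_fun (c : K) phi psi a w :
  corr (fun v => c *: phi v + psi v) a w = c *: corr phi a w + corr psi a w.
Proof. exact: corrk_linear. Qed.

Lemma corr_symlin phi a : symlin phi -> symlin (corr phi a).
Proof.
move=> phiS; have facts k := proj1 (corrk_facts k phiS) a.
split=> [w w' ww'|w c x y]; last exact: (proj2 (facts _)).
by rewrite /corr (perm_size ww'); apply: (proj1 (facts _)).
Qed.

Lemma corr_linear phi w : symlin phi -> linear (fun a => corr phi a w).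
Proof. by move=> phiS; apply: (proj2 (corrk_facts _ phiS)). Qed.

Lemma symlin_swap phi x y w : symlin phi -> phi [:: x, y & w] = phi [:: y, x & w].
Proof.
by case=> phiP _; exact/phiP/perm_swap.
Qed.

Lemma symlin0 phi w : symlin phi -> phi (0 :: w) = 0.
Proof. by case=> _ phiL; apply: (lin0 (phiL w)). Qed.

Lemma act_symlin phi a : symlin phi -> symlin (act phi a).
Proof.
move=> phiS; have [phiP phiL] := phiS; have [cP cL] := corr_symlin a phiS.
split=> [w w' ww'|w c x y]; rewrite /act.
  by rewrite (cP _ _ ww') (phiP _ (p a :: w')) ?perm_cons.
by rewrite !(symlin_swap (p a) _ _ phiS) phiL cL scalerDr addrACA.
Qed.

Lemma act_linear phi w : symlin phi -> linear (fun a => act phi a w).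
Proof.
move=> phiS c a b; have [_ phiL] := phiS.
by rewrite /act pL phiL (corr_linear w phiS) scalerDr addrACA.
Qed.

Lemma act_linear_fun (c : K) phi psi a w :
  act (fun v => c *: phi v + psi v) a w = c *: act phi a w + act psi a w.
Proof. by rewrite /act corr_linear_fun scalerDr addrACA. Qed.

Lemma act_ker phi a w : symlin phi -> p a = 0 -> act phi a w = corr phi a w.
Proof. by move=> phiS a0; rewrite /act a0 symlin0 // add0r. Qed.

Lemma act_nil phi a : symlin phi -> p a = 0 -> act phi a [::] = 0.
Proof. by move=> phiS a0; rewrite act_ker // corr_rec big_nil. Qed.

Lemma act_sec phi y w : act phi (s y) w = phi (y :: w) + corr phi (s y) w.
Proof. by rewrite /act sK. Qed.

Lemma nat_scaleI (n : nat) (u v : N) : n.+1%:R *: u = n.+1%:R *: v -> u = v.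
Proof. by move=> /(congr1 ( *:%R (n.+1%:R : K)^-1)); rewrite !scalerA mulVr ?scale1r. Qed.

(** The last hypothesis makes [a] an eigenvector of [rescale] with eigenvalue 1/(n+1): n + 1 is the
    length of w on the kernel of p, and that length plus one on the image of s. *)
Lemma corr_scale phi a w (n : nat) : symlin phi ->
  (size w != 0)%N -> n.+1%:R *: rescale (size w) a = a ->
  n.+1%:R *: corr phi a w = \sum_(z <- w)
    (corr (act phi (s z)) a (rem z w) + act phi (br a (s z)) (rem z w)).
Proof.
move=> phiS _ na; rewrite corr_rec scaler_sumr; apply: eq_bigr => z _.
rewrite scalerDr -(linZ (corr_linear _ (act_symlin (s z) phiS))).
by rewrite -(linZ (act_linear _ phiS)) -(linZ (brLl _)) na.
Qed.

Lemma act_ker_rec phi a w : symlin phi -> p a = 0 ->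
  (size w)%:R *: act phi a w = \sum_(z <- w)
    (act (act phi (s z)) a (rem z w) + act phi (br a (s z)) (rem z w)).
Proof.
move=> phiS a0; case sw : (size w) => [|n].
  by rewrite (size0nil sw) big_nil scale0r.
rewrite act_ker // corr_scale ?sw //.
  by apply: eq_bigr => z _; rewrite [act (act _ _) _ _]act_ker //; apply: act_symlin.
by rewrite /rescale a0 (lin0 sL) scaler0 add0r subr0 scalerA mulrV ?scale1r.
Qed.

Lemma corr_sec_rec phi y w : symlin phi ->
  (size w).+1%:R *: corr phi (s y) w = \sum_(z <- w)
    (corr (act phi (s z)) (s y) (rem z w) + act phi (br (s y) (s z)) (rem z w)).
Proof.
move=> phiS; case sw : (size w) => [|n].
  by rewrite (size0nil sw) big_nil corr_rec big_nil scaler0.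
rewrite corr_scale ?sw //.
by rewrite /rescale sK subrr scaler0 addr0 scalerA mulrV ?scale1r.
Qed.

(* This is sum_j s(y_j) . (P / y_j) = n P: the double sum over ordered pairs of
   letters is antisymmetric in its bracket part, and vanishes by induction in
   the other one. *)
Lemma sum_corr_sec phi w : symlin phi -> \sum_(z <- w) corr phi (s z) (rem z w) = 0.
Proof.
have [n] := ubnP (size w); elim: n w phi => // n IH w phi; rewrite ltnS => wn phiS.
case sw : (size w) => [|m]; first by rewrite (size0nil sw) big_nil.
apply: (@nat_scaleI m); rewrite scaler0 scaler_sumr.
pose F z z' v := corr (act phi (s z')) (s z) v.
pose B z z' v := act phi (br (s z) (s z')) v.
transitivity (\sum_(z <- w) \sum_(z' <- rem z w)
    (F z z' (rem z' (rem z w)) + B z z' (rem z' (rem z w)))).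
  apply: eq_big_seq => z zw.
  by rewrite -corr_sec_rec // size_rem // sw.
under eq_bigr do rewrite big_split; rewrite big_split /=.
rewrite sum_rem_swap => [|z z' v v' vv']; last first.
  exact: (proj1 (corr_symlin _ (act_symlin _ phiS))).
rewrite big1_seq ?add0r => [|z /andP[_ zw]]; last first.
  apply: IH; last exact: act_symlin.
  exact: leq_trans (size_rem_lt zw) wn.
apply: (@nat_scaleI 1); rewrite scaler0 scaler_nat mulr2n.
rewrite [X in X + _]sum_rem_swap => [|z z' v v' vv']; last first.
  exact: (proj1 (act_symlin _ phiS)).
rewrite -big_split big1 // => z _; rewrite -big_split big1 // => z' _ /=.
by rewrite /B brN (linN (act_linear _ phiS)) addNr.
Qed.

(** The normalization by symmetrization in dual form: the corrections cancel by [sum_corr_sec], and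
    each leading term puts the removed letter back. *)
Lemma sum_act_sec phi w : symlin phi ->
  \sum_(z <- w) act phi (s z) (rem z w) = (size w)%:R *: phi w.
Proof.
move=> phiS; under eq_bigr do rewrite act_sec.
rewrite big_split /= sum_corr_sec // addr0 scaler_nat.
rewrite (eq_big_seq (fun=> phi w)) => [|z zw].
  by rewrite big_const_seq count_predT iter_addr_0.
by apply: (proj1 phiS); rewrite perm_sym perm_to_rem.
Qed.

(** In [corr_sec_rec] one kind of summand contains a bracket and the other is divisible by
    induction; the integer factor on the left is a unit. *)
Lemma corr_sec_divisible (t : K) phi y w :
  (forall a b, exists c, br a b = t *: c) -> symlin phi ->
  exists u, corr phi (s y) w = t *: u.
Proof.
move=> br_t; have [n] := ubnP (size w); elim: n w phi => // n IH w phi.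
rewrite ltnS => wn phiS.
have [u Eu] : exists u, (size w).+1%:R *: corr phi (s y) w = t *: u.
  rewrite corr_sec_rec // big_seq; elim/big_ind: _ => [|_ _ [u ->] [v ->]|z zw].
  - by exists 0; rewrite scaler0.
  - by exists (u + v); rewrite scalerDr.
  have [|u ->] := IH (rem z w) (act phi (s z)) _ (act_symlin (s z) phiS).
    exact: leq_trans (size_rem_lt zw) wn.
  have [c ->] := br_t (s y) (s z).
  exists (u + act phi c (rem z w)).
  by rewrite (linZ (act_linear _ phiS)) -scalerDr.
exists ((size w).+1%:R^-1 *: u); apply: (@nat_scaleI (size w)).
by rewrite Eu (scaleCA _ t) (scalerA (size w).+1%:R) mulrV ?scale1r.
Qed.

(** * The commutation relation, by induction on the length of the word *)

Section Step.
Variable n : nat.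
Hypothesis IH : forall v phi a b, (size v < n)%N -> symlin phi ->
  act (act phi a) b v = act (act phi b) a v + act phi (br a b) v.

(** [corr] at v reads its function only on words no longer than v, and there the induction
    hypothesis rewrites that function. *)
Lemma corr_comm phi a b c v : (size v < n)%N -> symlin phi ->
  corr (act (act phi a) b) c v =
  corr (act (act phi b) a) c v + corr (act phi (br a b)) c v.
Proof.
move=> vn phiS.
rewrite (@corr_ext _ (fun u => 1 *: act (act phi b) a u + act phi (br a b) u)).
  by rewrite corr_linear_fun scale1r.
by move=> u uv; rewrite scale1r IH //; apply: leq_ltn_trans vn.
Qed.

(** In general c . v has a leading term one letter longer than v, possibly out of reach of the
    induction hypothesis. For c in the kernel of p it is absent. *)
Lemma act_comm_ker phi a b c v : (size v < n)%N -> symlin phi -> p c = 0 ->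
  act (act (act phi a) b) c v = act (act (act phi b) a) c v + act (act phi (br a b)) c v.
Proof.
move=> vn phiS c0; have aS f d := @act_symlin f d.
rewrite (act_ker v (aS _ b (aS _ a phiS)) c0) (act_ker v (aS _ a (aS _ b phiS)) c0).
by rewrite (act_ker v (aS _ _ phiS) c0) corr_comm.
Qed.

Lemma act_brN phi a b v : symlin phi -> act phi (br a b) v = - act phi (br b a) v.
Proof. by move=> phiS; rewrite brN (linN (act_linear _ phiS)). Qed.

Lemma corr_act_brN phi a b c v : symlin phi ->
  corr (act phi (br a b)) c v = - corr (act phi (br b a)) c v.
Proof.
move=> phiS; rewrite (_ : act phi (br a b) = (fun u => (-1) *: act phi (br b a) u + 0)).
  rewrite (corr_linear_fun _ _ (fun=> 0)) scaleN1r (_ : corr (fun=> 0) c v = 0) ?addr0 //.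
  have := corr_linear_fun (-1) (fun=> 0) (fun=> 0) c v.
  by rewrite scaler0 addr0 scaleN1r addNr.
by apply: funext => u; rewrite act_brN // scaleN1r addr0.
Qed.

Lemma act_jacobi phi a b c v : symlin phi ->
  act phi (br (br a b) c) v = act phi (br a (br b c)) v - act phi (br b (br a c)) v.
Proof. by move=> phiS; rewrite -brJ (linB (act_linear _ phiS)). Qed.

Lemma act_act_brN phi a b c v : symlin phi ->
  act (act phi (br a b)) c v = - act (act phi (br b a)) c v.
Proof.
move=> phiS; rewrite /act corr_act_brN // opprD; congr (_ + _).
exact: act_brN.
Qed.

(** After multiplication by the length of w, [act_ker_rec] expands all terms over words one letter
    shorter. The relation there, for a, b and s(z), leaves the Jacobi identity. *)
Lemma act_comm_kk phi a b w : size w = n -> symlin phi -> p a = 0 -> p b = 0 ->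
  act (act phi a) b w = act (act phi b) a w + act phi (br a b) w.
Proof.
move=> wn phiS a0 b0; have ab0 := p_br a0 b0.
have aS c : symlin (act phi c) by apply: act_symlin.
case sw : (size w) => [|m].
  by rewrite (size0nil sw) (act_nil (aS a) b0) (act_nil (aS b) a0) (act_nil phiS ab0) addr0.
apply: (@nat_scaleI m); rewrite -sw [RHS]scalerDr (act_ker_rec w (aS a) b0).
rewrite (act_ker_rec w (aS b) a0) (act_ker_rec w phiS ab0) -big_split.
apply: eq_big_seq => z zw /=; set v := rem z w.
have vn : (size v < n)%N by rewrite -wn; apply: size_rem_lt.
rewrite (act_comm_ker a (s z) vn phiS b0) (act_comm_ker b (s z) vn phiS a0).
rewrite (IH a b vn (aS _)) (IH a (br b (s z)) vn phiS).
rewrite (IH b (br a (s z)) vn phiS) act_jacobi //.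
by zmod.
Qed.

Lemma act_comm_ks phi a y w : size w = n -> symlin phi -> p a = 0 ->
  act (act phi a) (s y) w = act (act phi (s y)) a w + act phi (br a (s y)) w.
Proof.
move=> wn phiS a0.
have aS c : symlin (act phi c) by apply: act_symlin.
have aaS c d : symlin (act (act phi c) d) by apply: act_symlin.
apply: (@nat_scaleI n); rewrite act_sec [LHS]scalerDr [RHS]scalerDr.
(* The leading term of the left side is [act phi a (y :: w)], so the recursion is used on the longer
   word, with factor n + 1. The summand of its letter y is one copy of the right side. *)
have := act_ker_rec (y :: w) phiS a0.
rewrite (sum_rem_cons (G := fun z v =>
  act (act phi (s z)) a v + act phi (br a (s z)) v)) => [|z v v' vv']; last first.
  by rewrite (proj1 (aaS _ _) _ _ vv') (proj1 (aS _) _ _ vv').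
rewrite [size _]/= wn => ->.
have := corr_sec_rec y w (aS a); rewrite wn => ->.
have n1 (u : N) : n.+1%:R *: u = n%:R *: u + u by rewrite -natr1 scalerDl scale1r.
(* Of the n + 1 copies of the right side, one matches the summand of y; the other n are expanded by
   the recursion and by [sum_act_sec]. *)
rewrite 2!n1 -wn (act_ker_rec w (aS (s y)) a0).
rewrite -(sum_act_sec w (aS (br a (s y)))).
rewrite [RHS](_ : _ = act (act phi (s y)) a w + act phi (br a (s y)) w +
  (\sum_(z <- w) (act (act (act phi (s y)) (s z)) a (rem z w) +
     act (act phi (s y)) (br a (s z)) (rem z w)) +
   \sum_(z <- w) act (act phi (br a (s y))) (s z) (rem z w))); last by zmod.
rewrite -addrA; congr (_ + _); rewrite -!big_split.
apply: eq_big_seq => z zw /=; set v := rem z w.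
have vn : (size v < n)%N by rewrite -wn; apply: size_rem_lt.
(* The word [y :: v] has length n, beyond the induction hypothesis; its value is traded for an
   action of s(y) on v and a correction at v. *)
have E1 : act (act phi (s z)) a (y :: v) =
    act (act (act phi (s z)) a) (s y) v - corr (act (act phi (s z)) a) (s y) v.
  by rewrite [X in X - _]act_sec addrK.
have E2 : act phi (br a (s z)) (y :: v) =
    act (act phi (br a (s z))) (s y) v - corr (act phi (br a (s z))) (s y) v.
  by rewrite [X in X - _]act_sec addrK.
rewrite E1 E2 (IH a (s y) vn (aS _)).
rewrite (act_comm_ker (s z) (s y) vn phiS a0).
rewrite (IH (s z) (br a (s y)) vn phiS) (corr_comm (s z) a (s y) vn phiS).
rewrite (IH (br a (s z)) (s y) vn phiS) (IH a (br (s y) (s z)) vn phiS).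
rewrite (corr_act_brN (s z) a) // (act_act_brN (s z) (s y)) //.
rewrite (act_brN (s z)) // [br (br a (s z)) _]brN (linN (act_linear v phiS)).
rewrite (act_jacobi a (s y)) //.
by zmod.
Qed.

Lemma act_comm_ss phi x y w : size w = n -> symlin phi ->
  act (act phi (s x)) (s y) w = act (act phi (s y)) (s x) w + act phi (br (s x) (s y)) w.
Proof.
move=> wn phiS.
have aS c : symlin (act phi c) by apply: act_symlin.
have aaS c d : symlin (act (act phi c) d) by apply: act_symlin.
rewrite [LHS]act_sec [X in X + _ = _]act_sec [X in _ = X + _]act_sec.
rewrite [X in _ = X + _ + _]act_sec (symlin_swap x y) //.
have rec x' y' : n.+2%:R *: corr phi (s x') (y' :: w) =
    corr (act phi (s y')) (s x') w + act phi (br (s x') (s y')) w +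
    \sum_(z <- w) (corr (act phi (s z)) (s x') (y' :: rem z w) +
      act phi (br (s x') (s z)) (y' :: rem z w)).
  have := corr_sec_rec x' (y' :: w) phiS.
  rewrite (sum_rem_cons (G := fun z v =>
    corr (act phi (s z)) (s x') v + act phi (br (s x') (s z)) v)) => [|z v v' vv']; last first.
    rewrite (proj1 (corr_symlin _ (aS _)) _ _ vv').
    by rewrite (proj1 (aS _) _ _ vv').
  by rewrite [size _]/= wn.
have recA x' y' := corr_sec_rec y' w (aS (s x')).
have recD := sum_act_sec w (aS (br (s x) (s y))).
(* Scaling is by n + 2, the factor of [corr_sec_rec] on a word of length n + 1. *)
apply: (@nat_scaleI n.+1); rewrite [LHS]scalerDr [X in X + _ = _]scalerDr [RHS]scalerDr.
rewrite [X in _ = X + _]scalerDr [X in _ = X + _ + _]scalerDr !rec.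
set A := corr (act phi (s x)) (s y) w; set B := corr (act phi (s y)) (s x) w.
set D := act phi (br (s x) (s y)) w.
have -> : act phi (br (s y) (s x)) w = - D by rewrite act_brN.
have n2 (u : N) : n.+2%:R *: u = n.+1%:R *: u + u by rewrite -natr1 scalerDl scale1r.
have n1 (u : N) : n.+1%:R *: u = n%:R *: u + u by rewrite -natr1 scalerDl scale1r.
(* The corrections at w expand with factor n + 1 and the bracket term with factor n. The copies left
   over cancel against the summands of the first letter in [rec]. *)
rewrite (n2 A) (n2 B) (n2 D) (n1 D) -wn -recD recA recA.
set S0 := \sum_(z <- w) _; set S1 := \sum_(z <- w) _; set S2 := \sum_(z <- w) _.
set S3 := \sum_(z <- w) _; set S4 := \sum_(z <- w) _.
suff E : S0 + S1 = S2 + S3 + S4.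
  set Z := (_ *: _).
  transitivity (Z + B + D + A + (S0 + S1)); first by zmod.
  by rewrite E; zmod.
rewrite -!big_split; apply: eq_big_seq => z zw /=; set v := rem z w.
have vn : (size v < n)%N by rewrite -wn; apply: size_rem_lt.
have E1 y' u : act phi u (y' :: v) = act (act phi u) (s y') v - corr (act phi u) (s y') v.
  by rewrite [X in X - _]act_sec addrK.
(* The corrections at [x :: v] and [y :: v] are again values on words of length n. Only their
   difference occurs, and comparing the two orders of s(x) and s(y) on v determines it. *)
have E2 := IH (s x) (s y) vn (aS (s z)).
have E3 x' y' : act (act (act phi (s z)) (s x')) (s y') v =
  act phi (s z) [:: x', y' & v] + corr (act phi (s z)) (s x') (y' :: v) +
  corr (act (act phi (s z)) (s x')) (s y') v.
  by rewrite act_sec [X in X + _]act_sec.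
move: E2; rewrite !E3 (symlin_swap y x) //; set u0 := act _ _ _; move=> E2.
have {E2}-> : corr (act phi (s z)) (s x) (y :: v) =
    corr (act phi (s z)) (s y) (x :: v) + corr (act (act phi (s z)) (s y)) (s x) v +
    act (act phi (s z)) (br (s x) (s y)) v - corr (act (act phi (s z)) (s x)) (s y) v.
  by rewrite -[LHS](addKr u0) addrC; move/(canRL (addrK _)): E2 => ->; zmod.
rewrite !E1 !(corr_comm (s z) _ _ vn phiS).
rewrite (IH (s z) _ vn phiS) (IH (br (s x) (s z)) (s y) vn phiS).
rewrite (IH (br (s y) (s z)) (s x) vn phiS).
rewrite !(corr_act_brN (s z)) // (act_brN (s z) (br (s x) (s y)) v phiS).
rewrite (act_brN (br (s x) (s z)) (s y) v phiS) (act_brN (br (s y) (s z)) (s x) v phiS).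
rewrite (act_jacobi (s x) (s y) (s z) v phiS).
by zmod.
Qed.

End Step.

(** The defect [D] is linear in its first argument and antisymmetric, so splitting each argument
    along the image of s and the kernel of p leaves the three cases treated above. *)
Theorem act_comm phi a b w : symlin phi ->
  act (act phi a) b w = act (act phi b) a w + act phi (br a b) w.
Proof.
have [n] := ubnP (size w); elim: n w phi a b => // n IHn w phi a b; rewrite ltnS => wn phiS.
have {}IHn v psi c d : (size v < size w)%N -> symlin psi ->
    act (act psi c) d v = act (act psi d) c v + act psi (br c d) v.
  by move=> vw; apply: IHn; apply: leq_trans vw wn.
have aS c : symlin (act phi c) by apply: act_symlin.
pose D c d := act (act phi c) d w - act (act phi d) c w - act phi (br c d) w.
have DLl d : linear (D^~ d).
  move=> k c c'; rewrite /D.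
  have -> : act phi (k *: c + c') = (fun v => k *: act phi c v + act phi c' v).
    by apply: funext => v; apply: (act_linear _ phiS).
  rewrite act_linear_fun (act_linear _ (aS d)) brLl (act_linear _ phiS) !scalerBr.
  by zmod.
have DN c d : D c d = - D d c by rewrite /D (act_brN c d) //; zmod.
have pk e : p (e - s (p e)) = 0 by rewrite (linB pL) sK subrr.
have D0 c d : p c = 0 -> D c d = 0.
  move=> c0; have Dk : D c (d - s (p d)) = 0.
    by rewrite /D (act_comm_kk IHn) //; zmod.
  have Ds : D c (s (p d)) = 0.
    by rewrite /D (act_comm_ks IHn) //; zmod.
  have E : D d c = D (d - s (p d)) c + D (s (p d)) c by rewrite -(linD (DLl c)) subrK.
  by rewrite DN E opprD -!DN Dk Ds addr0.
have Ds y d : D (s y) d = 0.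
  have E : D d (s y) = D (d - s (p d)) (s y) + D (s (p d)) (s y).
    by rewrite -(linD (DLl (s y))) subrK.
  rewrite DN E D0 // add0r /D (act_comm_ss IHn) //; zmod.
suff E : D a b = 0.
  by apply/eqP; rewrite -subr_eq0; apply/eqP; rewrite -[RHS]E /D; zmod.
have E : D a b = D (a - s (p a)) b + D (s (p a)) b by rewrite -(linD (DLl b)) subrK.
by rewrite E D0 // Ds addr0.
Qed.

End PBW.

(** * Modules over presented algebras and over V(R) *)

Section PalgAct.
Variables (K : comNzRingType) (X : Type) (rel : aterm K X -> aterm K X -> Prop).
(* The relations need only hold on D; for the symbol map, D is the set of
   functionals that are linear on symmetric multilinear functions. *)
Variables (M : lmodType K) (op : X -> M -> M) (D : M -> Prop).
Hypothesis DD : forall m m', D m -> D m' -> D (m + m').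
Hypothesis DZ : forall k m, D m -> D (k *: m).
Hypothesis Dop : forall x m, D m -> D (op x m).
Hypothesis opL : forall x k m m', D m -> D m' ->
  op x (k *: m + m') = k *: op x m + op x m'.

Fixpoint taction (t : aterm K X) (m : M) : M :=
  match t with
  | AGen x => op x m
  | AConst k => k *: m
  | AAdd t u => taction t m + taction u m
  | AMul t u => taction t (taction u m)
  end.

Lemma taction_D t m : D m -> D (taction t m).
Proof.
elim: t m => [x|k|t IHt u IHu|t IHt u IHu] m Dm /=.
- exact: Dop.
- exact: DZ.
- by apply: DD; [apply: IHt|apply: IHu].
- exact/IHt/IHu.
Qed.

Lemma taction_linear t k m m' : D m -> D m' ->
  taction t (k *: m + m') = k *: taction t m + taction t m'.
Proof.
elim: t k m m' => [x|l|t IHt u IHu|t IHt u IHu] k m m' Dm Dm' /=.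
- exact: opL.
- by rewrite scalerDr scaleCA.
- by rewrite IHt // IHu // scalerDr addrACA.
- by rewrite IHu // IHt //; apply: taction_D.
Qed.

Lemma taction_scale t k m : D m -> taction t (k *: m) = k *: taction t m.
Proof.
move=> Dm; have t0 : taction t 0 = 0.
  rewrite -[0 in LHS](addNr m) -scaleN1r taction_linear // scaleN1r.
  exact: addNr.
have D0 : D 0 by rewrite -(scale0r m); apply: DZ.
by rewrite -[k *: m]addr0 taction_linear // t0 addr0.
Qed.

Hypothesis rel_op : forall t u, rel t u -> forall m, D m -> taction t m = taction u m.

Lemma acong_taction t u : acong rel t u -> forall m, D m -> taction t m = taction u m.
Proof.
elim=> {t u} /=.
- exact: rel_op.
- by [].
- by move=> t u _ IH m Dm; rewrite IH.
- by move=> t u v _ IH _ IH' m Dm; rewrite IH // IH'.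
- by move=> s s' t t' _ IH _ IH' m Dm; rewrite IH // IH'.
- by move=> s s' t t' _ IH _ IH' m Dm; rewrite IH' // IH //; apply: taction_D.
- by move=> s t u m _; rewrite addrA.
- by move=> s t m _; rewrite addrC.
- by move=> s m _; rewrite scale0r add0r.
- by [].
- by move=> s m _; rewrite scale1r.
- by move=> s m _; rewrite !scale0r.
- by [].
- move=> s t u m Dm; rewrite -[taction t m]scale1r taction_linear ?scale1r //;
    exact: taction_D.
- by move=> k l m _; rewrite scalerDl.
- by move=> k l m _; rewrite scalerA.
- by move=> k s m Dm; rewrite taction_scale.
Qed.

Definition pact (u : palg rel) (m : M) : M := taction (repr u) m.

Lemma pact_pi t m : D m -> pact (\pi_(palg rel) t) m = taction t m.
Proof. by move=> Dm; apply: acong_taction => //; apply: palg_reprP. Qed.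

Lemma pact_D u m : D m -> D (pact u m).
Proof. exact: taction_D. Qed.

Lemma pactD u v m : D m -> pact (u + v) m = pact u m + pact v m.
Proof.
elim/quotW: u => s; elim/quotW: v => t Dm.
by rewrite -[_ + _ in LHS]/(padd _ _) pi_padd !pact_pi.
Qed.

Lemma pactM u v m : D m -> pact (u * v) m = pact u (pact v m).
Proof.
elim/quotW: u => s; elim/quotW: v => t Dm.
by rewrite -[_ * _ in LHS]/(pmul _ _) pi_pmul !pact_pi //; apply: taction_D.
Qed.

Lemma pactZ k u m : D m -> pact (k *: u) m = k *: pact u m.
Proof.
elim/quotW: u => s Dm.
by rewrite -[_ *: _ in LHS]/(pmul (pconst _ k) _) pi_pmul !pact_pi.
Qed.

Lemma pact1 m : D m -> pact 1 m = m.
Proof. by move=> Dm; rewrite -[1]/(pconst _ 1) pact_pi //= scale1r. Qed.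

Lemma pact_gen x m : D m -> pact (pgen rel x) m = op x m.
Proof. by move=> Dm; rewrite pact_pi. Qed.

Lemma pact_scale u k m : D m -> pact u (k *: m) = k *: pact u m.
Proof. exact: taction_scale. Qed.

End PalgAct.

Lemma plift_pi (K : comNzRingType) (X : Type) rel (A : algType K) (f : X -> A) t :
  (forall s u, rel s u -> aeval f s = aeval f u) ->
  plift f (\pi_(palg (K := K) rel) t) = aeval f t.
Proof. by move=> fr; apply: (aeval_cong fr); apply: palg_reprP. Qed.

(** * V(R) as an induced module *)

Section AssocModule.
Variables (K : comUnitRingType) (R : lmodType K).
Variables (del : R -> R) (prd : nat -> R -> R -> R).
Hypothesis RP : vertex_lie del prd.
Hypothesis natU : forall n : nat, n.+1%:R \is a @GRing.unit K.

Local Notation L := (lieL del).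
Local Notation lm := (lmode del).
Local Notation br := (@lie_br K R del prd).
Local Notation U := (uea br [set: L]).
Local Notation V := (assocV del prd).
Local Notation gen := (ueagen br).
Local Notation mode := (@assoc_mode K R del prd).
Local Notation vac := (assoc_vac del prd).

Lemma ueagenD x y : gen (x + y) = gen x + gen y.
Proof.
rewrite -[RHS]/(padd (\pi_(palg _) _) (\pi_(palg _) _)) pi_padd.
by apply/eqP/palg_eqP; apply: acong_rel; apply: uea_relD.
Qed.

Lemma ueagenZ k x : gen (k *: x) = k *: gen x.
Proof.
rewrite -[RHS]/(pmul (\pi_(palg _) _) (\pi_(palg _) _)) pi_pmul.
by apply/eqP/palg_eqP; apply: acong_rel; apply: uea_relZ.
Qed.

Lemma ueagenB x y : gen x * gen y = gen y * gen x + gen (br x y).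
Proof.
rewrite -[LHS]/(pmul (\pi_(palg _) _) (\pi_(palg _) _)) pi_pmul.
rewrite -[_ * _]/(pmul (\pi_(palg _) _) (\pi_(palg _) _)) pi_pmul.
rewrite -[RHS]/(padd _ (\pi_(palg _) _)) pi_padd.
by apply/eqP/palg_eqP; apply: acong_rel; apply: uea_relB.
Qed.

Definition assocV_rel : set U := [set v : U |
  exists (u : U) (b : uea br (@lieLplus K R del)), v = u * uea_incl b - uea_aug b *: u].

Lemma vclass_reprP (u : U) : Defs.span assocV_rel (repr (\pi_V u) - u).
Proof. exact: quotm_reprP. Qed.

Definition vclass (u : U) : V := \pi_V u.

Lemma vclassD u v : vclass (u + v) = vclass u + vclass v.
Proof. exact: quotmD. Qed.

Lemma vclassZ k u : vclass (k *: u) = k *: vclass u.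
Proof. exact: quotmZ. Qed.

Definition lie_act (x : L) (v : V) : V := vclass (gen x * repr v).

(** Left multiplication by the generator of x carries the relation given by (u, b) to the one given
    by (x u, b), hence descends to the quotient. *)
Lemma lie_act_class x u : lie_act x (vclass u) = vclass (gen x * u).
Proof.
apply/eqP/quotm_eqP; rewrite -mulrBr.
have := vclass_reprP u; elim=> [_ [w [b ->]]||y z _ Hy _ Hz|k y _ Hy].
- rewrite mulrBr -scalerAr mulrA; apply: span_gen.
  by exists (gen x * w), b.
- by rewrite mulr0; apply: span_0.
- by rewrite mulrDr; apply: span_D.
- by rewrite -scalerAr; apply: span_Z.
Qed.

Lemma lie_act_linear x : linear (lie_act x).
Proof.
move=> k; elim/quotW=> u; elim/quotW=> v.
rewrite -[\pi u]/(vclass u) -[\pi v]/(vclass v) -vclassZ -vclassD !lie_act_class.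
by rewrite mulrDr -scalerAr vclassD vclassZ.
Qed.

Lemma lie_act_linearl v : linear (lie_act^~ v).
Proof.
move=> k x y; elim/quotW: v => u; rewrite -[\pi u]/(vclass u) !lie_act_class.
by rewrite ueagenD ueagenZ mulrDl -scalerAl vclassD vclassZ.
Qed.

Lemma lie_act_comm x y v :
  lie_act x (lie_act y v) - lie_act y (lie_act x v) = lie_act (br x y) v.
Proof.
elim/quotW: v => u; rewrite -[\pi u]/(vclass u) !lie_act_class !mulrA.
by rewrite ueagenB mulrDl vclassD addrAC subrr add0r.
Qed.

Lemma assoc_modeE a n v : mode a n v = lie_act (lm a n) v.
Proof. by []. Qed.

Lemma assoc_mode_linear a n : linear (mode a n).
Proof. exact: lie_act_linear. Qed.

Lemma assoc_mode_linearl n v : linear (fun a => mode a n v).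
Proof. exact: linear_comp (lie_act_linearl v) (lmode_linear del n). Qed.

Lemma assoc_mode_del a n v : mode (del a) n v = - mode a (n - 1) v *~ n.
Proof.
rewrite !assoc_modeE (lmode_del RP) (linMz (lie_act_linearl v)).
by rewrite (linN (lie_act_linearl v)).
Qed.

Lemma assoc_mode_comm a m b n v :
  mode a m (mode b n v) - mode b n (mode a m v) =
  \sum_(i \in [set: nat]) mode (prd i a b) (m + n - i%:Z) v *~ binz m i.
Proof.
rewrite !assoc_modeE lie_act_comm (lie_br_lmode RP natU).
rewrite (lin_fsum (lie_act_linearl v)); last exact: loop_br_fin.
by apply: eq_fsbigr => i _; rewrite (linMz (lie_act_linearl v)).
Qed.

Lemma uea_incl_pi (H : set L) t :
  uea_incl (\pi_(uea br H) t) = aeval (fun x : {x | H x} => gen (sval x)) t.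
Proof.
apply: plift_pi => s u; case=> [x y z|k x z|x y z] zE /=; rewrite zE.
- exact: ueagenD.
- by rewrite ueagenZ -scalerAl mul1r.
- exact: ueagenB.
Qed.

Lemma uea_aug_pi (H : set L) t :
  uea_aug (\pi_(uea br H) t) = aeval (fun=> 0 : K^o) t.
Proof. by apply: (plift_pi (A := K^o)) => s u; apply: uea_rel_aug. Qed.

Lemma lie_act_vac x : lieLplus x -> lie_act x vac = 0.
Proof.
move=> xp; rewrite [lie_act x vac]lie_act_class mulr1.
rewrite -[RHS]/(\pi_V 0); apply/eqP/quotm_eqP; rewrite subr0; apply: span_gen.
exists 1, (pgen _ (exist _ x xp)).
by rewrite uea_incl_pi uea_aug_pi /= scale0r subr0 mul1r.
Qed.

Lemma assoc_mode_vac a (n : nat) : mode a n%:Z vac = 0.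
Proof. by apply: lie_act_vac; apply: span_gen; exists a, n. Qed.

(** Elements of U are classes of terms; the induction is on a term t, for the stronger claim that
    left multiplication by t preserves [P]. *)
Lemma assocV_ind (P : V -> Prop) : P vac ->
  (forall v w, P v -> P w -> P (v + w)) -> (forall k v, P v -> P (k *: v)) ->
  (forall a n v, P v -> P (mode a n v)) -> forall v, P v.
Proof.
move=> P1 PD PZ Pm; elim/quotW; elim/quotW => t.
suff H u : P (vclass u) -> P (vclass (\pi_(palg _) t * u : U)).
  by have := H 1 P1; rewrite mulr1.
elim: t u => [[x []]|k|t IHt t' IHt'|t IHt t' IHt'] u Pu.
- rewrite -[\pi_(palg _) _]/(gen x) -lie_act_class.
  elim/lieL_ind: x => [|x y Hx Hy|a n]; last exact: Pm.
    by rewrite (lin0 (lie_act_linearl _)) -(scale0r vac); apply: PZ.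
  by rewrite (linD (lie_act_linearl _)); apply: PD.
- by rewrite -[vclass _]/(vclass (k *: u)) vclassZ; apply: PZ.
- rewrite -pi_padd -[padd _ _]/(_ + _ : U) mulrDl vclassD.
  by apply: PD; [apply: IHt|apply: IHt'].
- rewrite -pi_pmul -[pmul _ _]/(_ * _ : U) -mulrA.
  exact/IHt/IHt'.
Qed.

Section Lift.
Variables (M : lmodType K) (op : R -> int -> M -> M) (D : M -> Prop) (m0 : M).
Hypothesis DD : forall m m', D m -> D m' -> D (m + m').
Hypothesis DZ : forall k m, D m -> D (k *: m).
Hypothesis Dop : forall a n m, D m -> D (op a n m).
Hypothesis opL : forall a n k m m', D m -> D m' ->
  op a n (k *: m + m') = k *: op a n m + op a n m'.
Hypothesis opLa : forall n m, D m -> linear (fun a => op a n m).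
Hypothesis opdel : forall a n m, D m -> op (del a) n m = - op a (n - 1) m *~ n.
Hypothesis opC : forall a m b n v, D v ->
  op a m (op b n v) - op b n (op a m v) =
  \sum_(i \in [set: nat]) op (prd i a b) (m + n - i%:Z) v *~ binz m i.
Hypothesis Dm0 : D m0.
Hypothesis opm0 : forall a (n : nat), op a n%:Z m0 = 0.

Let lop (x : L) (m : M) : M := lie_lift (fun a n => op a n m) x.

Let lopL m : D m -> linear (lop^~ m).
Proof. by move=> Dm; apply: (lie_lift_linear RP); [move=> n; apply: opLa|move=> a n; apply: opdel]. Qed.

Let lop_lm a n m : D m -> lop (lm a n) m = op a n m.
Proof.
move=> Dm; apply: (lie_lift_lmode RP (Phi := fun a n => op a n m)).
  by move=> k; apply: opLa.
by move=> b k; apply: opdel.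
Qed.

Let D0 : D 0. Proof. by rewrite -(scale0r m0); apply: DZ. Qed.

Let Dlop x m : D m -> D (lop x m).
Proof.
move=> Dm; elim/lieL_ind: x => [|x y Hx Hy|a n].
- by rewrite (lin0 (lopL Dm)).
- by rewrite (linD (lopL Dm)); apply: DD.
- by rewrite lop_lm //; apply: Dop.
Qed.

Let lop_linear x k m m' : D m -> D m' -> lop x (k *: m + m') = k *: lop x m + lop x m'.
Proof.
move=> Dm Dm'; have Dmm : D (k *: m + m') by apply: DD => //; apply: DZ.
elim/lieL_ind: x => [|x y Hx Hy|a n].
- by rewrite !(lin0 (lopL _)) // scaler0 addr0.
- rewrite (linD (lopL Dmm)) (linD (lopL Dm)) (linD (lopL Dm')) Hx Hy scalerDr.
  exact: addrACA.
- by rewrite !lop_lm // opL.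
Qed.

Let lopD x m m' : D m -> D m' -> lop x (m + m') = lop x m + lop x m'.
Proof. by move=> Dm Dm'; rewrite -[m]scale1r lop_linear // !scale1r. Qed.

Let lop_comm x y m : D m -> lop x (lop y m) - lop y (lop x m) = lop (br x y) m.
Proof.
move=> Dm; have brL := lie_br_linearl RP natU; have brR := lie_br_linearr RP natU.
have lop0 z : lop z 0 = 0.
  by rewrite -[0 in LHS](addNr m0) -scaleN1r lop_linear // scaleN1r; apply: addNr.
elim/lieL_ind: x => [|x x' Hx Hx'|a k].
- rewrite (lin0 (brL _)) !(lin0 (lopL Dm)) (lin0 (lopL _)) ?lop0 ?subrr //.
  exact: Dlop.
- rewrite (linD (brL _)) (linD (lopL (Dlop _ Dm))) !(linD (lopL Dm)).
  rewrite lopD; try exact: Dlop.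
  by rewrite -Hx -Hx'; zmod.
elim/lieL_ind: y => [|y y' Hy Hy'|b n].
- rewrite (lin0 (brR _)) !(lin0 (lopL Dm)) (lin0 (lopL _)) ?lop0 ?subrr //.
  exact: Dlop.
- rewrite (linD (brR _)) (linD (lopL (Dlop _ Dm))) !(linD (lopL Dm)).
  rewrite lopD; try exact: Dlop.
  by rewrite -Hy -Hy'; zmod.
rewrite !lop_lm //; try exact: Dop.
rewrite opC // (lie_br_lmode RP natU) (lin_fsum (lopL Dm)); last exact: loop_br_fin.
by apply: eq_fsbigr => i _; rewrite (linMz (lopL Dm)) lop_lm.
Qed.

Let lop_plus x : lieLplus x -> lop x m0 = 0.
Proof.
elim=> [_ [a [n ->]]||y z _ Hy _ Hz|k y _ Hy].
- by rewrite lop_lm.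
- exact: (lin0 (lopL Dm0)).
- by rewrite (linD (lopL Dm0)) Hy Hz addr0.
- by rewrite (linZ (lopL Dm0)) Hy scaler0.
Qed.

Let gop (x : {x : L | [set: L] x}) := lop (sval x).

Let gop_rel t u : uea_rel (K := K) br t u -> forall m, D m ->
  taction gop t m = taction gop u m.
Proof.
case=> [x y z|k x z|x y z] zE m Dm.
- rewrite -[LHS]/(lop (sval z) m) zE; exact: (linD (lopL Dm)).
- rewrite -[LHS]/(lop (sval z) m) zE; exact: (linZ (lopL Dm)).
- rewrite -[RHS]/(lop (sval y) (lop (sval x) m) + lop (sval z) m) zE -lop_comm //.
  by rewrite addrCA subrr addr0.
Qed.

Let gpact (u : U) : M -> M := pact gop u.

Let pact_incl b : gpact (uea_incl (b : uea br (@lieLplus K R del))) m0 = uea_aug b *: m0.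
Proof.
have Dgop x m : D m -> D (gop x m) by apply: Dlop.
have gopL x k m m' : D m -> D m' -> gop x (k *: m + m') = k *: gop x m + gop x m'.
  exact: lop_linear.
elim/quotW: b => t; rewrite uea_incl_pi uea_aug_pi.
elim: t => [[x xp]|k|t IHt u IHu|t IHt u IHu] /=.
- rewrite scale0r; apply: etrans (lop_plus xp).
  exact: (pact_gen DD DZ Dgop gopL gop_rel).
- rewrite [LHS](pactZ DD DZ Dgop gopL gop_rel) //.
  by rewrite (pact1 DD DZ Dgop gopL gop_rel) // -[k%:A]/(k * 1) mulr1.
- by rewrite [LHS](pactD DD DZ Dgop gopL gop_rel) // scalerDl -IHt -IHu.
- rewrite [LHS](pactM DD DZ Dgop gopL gop_rel) //; move: IHu IHt; rewrite /gpact.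
  by move=> -> IHt; rewrite (pact_scale DD DZ Dgop gopL) // IHt scalerA mulrC.
Qed.

(** Frobenius reciprocity: the operators make U act on [D], and v goes to a representative of v
    applied to [m0]. This descends because U(L_+) acts on [m0] through the augmentation
    ([pact_incl]). *)
Lemma assocV_lift : exists F : V -> M, [/\ linear F, forall v, D (F v),
  F vac = m0 & forall a n v, F (mode a n v) = op a n (F v)].
Proof.
have Dgop x m : D m -> D (gop x m) by apply: Dlop.
have gopL x k m m' : D m -> D m' -> gop x (k *: m + m') = k *: gop x m + gop x m'.
  exact: lop_linear.
have gD u v : gpact (u + v) m0 = gpact u m0 + gpact v m0.
  exact: (pactD DD DZ Dgop gopL gop_rel).
have gZ k u : gpact (k *: u) m0 = k *: gpact u m0.
  exact: (pactZ DD DZ Dgop gopL gop_rel).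
have gM u v : gpact (u * v) m0 = gpact u (gpact v m0).
  exact: (pactM DD DZ Dgop gopL gop_rel).
have gN u : gpact (- u) m0 = - gpact u m0 by rewrite -scaleN1r gZ scaleN1r.
pose F (v : V) := gpact (repr v) m0.
have FE u : F (vclass u) = gpact u m0.
  apply/eqP; rewrite -subr_eq0 -gN -gD.
  apply/eqP; have := vclass_reprP u.
  elim=> [_ [w [b ->]]||y z _ Hy _ Hz|k y _ Hy].
  - rewrite gD gN gZ gM pact_incl /gpact (pact_scale DD DZ Dgop gopL) //.
    by rewrite subrr.
  - by rewrite -(scale0r (0 : U)) gZ scale0r.
  - by rewrite gD Hy Hz addr0.
  - by rewrite gZ Hy scaler0.
exists F; split.
- move=> k; elim/quotW=> u; elim/quotW=> v.
  by rewrite -[\pi u]/(vclass u) -[\pi v]/(vclass v) -vclassZ -vclassD !FE gD gZ.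
- by move=> v; apply: pact_D.
- by rewrite [F vac]FE /gpact (pact1 DD DZ Dgop gopL gop_rel).
- move=> a n; elim/quotW=> u; rewrite -[\pi u]/(vclass u) assoc_modeE lie_act_class.
  rewrite !FE gM [LHS](pact_gen DD DZ Dgop gopL gop_rel) /gop /=; last exact: pact_D.
  by rewrite lop_lm //; apply: pact_D.
Qed.

End Lift.
End AssocModule.

(* The properties characterizing V(R) as the module induced from the trivial
   module, abstracted from the construction. *)
Record assoc_model (K : comUnitRingType) (R : lmodType K)
    (del : R -> R) (prd : nat -> R -> R -> R) (V : lmodType K)
    (mode : R -> int -> V -> V) (vac : V) : Prop := AssocModel {
  am_linear : forall a n, linear (mode a n);
  am_linearl : forall n v, linear (fun a => mode a n v);
  am_del : forall a n v, mode (del a) n v = - mode a (n - 1) v *~ n;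
  am_comm : forall a m b n v, mode a m (mode b n v) - mode b n (mode a m v) =
    \sum_(i \in [set: nat]) mode (prd i a b) (m + n - i%:Z) v *~ binz m i;
  am_vac : forall a (n : nat), mode a n%:Z vac = 0;
  am_ind : forall P : V -> Prop, P vac ->
    (forall v w, P v -> P w -> P (v + w)) -> (forall k v, P v -> P (k *: v)) ->
    (forall a n v, P v -> P (mode a n v)) -> forall v, P v;
  am_lift : forall (M : lmodType K) (op : R -> int -> M -> M) (D : M -> Prop) (m0 : M),
    (forall m m', D m -> D m' -> D (m + m')) ->
    (forall k m, D m -> D (k *: m)) ->
    (forall a n m, D m -> D (op a n m)) ->
    (forall a n k m m', D m -> D m' ->
      op a n (k *: m + m') = k *: op a n m + op a n m') ->
    (forall n m, D m -> linear (fun a => op a n m)) ->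
    (forall a n m, D m -> op (del a) n m = - op a (n - 1) m *~ n) ->
    (forall a m b n v, D v -> op a m (op b n v) - op b n (op a m v) =
      \sum_(i \in [set: nat]) op (prd i a b) (m + n - i%:Z) v *~ binz m i) ->
    D m0 -> (forall a (n : nat), op a n%:Z m0 = 0) ->
    exists F : V -> M, [/\ linear F, forall v, D (F v),
      F vac = m0 & forall a n v, F (mode a n v) = op a n (F v)]
}.

Lemma assocV_model (K : comUnitRingType) (R : lmodType K)
    (del : R -> R) (prd : nat -> R -> R -> R) :
  vertex_lie del prd -> (forall n : nat, n.+1%:R \is a @GRing.unit K) ->
  assoc_model del prd (@assoc_mode K R del prd) (assoc_vac del prd).
Proof.
move=> RP natU; split.
- exact: assoc_mode_linear.
- exact: assoc_mode_linearl.
- exact: assoc_mode_del.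
- exact: assoc_mode_comm.
- exact: assoc_mode_vac.
- exact: assocV_ind.
- exact: assocV_lift.
Qed.

(** * Vertex algebras and their quotients *)

Lemma fsum_nat1 (M : zmodType) (F : nat -> M) k :
  (forall i, i != k -> F i = 0) -> \sum_(i \in [set: nat]) F i = F k.
Proof.
move=> F0; rewrite (fsum_nat (N := k.+1)) => [|i ki]; last first.
  by apply: F0; rewrite gtn_eqF.
rewrite big_ord_recr big1 => [|i _]; first by rewrite /= add0r.
by rewrite F0 //= ltn_eqF.
Qed.

Lemma sumMz_fsum (M : zmodType) (F : nat -> M) (z : int) :
  (exists n, forall i, (n <= i)%N -> F i = 0) ->
  (\sum_(i \in [set: nat]) F i) *~ z = \sum_(i \in [set: nat]) F i *~ z.
Proof.
by apply: (fsum_map (f := fun x => x *~ z)) => [x y|]; rewrite ?mulrzDl ?mul0rz.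
Qed.

Section VertexAlgebra.
Variables (K : comNzRingType) (V : lmodType K) (Y : V -> int -> V -> V) (vac : V).
Hypothesis VA : vertex_algebra Y vac.

Let YLl n v : linear (fun u => Y u n v) := va_linearl VA n v.
Let YLr u n : linear (Y u n) := va_linearr VA u n.

Lemma va_fin u (c : int) v : exists n : nat, forall i : nat, (n <= i)%N ->
  Y u (c + i%:Z) v = 0.
Proof.
have [N YN] := va_trunc VA u v; exists `|N - c|%N => i Ni; apply: YN; lia.
Qed.

Lemma va_fin2 u v w (a q : int) (c : nat -> int) : exists n, forall i, (n <= i)%N ->
  Y u (a - i%:Z) (Y v (q + i%:Z) w) *~ c i = 0.
Proof.
have [n Yn] := va_fin v q w; exists n => i /Yn ->.
by rewrite (lin0 (YLr _ _)) mul0rz.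
Qed.

(** The Jacobi identity at p = 0, where the right side keeps only i = 0. It expresses the modes of
    u_r v through those of u and v. *)
Lemma va_iterate u v w (r q : int) : Y (Y u r v) q w =
  \sum_(i \in [set: nat]) Y u (r - i%:Z) (Y v (q + i%:Z) w) *~ ((-1) ^+ i * binz r i)
  - \sum_(i \in [set: nat]) Y v (q + r - i%:Z) (Y u (0 + i%:Z) w)
      *~ ((-1) ^ r * (-1) ^+ i * binz r i).
Proof.
have := va_jacobi VA u v w 0 q r; rewrite [RHS](fsum_nat1 (k := 0)) => [|i i0].
  by rewrite addr0 subr0 !add0r binz0 mulr1z => <-.
by rewrite binz0n (negbTE i0) mulr0z.
Qed.

Lemma va_commutator u v w (p q : int) :
  Y u p (Y v q w) - Y v q (Y u p w) =
  \sum_(i \in [set: nat]) Y (Y u i%:Z v) (p + q - i%:Z) w *~ binz p i.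
Proof.
have := va_jacobi VA u v w p q 0.
rewrite [X in X - _](fsum_nat1 (k := 0)) => [|i i0]; last by rewrite binz0n (negbTE i0) mulr0 mulr0z.
rewrite [X in _ - X](fsum_nat1 (k := 0)) => [|i i0]; last by rewrite binz0n (negbTE i0) mulr0 mulr0z.
rewrite ?(addr0, subr0) !binz0 expr0 expr0z !mulr1 !mulr1z => ->.
by apply: eq_fsbigr => i _; rewrite add0r.
Qed.

(** The Jacobi identity on the vacuum with p = -1 and q = 0: the first sum dies by creation and the
    second keeps only v_r u_(-1) 1 = v_r u. By [va_iter_creation], x_(-1-i) 1 is the divided power
    T^i x / i! of T x = x_(-2) 1. *)
Lemma va_skew u v (r : int) : Y v r u =
  \sum_(i \in [set: nat]) Y (Y u (r + i%:Z) v) (-1 - i%:Z) vac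
    *~ (- (-1) ^ r * (-1) ^+ i).
Proof.
have := va_jacobi VA u v vac (-1) 0 r.
rewrite [X in X - _]fsbig1 => [|i _]; last by rewrite add0r va_creation // (lin0 (YLr _ _)) mul0rz.
rewrite [X in _ - X](fsum_nat1 (k := 0)) => [|[|i] // _]; last first.
  have -> : -1 + i.+1%:Z = i%:Z by lia.
  by rewrite va_creation // (lin0 (YLr _ _)) mul0rz.
rewrite sub0r ?(addr0, subr0, add0r) (va_creationN1 VA) binz0 expr0 !mulr1 => E.
have s2 : (-1) ^ r * (-1) ^ r = 1 :> int.
  by rewrite -exprzMl ?unitrN1 // mulrNN mulr1 exp1rz.
have -> : Y v r u = - (Y v r u *~ (-1) ^ r) *~ (- (-1) ^ r).
  by rewrite mulrNz mulNrz opprK -mulrzA s2 mulr1z.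
rewrite E sumMz_fsum; last first.
  have [n Yn] := va_fin u r v; exists n => i /Yn ->.
  by rewrite (lin0 (YLl _ _)) mul0rz.
apply: eq_fsbigr => i _; rewrite -mulrzA binzN1; congr (_ *~ _); ring.
Qed.

Lemma va_iter_creation u (i : nat) :
  iter i (fun x => Y x (-2) vac) u = i`!%:R *: Y u (-1 - i%:Z) vac.
Proof.
elim: i u => [|i IH] u; first by rewrite /= subr0 (va_creationN1 VA) scale1r.
rewrite iterSr IH va_iterate.
(* The vacuum has only the mode -1, so only j = i survives; its coefficient is i + 1. *)
rewrite (fsum_nat1 (k := i)) => [|j ji]; last first.
  rewrite (va_vacuum VA) ifF ?(lin0 (YLr _ _)) ?mul0rz //.
  by apply/negbTE; apply: contra_neq ji => /eqP; lia.
rewrite fsbig1 => [|j _]; last by rewrite add0r va_creation // (lin0 (YLr _ _)) mul0rz.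
rewrite subr0 (va_vacuum VA) ifT; last by apply/eqP; lia.
rewrite binzN2 mulrA -expr2 sqrr_sign mul1r factS natrM [_%:R * _]mulrC -scalerA.
by rewrite (scaler_nat i.+1) pmulrn (_ : -2 - i%:Z = -1 - i.+1%:Z) //; lia.
Qed.

Definition va_comm u v := forall m n w, Y u m (Y v n w) = Y v n (Y u m w).

(** The modes of u_r v are sums of products of modes of u and v. *)
Lemma va_comm_iter u v b r : va_comm u b -> va_comm v b -> va_comm (Y u r v) b.
Proof.
move=> ub vb q n w; rewrite !va_iterate (linB (YLr _ _)).
rewrite !(lin_fsum (YLr _ _)); try exact: va_fin2.
by congr (_ - _); apply: eq_fsbigr => i _; rewrite (linMz (YLr _ _)) ?(vb, ub).
Qed.

Lemma va_comm_vac b : va_comm vac b.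
Proof.
move=> m n w; rewrite !(va_vacuum VA); case: eqP => // _.
by rewrite (lin0 (YLr _ _)).
Qed.

Lemma va_comm_lin k u v b : va_comm u b -> va_comm v b -> va_comm (k *: u + v) b.
Proof. by move=> ub vb m n w; rewrite !YLl ub vb YLr. Qed.

Section Commutative.
Hypothesis Ycomm : va_commutative Y.

(** Write v as v_(-1) 1 and move u_n past v_(-1) onto the vacuum; commutativity and associativity of
    the product u_(-1) v below follow in the same way. *)
Lemma comm_nonneg u (n : nat) v : Y u n%:Z v = 0.
Proof.
by rewrite -[v](va_creationN1 VA) Ycomm va_creation // (lin0 (YLr _ _)).
Qed.

Lemma comm_mulC u v : Y u (-1) v = Y v (-1) u.
Proof. by rewrite -{1}[v](va_creationN1 VA) Ycomm (va_creationN1 VA). Qed.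

Lemma comm_mulA u v w : Y (Y u (-1) v) (-1) w = Y u (-1) (Y v (-1) w).
Proof. by rewrite comm_mulC Ycomm (comm_mulC w). Qed.

Lemma comm_delM u v : Y (Y u (-1) v) (-2) vac =
  Y (Y u (-2) vac) (-1) v + Y u (-1) (Y v (-2) vac).
Proof.
rewrite va_iterate [X in _ - X]fsbig1 => [|i _]; last first.
  by rewrite add0r va_creation // (lin0 (YLr _ _)) mul0rz.
(* For i >= 2 the mode -2 + i is nonnegative and kills the vacuum. *)
rewrite (fsum_nat (N := 2)) => [|[|[|i]] // _]; last first.
  have -> : -2 + i.+2%:Z = i%:Z by lia.
  by rewrite va_creation // (lin0 (YLr _ _)) mul0rz.
rewrite big_ord_recl big_ord1 lift0 !binzN1 -!expr2 !sqrr_sign !mulr1z.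
rewrite ?(subr0, addr0).
rewrite (_ : -1 - 1%N%:Z = -2) // (_ : -2 + 1%N%:Z = -1) // (va_creationN1 VA).
by rewrite addrC; congr (_ + _); rewrite -{1}[v](va_creationN1 VA) Ycomm comm_mulC.
Qed.

End Commutative.
End VertexAlgebra.

Section VaHom.
Variables (K : comNzRingType) (V W : lmodType K).
Variables (YV : V -> int -> V -> V) (vacV : V) (YW : W -> int -> W -> W) (vacW : W).
Hypotheses (VP : vertex_algebra YV vacV) (WP : vertex_algebra YW vacW).
Variable f : V -> W.
Hypothesis fL : linear f.

Lemma va_hom_iter u v r :
  (forall n w, f (YV u n w) = YW (f u) n (f w)) ->
  (forall n w, f (YV v n w) = YW (f v) n (f w)) ->
  forall n w, f (YV (YV u r v) n w) = YW (f (YV u r v)) n (f w).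
Proof.
move=> fu fv n w; rewrite fu (va_iterate VP) (va_iterate WP) (linB fL).
rewrite !(lin_fsum fL); try exact: (va_fin2 VP).
by congr (_ - _); apply: eq_fsbigr => i _; rewrite (linMz fL) ?(fu, fv).
Qed.

End VaHom.

(** * The quotient of a vertex algebra over C[h] by a polynomial *)

Section QuotVA.
Variables (C : comNzRingType) (W : lmodType {poly C}) (p : {poly C}).
Local Notation Q := (hquot W p).
Local Notation cl := (hclass (W := W) p).

Lemma hclassD : {morph cl : x y / x + y}.
Proof. by move=> x y; apply: quotmD. Qed.

Lemma hclassZ c x : cl (c%:P *: x) = c *: cl x.
Proof. exact: quotmZ. Qed.

Lemma hclass0 : cl 0 = 0.
Proof. by []. Qed.

Lemma hclassN x : cl (- x) = - cl x.
Proof. by apply: (addrI (cl x)); rewrite -hclassD !subrr. Qed.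

Lemma hclassMz x (z : int) : cl (x *~ z) = cl x *~ z.
Proof.
have Mn n : cl (x *+ n) = cl x *+ n.
  by elim: n => // n IH; rewrite !mulrS hclassD IH.
by case: z => n; rewrite ?NegzE ?mulrNz ?hclassN -!pmulrn Mn.
Qed.

Lemma hclass_repr x : cl (repr x) = x.
Proof. exact: reprK. Qed.

Lemma hclass_mul w : cl (p *: w) = 0.
Proof. by apply/eqP/quotm_eqP; rewrite subr0; apply: span_gen; exists w. Qed.

Lemma hclass_eq0 w : cl w = 0 -> exists z, w = p *: z.
Proof.
move=> /eqP/quotm_eqP; rewrite subr0.
elim=> [_ [z _ <-]||x y _ [u ->] _ [v ->]|a x _ [u ->]].
- by exists z.
- by exists 0; rewrite scaler0.
- by exists (u + v); rewrite scalerDr.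
- by exists (a *: u); rewrite scaleCA.
Qed.

Lemma hclass_eq u v : cl u = cl v -> exists z, u = v + p *: z.
Proof.
move=> E; have [|z uv] := @hclass_eq0 (u - v).
  by rewrite hclassD hclassN E subrr.
by exists z; rewrite -uv addrC subrK.
Qed.

Lemma hclass_horner c : (forall w, cl ('X *: w) = c *: cl w) ->
  forall (q : {poly C}) w, cl (q *: w) = q.[c] *: cl w.
Proof.
move=> Xc; elim/poly_ind => [|q a IH] w; first by rewrite horner0 !scale0r.
rewrite scalerDl hclassD hclassZ -scalerA IH Xc scalerA.
by rewrite hornerMXaddC scalerDl.
Qed.

Lemma hclass_fsum (F : nat -> W) : (exists n, forall i, (n <= i)%N -> F i = 0) ->
  cl (\sum_(i \in [set: nat]) F i) = \sum_(i \in [set: nat]) cl (F i).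
Proof. by apply: fsum_map => //; exact: hclassD. Qed.

Variables (Y : W -> int -> W -> W) (vac : W).
Hypothesis VA : vertex_algebra Y vac.
Local Notation qY := (@quotY C W Y p).

Lemma quotY_class u n v : qY (cl u) n (cl v) = cl (Y u n v).
Proof.
rewrite /quotY; have [z' Ez'] := hclass_eq (hclass_repr (cl v)).
have [z'' Ez''] := hclass_eq (hclass_repr (cl u)).
rewrite Ez' Ez'' (linD (va_linearl VA n _)) (linZ (va_linearl VA n _)).
rewrite hclassD hclass_mul addr0.
by rewrite (linD (va_linearr VA u n)) (linZ (va_linearr VA u n)) hclassD hclass_mul addr0.
Qed.

Lemma quot_va : vertex_algebra qY (cl vac).
Proof.
have repE x : exists u, x = cl u by exists (repr x); rewrite hclass_repr.
split.
- move=> n y k x x'; have [v ->] := repE y; have [u ->] := repE x.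
  have [u' ->] := repE x'.
  by rewrite -hclassZ -hclassD !quotY_class (va_linearl VA) hclassD hclassZ.
- move=> y n k x x'; have [v ->] := repE y; have [u ->] := repE x.
  have [u' ->] := repE x'.
  by rewrite -hclassZ -hclassD !quotY_class (va_linearr VA) hclassD hclassZ.
- move=> x y; have [u ->] := repE x; have [v ->] := repE y.
  have [N YN] := va_trunc VA u v; exists N => n /YN E.
  by rewrite quotY_class E.
- move=> n x; have [u ->] := repE x; rewrite quotY_class (va_vacuum VA).
  by case: eqP.
- by move=> x n; have [u ->] := repE x; rewrite quotY_class va_creation.
- by move=> x; have [u ->] := repE x; rewrite quotY_class va_creationN1.
- move=> x y z k q r; have [u ->] := repE x; have [v ->] := repE y.
  have [w ->] := repE z.
  have := congr1 cl (va_jacobi VA u v w k q r).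
  rewrite hclassD hclassN !hclass_fsum; try exact: (va_fin2 VA).
    move=> E; rewrite -[RHS]/(_) ; move: E.
    under eq_fsbigr do rewrite hclassMz -!quotY_class.
    under [X in _ - X]eq_fsbigr do rewrite hclassMz -!quotY_class.
    by under [RHS]eq_fsbigr do rewrite hclassMz -!quotY_class.
  have [n Yn] := va_fin VA u r v; exists n => i /Yn ->.
  by rewrite (lin0 (va_linearl VA _ _)) mul0rz.
Qed.

End QuotVA.

(** * The symbol map *)

Section Symbol.
Variables (K : comUnitRingType) (R N : lmodType K).
Variables (del : R -> R) (prd : nat -> R -> R -> R).
Hypothesis RP : vertex_lie del prd.
Hypothesis natU : forall n : nat, n.+1%:R \is a @GRing.unit K.

Local Notation br := (@lie_br K R del prd).
Local Notation sec := (fun a => lmode del a (-1)).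

Definition loop_act (phi : seq R -> N) (a : R) (n : int) : seq R -> N :=
  act br (lie_proj (del := del)) sec phi (lmode del a n).

Let brLl := lie_br_linearl RP natU.
Let brLr := lie_br_linearr RP natU.
Let projL := lie_proj_linear RP natU.
Let secL : linear sec := lmode_linear del (-1).
Let secK : cancel sec (lie_proj (del := del)) := lie_proj_lmodeN1 RP natU.

Lemma loop_act_symlin phi a n : symlin phi -> symlin (loop_act phi a n).
Proof. exact: (act_symlin brLl brLr projL secL). Qed.

(* V(R) acts on symmetric multilinear functions; evaluating at the empty word
   gives a linear map out of V(R) for each such function. *)
Lemma assoc_model_symbol (V : lmodType K) (mode : R -> int -> V -> V) (vac : V) :
  assoc_model del prd mode vac -> exists sigma : V -> (seq R -> N) -> N,
  [/\ forall phi, linear (sigma^~ phi),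
      forall phi, sigma vac phi = phi [::] &
      forall phi a n v, symlin phi ->
        sigma (mode a n v) phi = sigma v (loop_act phi a n)].
Proof.
move=> AM; pose M : lmodType K := (seq R -> N) -> N.
pose op (a : R) (n : int) (xi : M) : M :=
  fun phi => if `[< symlin phi >] then xi (loop_act phi a n) else 0.
pose D (xi : M) := forall c phi psi, symlin phi -> symlin psi ->
  xi (fun w => c *: phi w + psi w) = c *: xi phi + xi psi.
pose xi0 : M := fun phi => phi [::].
have symlin_lin c phi psi : symlin phi -> symlin psi ->
    symlin (fun w => c *: phi w + psi w : N).
  move=> [phiP phiL] [psiP psiL]; split=> [w w' ww'|w b x y].
    by rewrite (phiP _ _ ww') (psiP _ _ ww').
  by rewrite phiL psiL !scalerDr (scaleCA c); zmod.
have opE a n xi phi : symlin phi -> op a n xi phi = xi (loop_act phi a n).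
  by move=> phiS; rewrite /op asboolT.
have opN a n xi phi : ~ symlin phi -> op a n xi phi = 0.
  by move=> phiS; rewrite /op asboolF.
have actL phi n c a b : symlin phi -> loop_act phi (c *: a + b) n =
    (fun w => c *: loop_act phi a n w + loop_act phi b n w).
  move=> phiS; apply: funext => w; rewrite /loop_act (lmode_linear del n).
  exact: (act_linear brLl brLr projL secL _ phiS).
have MzE (u : M) (z : int) phi : (u *~ z) phi = u phi *~ z.
  have Mn k : (u *+ k) phi = u phi *+ k.
    by elim: k => // k IH; rewrite !mulrS -IH.
  by case: z => k; rewrite ?NegzE ?mulrNz -!pmulrn -Mn.
have sumE n (f : 'I_n -> M) phi : (\sum_(i < n) f i) phi = \sum_(i < n) f i phi.
  by elim/big_rec2: _ => // i _ u _ <-.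
have xactL x phi : D x -> symlin phi ->
    linear (fun l => x (act br (lie_proj (del := del)) sec phi l)).
  move=> Dx phiS c l l'; rewrite -Dx; try exact: (act_symlin brLl brLr projL secL).
  by congr x; apply: funext => w; apply: (act_linear brLl brLr projL secL _ phiS).
have opLa n x : D x -> linear (fun a => op a n x).
  move=> Dx k a b; apply: funext => phi.
  rewrite -[RHS]/(k *: op a n x phi + op b n x phi).
  case: (pselect (symlin phi)) => phiS; last by rewrite !opN // scaler0 addr0.
  by rewrite !opE // actL // Dx //; apply: loop_act_symlin.
have opdel a n x : D x -> op (del a) n x = - op a (n - 1) x *~ n.
  move=> Dx; apply: funext => phi.
  rewrite MzE -[(- _) phi]/(- op a (n - 1) x phi).
  case: (pselect (symlin phi)) => phiS; last by rewrite !opN // oppr0 mul0rz.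
  rewrite !opE // /loop_act (lmode_del RP).
  by rewrite (linMz (xactL x phi Dx phiS)) (linN (xactL x phi Dx phiS)).
have [|||||||||F [FL FD F0 Fm]] := am_lift AM (M := M) (op := op) (D := D) (m0 := xi0).
- move=> x y Dx Dy c phi psi phiS psiS.
  by rewrite -![(x + y) _]/(x _ + y _) Dx // Dy // scalerDr addrACA.
- move=> k x Dx c phi psi phiS psiS.
  by rewrite -![(k *: x) _]/(k *: x _) Dx // scalerDr scaleCA.
- move=> a n x Dx c phi psi phiS psiS; rewrite !opE //; last exact: symlin_lin.
  rewrite -Dx; try exact: loop_act_symlin.
  by congr x; apply: funext => w; rewrite /loop_act act_linear_fun.
- move=> a n k x y Dx Dy; apply: funext => phi.
  rewrite -[RHS]/(k *: op a n x phi + op a n y phi).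
  case: (pselect (symlin phi)) => phiS; first by rewrite !opE.
  by rewrite !opN // scaler0 addr0.
- exact: opLa.
- exact: opdel.
- move=> a m b n x Dx.
  have [N0 ab0] := vl_C0 RP a b.
  have op0 i k : (N0 <= i)%N -> op (prd i a b) k x = 0.
    by move=> Ni; rewrite ab0 // (lin0 (opLa k x Dx)).
  rewrite (fsum_nat (N := N0)) => [|i Ni]; last by rewrite op0 ?mul0rz.
  apply: funext => phi; rewrite sumE.
  rewrite -[LHS]/(op a m (op b n x) phi - op b n (op a m x) phi).
  case: (pselect (symlin phi)) => phiS; last first.
    rewrite !opN // subrr big1 // => i _.
    by rewrite MzE opN // mul0rz.
  have aS c k : symlin (loop_act phi c k) by apply: loop_act_symlin.
  (* The coefficient 1 gives the relation the shape in which membership in [D] provides linearity of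
     [x]. *)
  rewrite !opE // (_ : loop_act (loop_act phi a m) b n = (fun w =>
     1 *: loop_act (loop_act phi b n) a m w + act br (lie_proj (del := del)) sec phi
       (br (lmode del a m) (lmode del b n)) w)); last first.
    apply: funext => w; rewrite scale1r.
    exact: (act_comm natU brLl brLr (lie_br_skew RP natU) (lie_br_jacobi RP natU)
      projL secL secK (lie_proj_br RP natU)).
  rewrite Dx; [|exact: loop_act_symlin|exact: (act_symlin brLl brLr projL secL)].
  rewrite scale1r addrAC subrr add0r (lie_br_lmode RP natU).
  rewrite (loop_brE del m n ab0) (lin_sum (xactL x phi Dx phiS)).
  apply: eq_bigr => i _; rewrite (linMz (xactL x phi Dx phiS)).
  by rewrite MzE opE.
- by [].
- move=> a n; apply: funext => phi.
  case: (pselect (symlin phi)) => phiS; last by rewrite opN.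
  rewrite opE //; apply: act_nil => //.
  by rewrite (lie_proj_lmode RP natU).
exists F; split.
- by move=> phi k v w; rewrite FL.
- by move=> phi; rewrite F0.
- by move=> phi a n v phiS; rewrite Fm opE.
Qed.

Lemma lie_br_divisible (t : K) : (forall n a b, exists c, prd n a b = t *: c) ->
  forall x y : lieL del, exists z, br x y = t *: z.
Proof.
move=> prdt x y; elim/lieL_ind: x => [|x x' [z Hz] [z' Hz']|a m].
- by exists 0; rewrite (lin0 (brLl _)) scaler0.
- by exists (z + z'); rewrite (linD (brLl _)) Hz Hz' scalerDr.
elim/lieL_ind: y => [|y y' [z Hz] [z' Hz']|b n].
- by exists 0; rewrite (lin0 (brLr _)) scaler0.
- by exists (z + z'); rewrite (linD (brLr _)) Hz Hz' scalerDr.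
have [N0 ab0] := vl_C0 RP a b; rewrite (lie_br_lmode RP natU) (loop_brE del m n ab0).
elim/big_ind: _ => [|_ _ [u ->] [v ->]|i _].
- by exists 0; rewrite scaler0.
- by exists (u + v); rewrite scalerDr.
have [c ->] := prdt i a b; exists (lmode del c (m + n - i%:Z) *~ binz m i).
by rewrite (linZ (lmode_linear _ _)) scalerMzr.
Qed.

(* Every correction term contains a bracket, hence a factor t. *)
Lemma symbol_leading (t : K) (V : lmodType K) (mode : R -> int -> V -> V) (vac : V)
    (sigma : V -> (seq R -> N) -> N) :
  (forall n a b, exists c, prd n a b = t *: c) ->
  (forall phi, sigma vac phi = phi [::]) ->
  (forall phi a n v, symlin phi ->
     sigma (mode a n v) phi = sigma v (loop_act phi a n)) ->
  forall l phi, symlin phi ->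
  exists z, sigma (foldr (fun a v => mode a (-1) v) vac l) phi = phi l + t *: z.
Proof.
move=> prdt sigma0 sigmaM; elim=> [|a l IH] phi phiS.
  by exists 0; rewrite scaler0 addr0.
have [z Hz] := IH _ (loop_act_symlin a (-1) phiS).
have [u Hu] := corr_sec_divisible natU brLl brLr projL secL secK a l
  (lie_br_divisible prdt) phiS.
exists (u + z); rewrite /= sigmaM // Hz /loop_act (act_sec br secK phi a l) Hu.
by rewrite scalerDr addrA.
Qed.

End Symbol.

(** * Generation of the symmetric algebra by monomials *)

Section SymFacts.
Variables (K : comNzRingType) (M : lmodType K).
Local Notation S := (sym M).
Local Notation gen := (@symgen K M).

Lemma symgen_linear : linear gen.
Proof.
move=> k x y.
rewrite -[RHS]/(padd (pmul (\pi_(palg _) _) (\pi_(palg _) _)) (\pi_(palg _) _)).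
rewrite pi_pmul pi_padd; apply/eqP/palg_eqP.
apply: acong_trans (acong_rel (sym_relD _ _)) _.
by apply: acong_add; [apply: acong_rel; apply: sym_relZ|apply: acong_refl].
Qed.

Definition symprod (l : seq M) : S := foldr (fun a u => gen a * u) 1 l.

Lemma sym_span u : Defs.span (range symprod) u.
Proof.
suff H t v : Defs.span (range symprod) v -> Defs.span (range symprod) (\pi_(palg _) t * v : S).
  elim/quotW: u => t; rewrite -[\pi t]mulr1; apply: H.
  by apply: span_gen; exists [::].
elim: t v => [a|k|t IHt t' IHt'|t IHt t' IHt'] v Sv.
- rewrite -[\pi_(palg _) _]/(gen a).
  elim: Sv => [_ [l _ <-]||x y _ Hx _ Hy|c x _ Hx].
  + by apply: span_gen; exists (a :: l).
  + by rewrite mulr0; apply: span_0.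
  + by rewrite mulrDr; apply: span_D.
  + rewrite (_ : _ * _ = c *: (gen a * x)); first exact: span_Z.
    exact: esym (scalerAr c (gen a) x).
- by rewrite -[_ * v]/(k *: v); apply: span_Z.
- rewrite -pi_padd -[padd _ _]/(_ + _ : S) mulrDl.
  by apply: span_D; [apply: IHt|apply: IHt'].
- rewrite -pi_pmul -[pmul _ _]/(_ * _ : S) -mulrA.
  exact/IHt/IHt'.
Qed.

Lemma sym_ind (P : S -> Prop) : (forall l, P (symprod l)) ->
  (forall u v, P u -> P v -> P (u + v)) -> (forall k u, P u -> P (k *: u)) ->
  forall u, P u.
Proof.
move=> Pp PD PZ u; elim: (sym_span u) => [_ [l _ <-]||x y _ Hx _ Hy|c x _ Hx].
- exact: Pp.
- by rewrite -(scale0r (symprod [::])); apply: PZ.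
- exact: PD.
- exact: PZ.
Qed.

End SymFacts.

Lemma foldr_perm (A : eqType) (T : Type) (f : A -> T -> T) t0 :
  (forall a b t, f a (f b t) = f b (f a t)) ->
  forall w w', perm_eq w w' -> foldr f t0 w = foldr f t0 w'.
Proof.
move=> fC; elim=> [|a w IH] w'; first by rewrite perm_sym => /perm_nilP ->.
move=> aw; have : a \in w' by rewrite -(perm_mem aw) mem_head.
move=> aw'; move: aw; case/splitPr: aw' => p1 p2 aw.
have -> : foldr f t0 (p1 ++ a :: p2) = foldr f t0 (a :: p1 ++ p2).
  by elim: p1 {aw} => //= b p1 ->; rewrite fC.
rewrite /= (IH (p1 ++ p2)) // -(perm_cons a) (permPl aw).
by rewrite -cat_cons -cat1s perm_catCA.
Qed.

(** * The quotient at h = 1 *)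

(* A C-module regarded as a C[h]-module on which h acts as 1. *)
Definition at1 (C : comNzRingType) (V : lmodType C) := V : Type.

Section At1.
Variables (C : comNzRingType) (V : lmodType C).
HB.instance Definition _ := GRing.Zmodule.on (at1 V).

Definition at1_scale (p : {poly C}) (v : at1 V) : at1 V := p.[1] *: (v : V).

Lemma at1_scaleA p q v : at1_scale p (at1_scale q v) = at1_scale (p * q) v.
Proof. by rewrite /at1_scale scalerA hornerM. Qed.
Lemma at1_scale1 : left_id 1 at1_scale.
Proof. by move=> v; rewrite /at1_scale hornerE scale1r. Qed.
Lemma at1_scaleDr : right_distributive at1_scale +%R.
Proof. by move=> p v w; rewrite /at1_scale scalerDr. Qed.
Lemma at1_scaleDl v : {morph at1_scale^~ v : p q / p + q}.
Proof. by move=> p q; rewrite /at1_scale hornerD scalerDl. Qed.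

HB.instance Definition _ := GRing.Zmodule_isLmodule.Build {poly C} (at1 V)
  at1_scaleA at1_scale1 at1_scaleDr at1_scaleDl.

Lemma at1_scaleE (p : {poly C}) (v : at1 V) : p *: v = p.[1] *: (v : V) :> V.
Proof. by []. Qed.

End At1.

Lemma at1_linear (C : comNzRingType) (V W : lmodType C) (f : V -> W) :
  linear f -> linear (f : at1 V -> at1 W).
Proof. by move=> fL p v w; apply: fL. Qed.

Lemma poly_natU (C : fieldType) : (forall n : nat, n.+1%:R \is a @GRing.unit C) ->
  forall n : nat, n.+1%:R \is a @GRing.unit {poly C}.
Proof. by move=> natC n; rewrite -(rmorph_nat (@polyC C)) rmorph_unit. Qed.

Section EvalAtOne.
Variables (C : fieldType) (R : lmodType C).

(** Evaluation at h = 1, which is C[h]-linear as a map to [at1 R]. *)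
Definition hsum (f : hpoly R) : R := fsext (fun _ a => a) f.

Lemma hsum_fin (f : hpoly R) : exists N, forall i, (N <= i)%N -> f i = 0.
Proof.
have /(finite_natP (fun n => _ <> 0))[N fN] := fsvalP f.
by exists N => i /fN/contrapT.
Qed.

Lemma hsum_linear : linear (hsum : hpoly R -> at1 R).
Proof.
apply: hpoly_linear => [f g|f|c f]; first exact: (fsextD (fun _ => fun _ _ => erefl)).
- have [N fN] := hsum_fin f; rewrite at1_scaleE hornerX scale1r.
  rewrite /hsum /fsext (fsum_nat (N := N.+1)) => [|[|i] // Ni]; last first.
    by rewrite hscaleX fN.
  rewrite (fsum_nat (N := N)) // big_ord_recl hscaleX add0r.
  by apply: eq_bigr => i _; rewrite hscaleX lift0.
- have [N fN] := hsum_fin f; rewrite at1_scaleE hornerC.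
  rewrite /hsum /fsext !(fsum_nat (N := N)) //; last first.
    by move=> i Ni; rewrite hscaleC fN // scaler0.
  by rewrite scaler_sumr; apply: eq_bigr => i _; rewrite hscaleC.
Qed.

Lemma hsum_const a : hsum (hconst a) = a.
Proof. exact: (fsext_single (Phi := fun _ x => x)). Qed.

Variables (del : R -> R) (prd : nat -> R -> R -> R).
Hypothesis RP : vertex_lie del prd.

Lemma hsum_ext f : hsum (hext del f) = del (hsum f).
Proof.
have delL := vl_del_linear RP.
rewrite /hsum /fsext (lin_fsum delL (hsum_fin f)).
by apply: eq_fsbigr => i _; rewrite hextE.
Qed.

Lemma hsum_prd n f g : hsum (hprd prd n f g) = prd n (hsum f) (hsum g).
Proof.
have prdLl b : linear (prd n ^~ b) := vl_linearl RP n b.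
have prdLr a : linear (prd n a) := vl_linearr RP n a.
apply/eqP; rewrite -subr_eq0; apply/eqP.
pose F1 g f : at1 R := hsum (hprd prd n f g) - prd n (hsum f) (hsum g).
have F1L g' : linear (F1 g').
  apply: linear_sub; first exact: (linear_comp hsum_linear (hprd_linearl RP n g')).
  exact: (linear_comp (at1_linear (prdLl (hsum g'))) hsum_linear).
have F2L f' : linear (F1^~ f').
  apply: linear_sub; first exact: (linear_comp hsum_linear (hprd_linearr RP n f')).
  exact: (linear_comp (at1_linear (prdLr (hsum f'))) hsum_linear).
apply: (hpoly_lin0 (F1L g)) => a; apply: (hpoly_lin0 (F2L (hconst a))) => b.
rewrite /F1 (hprd_const RP) (linZ hsum_linear) at1_scaleE hornerX scale1r.
by rewrite !hsum_const subrr.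
Qed.

End EvalAtOne.

Lemma assocVh_model (C : fieldType) (R : lmodType C) (del : R -> R)
    (prd : nat -> R -> R -> R) :
  vertex_lie del prd -> (forall n : nat, n.+1%:R \is a @GRing.unit C) ->
  assoc_model (hext del) (hprd prd) (V := assocVh del prd)
    (@assoc_mode {poly C} (hpoly R) (hext del) (hprd prd)) (assoch_vac del prd).
Proof.
move=> RP natC; have natU := poly_natU natC.
exact: (assocV_model (hvertex_lie RP natC) natU).
Qed.

Section AtOne.
Variables (C : fieldType) (R : lmodType C).
Variables (del : R -> R) (prd : nat -> R -> R -> R).
Hypothesis natC : forall n : nat, n.+1%:R \is a @GRing.unit C.
Hypothesis RP : vertex_lie del prd.

Variables (V : lmodType C) (mode : R -> int -> V -> V) (vac : V).
Hypothesis VM : assoc_model del prd mode vac.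
Variable YV : V -> int -> V -> V.
Hypothesis VA : vertex_algebra YV vac.
Hypothesis YVmode : forall a n v, YV (mode a (-1) vac) n v = mode a n v.

Variables (W : lmodType {poly C}) (hmode : hpoly R -> int -> W -> W) (hvac : W).
Hypothesis WM : assoc_model (hext del) (hprd prd) hmode hvac.
Variable Yh : W -> int -> W -> W.
Hypothesis hVA : vertex_algebra Yh hvac.
Hypothesis Yhmode : forall f n v, Yh (hmode f (-1) hvac) n v = hmode f n v.

Local Notation Q := (hquot W ('X - 1)).
Local Notation cl := (hclass (W := W) ('X - 1)).
Local Notation qY := (@quotY C W Yh ('X - 1)).
Local Notation hemb a := (hmode (hconst a) (-1) hvac).

Let hRP := hvertex_lie RP natC.
Let QVA := quot_va ('X - 1) hVA.

Lemma hclassX1 (w : W) : cl ('X *: w) = cl w.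
Proof.
have E : 'X *: w = w + ('X - 1) *: w by rewrite scalerBl scale1r addrC subrK.
by rewrite E hclassD hclass_mul addr0.
Qed.

Lemma hclass_horner1 (q : {poly C}) (w : W) : cl (q *: w) = q.[1] *: cl w.
Proof. by apply: hclass_horner => v; rewrite hclassX1 scale1r. Qed.

Definition mode1 (a : R) (n : int) (x : Q) : Q := qY (cl (hemb a)) n x.

Lemma mode1_class a n w : mode1 a n (cl w) = cl (hmode (hconst a) n w).
Proof. by rewrite /mode1 (quotY_class _ hVA) Yhmode. Qed.

Lemma hclass_at1 : linear (cl : W -> at1 Q).
Proof. by move=> p v w; rewrite hclassD hclass_horner1. Qed.

Lemma mode1_linearl n x : linear (fun a => mode1 a n x).
Proof.
move=> k a b; rewrite -(hclass_repr x) !mode1_class hconst_linear.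
by rewrite (am_linearl WM n _) hclassD hclassZ.
Qed.

Lemma mode1_linear a n : linear (mode1 a n).
Proof. exact: va_linearr QVA _ n. Qed.

(** Both sides are C[h]-linear in f with values in [at1 Q], and they agree on constants. *)
Lemma hclass_hmode f n w : cl (hmode f n w) = mode1 (hsum f) n (cl w).
Proof.
apply/eqP; rewrite -subr_eq0; apply/eqP.
pose F f : at1 Q := cl (hmode f n w) - mode1 (hsum f) n (cl w).
have FL : linear F.
  apply: linear_sub.
    exact: (linear_comp hclass_at1 (am_linearl WM n w)).
  exact: (linear_comp (at1_linear (mode1_linearl n (cl w))) (@hsum_linear C R)).
move: f; apply: (hpoly_lin0 FL) => a.
by rewrite /F hsum_const mode1_class subrr.
Qed.

Lemma mode1_vac a (n : nat) : mode1 a n (cl hvac) = 0.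
Proof.
by rewrite mode1_class (am_vac WM).
Qed.

Lemma mode1_del a n x : mode1 (del a) n x = - mode1 a (n - 1) x *~ n.
Proof.
rewrite -(hclass_repr x) !mode1_class -hclassN -hclassMz.
rewrite -(hext_const (vl_del_linear RP)); by rewrite (am_del WM).
Qed.

Lemma mode1_comm a m b n x : mode1 a m (mode1 b n x) - mode1 b n (mode1 a m x) =
  \sum_(i \in [set: nat]) mode1 (prd i a b) (m + n - i%:Z) x *~ binz m i.
Proof.
rewrite -(hclass_repr x) !mode1_class -hclassN -hclassD.
rewrite (am_comm WM) hclass_fsum; last first.
  have [N abN] := vl_C0 hRP (hconst a) (hconst b); exists N => i /abN ->.
  by rewrite (lin0 (am_linearl WM _ _)) mul0rz.
apply: eq_fsbigr => i _; rewrite hclassMz hclass_hmode (hsum_prd RP).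
by rewrite !hsum_const.
Qed.

Theorem va_iso_at1 : exists! f : V -> Q,
  va_iso YV vac qY (cl hvac) f /\ (forall a, f (mode a (-1) vac) = cl (hemb a)).
Proof.
have [|||||||||f [fL _ fv fm]] := am_lift VM (M := Q) (op := mode1)
    (D := fun=> True) (m0 := cl hvac) => //.
- by move=> a n k x y _ _; apply: mode1_linear.
- by move=> n x _; apply: mode1_linearl.
- by move=> a n x _; apply: mode1_del.
- by move=> a m b n x _; apply: mode1_comm.
- exact: mode1_vac.
pose op (g : hpoly R) (n : int) (v : at1 V) : at1 V := mode (hsum g) n v.
have [|||||||||B [BL _ Bv Bm]] := am_lift WM (M := at1 V) (op := op)
    (D := fun=> True) (m0 := vac) => //.
- by move=> g n k x y _ _; apply: (at1_linear (am_linear VM _ n)).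
- move=> n x _.
  exact: (linear_comp (at1_linear (am_linearl VM n x)) (@hsum_linear C R)).
- by move=> g n x _; rewrite /op (hsum_ext RP) (am_del VM).
- move=> g m g' n x _; rewrite /op [LHS](am_comm VM).
  by apply: eq_fsbigr => i _; rewrite (hsum_prd RP).
- by move=> g n; apply: (am_vac VM).
have femb a : f (mode a (-1) vac) = cl (hemb a).
  by rewrite fm fv mode1_class.
have fB w : f (B w) = cl w.
  elim/(am_ind WM): w => [|v w Hv Hw|k v Hv|g n v Hv].
  - by rewrite Bv fv.
  - by rewrite (linD BL) (linD fL) Hv Hw -hclassD.
  - by rewrite (linZ BL) at1_scaleE (linZ fL) Hv -hclass_horner1.
  - by rewrite Bm fm Hv -hclass_hmode.
pose B' (x : Q) : V := B (repr x).
have B'E w : B' (cl w) = B w.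
  rewrite /B'; have [u ->] := hclass_eq (hclass_repr (cl w)).
  rewrite (linD BL) (linZ BL) at1_scaleE hornerD hornerN hornerX hornerC.
  by rewrite subrr scale0r addr0.
have B'L : linear B'.
  move=> k x y; rewrite -(hclass_repr x) -(hclass_repr y) -hclassZ -hclassD !B'E.
  by rewrite (linD BL) (linZ BL) at1_scaleE hornerC.
have B'f v : B' (f v) = v.
  elim/(am_ind VM): v => [|v w Hv Hw|k v Hv|a n v Hv].
  - by rewrite fv B'E Bv.
  - by rewrite (linD fL) (linD B'L) Hv Hw.
  - by rewrite (linZ fL) (linZ B'L) Hv.
  - by rewrite fm -{2}Hv -(hclass_repr (f v)) mode1_class !B'E Bm /op hsum_const.
exists f; split; first split=> //.
  split=> //.
  - exists B' => // x; by rewrite -(hclass_repr x) B'E fB.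
  - move=> u; elim/(am_ind VM): u => [|u v Hu Hv|k u Hu|a m u Hu] n v'.
    + by rewrite fv (va_vacuum VA) (va_vacuum QVA); case: eqP => // _; apply: (lin0 fL).
    + rewrite (linD (va_linearl VA n v')) !(linD fL) Hu Hv.
      by rewrite (linD (va_linearl QVA n _)).
    + rewrite (linZ (va_linearl VA n v')) !(linZ fL) Hu.
      by rewrite (linZ (va_linearl QVA n _)).
    + rewrite -YVmode; apply: (va_hom_iter VA QVA fL) => // k w.
      by rewrite YVmode fm femb.
move=> g [[gL _ gv gY] gemb]; apply: funext.
elim/(am_ind VM) => [|u v Hu Hv|k u Hu|a m u Hu].
- by rewrite fv gv.
- by rewrite (linD fL) (linD gL) Hu Hv.
- by rewrite (linZ fL) (linZ gL) Hu.
- by rewrite fm Hu -[in RHS]YVmode gY gemb.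
Qed.

End AtOne.

(** * The quotient at h = 0 *)

(** [sym_relC] is imposed on arbitrary terms, so commutation has to be carried over from generators
    to terms. *)
Lemma taction_commute (K : comNzRingType) (X : Type) (M : lmodType K)
    (op : X -> M -> M) :
  (forall x, linear (op x)) -> (forall x y m, op x (op y m) = op y (op x m)) ->
  forall s t m, taction op s (taction op t m) = taction op t (taction op s m).
Proof.
move=> opL opC.
have tL t : linear (taction op t).
  move=> k m m'; apply: (taction_linear (D := fun=> True)) => // x k' u v _ _.
  exact: opL.
have xC x t m : op x (taction op t m) = taction op t (op x m).
  elim: t m => [y|k|t IHt u IHu|t IHt u IHu] m /=.
  - exact: opC.
  - by rewrite (linZ (opL x)).
  - by rewrite (linD (opL x)) IHt IHu.
  - by rewrite IHt IHu.
elim=> [x|k|s IHs u IHu|s IHs u IHu] t m /=.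
- exact: xC.
- by rewrite (linZ (tL t)).
- by rewrite (linD (tL t)) IHs IHu.
- by rewrite IHu IHs.
Qed.

Section SymPoly.
Variables (C : fieldType) (R : lmodType C).
Local Notation S := (sym R).

Definition mulgen (a : R) (u : S) : S := symgen a * u.

Lemma mulgen_linearl u : linear (mulgen^~ u).
Proof.
by move=> k a b; rewrite /mulgen symgen_linear mulrDl -[in LHS]palg_scalerAl.
Qed.

Lemma mulgen_linearr a : linear (mulgen a).
Proof.
move=> k u v; rewrite /mulgen mulrDr; congr (_ + _).
by symmetry; apply: (scalerAr k (symgen a) u).
Qed.

(** The product of a word in S(R)[h], the universal symmetric multilinear function; evaluating the
    symbol at it gives a map from V_h(R) to S(R)[h]. *)
Definition prodh (w : seq (hpoly R)) : hpoly S := foldr (hconv mulgen) (hconst 1) w.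

Let convLl := hconv_linearl mulgen_linearl mulgen_linearr.
Let convLr := hconv_linearr mulgen_linearl mulgen_linearr.

Lemma prodh_symlin : symlin (K := {poly C}) prodh.
Proof.
split=> [|w]; last exact: convLl.
apply: foldr_perm => f g u; apply/eqP; rewrite -subr_eq0; apply/eqP.
move: f; apply: hpoly_lin0.
  by apply: linear_sub; [apply: convLl|apply: linear_comp (convLr _) (convLl _)].
move=> a; move: g; apply: hpoly_lin0.
  by apply: linear_sub; [apply: linear_comp (convLr _) (convLl _)|apply: convLl].
move=> b; move: u; apply: hpoly_lin0.
  by apply: linear_sub; apply: linear_comp.
move=> u; rewrite !(hconv_const mulgen_linearl mulgen_linearr) /mulgen.
by rewrite mulrCA subrr.
Qed.

Lemma prodh_const l : prodh (map (@hconst C R) l) = hconst (symprod l).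
Proof.
elim: l => //= a l IH.
by rewrite /prodh /= -/(prodh _) IH (hconv_const mulgen_linearl mulgen_linearr).
Qed.

End SymPoly.

Section AtZero.
Variables (C : fieldType) (R : lmodType C).
Variables (del : R -> R) (prd : nat -> R -> R -> R).
Hypothesis natC : forall n : nat, n.+1%:R \is a @GRing.unit C.
Hypothesis RP : vertex_lie del prd.

Variables (W : lmodType {poly C}) (hmode : hpoly R -> int -> W -> W) (hvac : W).
Hypothesis WM : assoc_model (hext del) (hprd prd) hmode hvac.
Variable Yh : W -> int -> W -> W.
Hypothesis hVA : vertex_algebra Yh hvac.
Hypothesis Yhmode : forall f n v, Yh (hmode f (-1) hvac) n v = hmode f n v.

Local Notation Q := (hquot W 'X).
Local Notation cl := (hclass (W := W) 'X).
Local Notation qY := (@quotY C W Yh 'X).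
Local Notation hemb a := (hmode (hconst a) (-1) hvac).
Local Notation S := (sym R).

Let hRP := hvertex_lie RP natC.
Let natU := poly_natU natC.
Let QVA := quot_va 'X hVA.

Let YLl n v : linear (fun u => Yh u n v) := va_linearl hVA n v.
Let YLr u n : linear (Yh u n) := va_linearr hVA u n.
Let qLl n v : linear (fun u => qY u n v) := va_linearl QVA n v.
Let qLr u n : linear (qY u n) := va_linearr QVA u n.

Lemma hclass_horner0 (q : {poly C}) (w : W) : cl (q *: w) = q.[0] *: cl w.
Proof. by apply: hclass_horner => v; rewrite hclass_mul scale0r. Qed.

Lemma hmode_const0 f n w : cl (hmode f n w) = cl (hmode (hconst (f 0%N)) n w).
Proof.
have [g {1}->] := hpoly_split f.
rewrite (linD (am_linearl WM n w)) (linZ (am_linearl WM n w)).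
by rewrite hclassD hclass_mul addr0.
Qed.

Lemma hprd_divisible n f g : exists k, hprd prd n f g = 'X *: k.
Proof. by exists (hext2 (prd n) f g). Qed.

Lemma hmode_comm0 f m g n w : cl (hmode f m (hmode g n w)) = cl (hmode g n (hmode f m w)).
Proof.
apply/eqP; rewrite -subr_eq0 -hclassN -hclassD (am_comm WM); apply/eqP.
rewrite hclass_fsum; last first.
  have [N fgN] := vl_C0 hRP f g; exists N => i /fgN ->.
  by rewrite (lin0 (am_linearl WM _ _)) mul0rz.
apply: fsbig1 => i _; have [k ->] := hprd_divisible i f g.
by rewrite hclassMz (linZ (am_linearl WM _ _)) hclass_mul mul0rz.
Qed.

(** Modes of R[h] commute modulo h because their commutators are divisible by h. [va_comm_iter]
    extends commutation in the left argument only, so it is used twice, with the arguments exchanged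
    in between. *)
Theorem quot_commutative : va_commutative qY.
Proof.
have ind (P : Q -> Prop) : P (cl hvac) ->
    (forall k x y, P x -> P y -> P (k *: x + y)) ->
    (forall f r x, P x -> P (qY (cl (hmode f (-1) hvac)) r x)) -> forall x, P x.
  move=> P0 PL Pm x; rewrite -(hclass_repr x).
  have P00 : P 0.
    by have := PL (-1) _ _ P0 P0; rewrite scaleN1r addNr.
  elim/(am_ind WM): (repr x) => [//|u v Hu Hv|k u Hu|f n u Hu].
  - by rewrite hclassD -[cl u]scale1r; apply: PL.
  - by rewrite hclass_horner0 -[_ *: _]addr0; apply: PL.
  - by rewrite -Yhmode -(quotY_class _ hVA); apply: Pm.
have gg f g : va_comm qY (cl (hmode f (-1) hvac)) (cl (hmode g (-1) hvac)).
  move=> m n x; rewrite -(hclass_repr x) !(quotY_class _ hVA) !Yhmode.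
  exact: hmode_comm0.
have xg g x : va_comm qY x (cl (hmode g (-1) hvac)).
  elim/ind: x => [|k x y Hx Hy|f r x Hx].
  - exact: va_comm_vac QVA _.
  - exact: va_comm_lin QVA _ _ _ _ Hx Hy.
  - exact: va_comm_iter QVA _ _ _ _ (gg f g) Hx.
suff xy x y : va_comm qY x y by [].
elim/ind: x => [|k x z Hx Hz|f r x Hx].
- exact: va_comm_vac QVA _.
- exact: va_comm_lin QVA _ _ _ _ Hx Hz.
- apply: (va_comm_iter QVA) => // m n w.
  by rewrite xg.
Qed.

Let qN := comm_nonneg QVA quot_commutative.
Let qA := comm_mulA QVA quot_commutative.

(** In the commutative quotient all nonnegative products vanish, so u_n v lies in hW; this is what
    gives (1/h) u_n v a meaning. *)
Lemma Yh_divisible u (n : nat) v : exists d, 'X *: d = Yh u n v.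
Proof.
have [|z ->] := @hclass_eq0 _ _ 'X (Yh u n v); last by exists z.
by rewrite -(quotY_class _ hVA) qN.
Qed.

Local Notation memb a := (cl (hemb a)).

Lemma memb_linear : linear (fun a => memb a).
Proof.
by move=> k a b; rewrite hconst_linear (am_linearl WM) hclassD hclassZ.
Qed.

Lemma memb_class a n w : qY (memb a) n (cl w) = cl (hmode (hconst a) n w).
Proof. by rewrite (quotY_class _ hVA) Yhmode. Qed.

Let symop (a : R) (x : Q) : Q := qY (memb a) (-1) x.

Let symop_linear a : linear (symop a) := qLr _ _.

Let symop_rel t u : sym_rel t u -> forall m, True -> taction symop t m = taction symop u m.
Proof.
case=> [x y|k x|s v] m _ /=.
- by rewrite /symop (linD memb_linear) (linD (qLl _ _)).
- by rewrite /symop (linZ memb_linear) (linZ (qLl _ _)).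
- apply: taction_commute => // a b z; exact: quot_commutative.
Qed.

(** S(R) acts on W/hW with a in R acting by a_(-1); the map is the orbit of the vacuum under this
    action. *)
Definition symmap (s : S) : Q := pact symop s (cl hvac).
Local Notation g := symmap.

Lemma symmap_linear : linear g.
Proof.
move=> k s t; rewrite /symmap.
rewrite [LHS](pactD (D := fun=> True) _ _ _ _ symop_rel) //; last first.
  by move=> x k' u v _ _; apply: symop_linear.
congr (_ + _); apply: (pactZ (D := fun=> True) _ _ _ _ symop_rel) => //.
by move=> x k' u v _ _; apply: symop_linear.
Qed.

Lemma symmap1 : g 1 = cl hvac.
Proof.
apply: (pact1 (D := fun=> True) _ _ _ _ symop_rel) => //.
by move=> x k' u v _ _; apply: symop_linear.
Qed.

Lemma symmap_gen a s : g (symgen a * s) = qY (memb a) (-1) (g s).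
Proof.
rewrite /symmap [LHS](pactM (D := fun=> True) _ _ _ _ symop_rel) //; last first.
  by move=> x k' u v _ _; apply: symop_linear.
apply: (pact_gen (D := fun=> True) _ _ _ _ symop_rel) => //.
by move=> x k' u v _ _; apply: symop_linear.
Qed.

Lemma symmap_emb a : g (symgen a) = memb a.
Proof. by rewrite -[symgen a]mulr1 symmap_gen symmap1 (va_creationN1 QVA). Qed.

Lemma symmapM s t : g (s * t) = qY (g s) (-1) (g t).
Proof.
elim/sym_ind: s => [l|u v Hu Hv|k u Hu].
- elim: l => [|a l IH] /=; first by rewrite mul1r symmap1 (va_vacuum QVA).
  by rewrite -mulrA !symmap_gen IH qA.
- by rewrite mulrDl !(linD symmap_linear) Hu Hv (linD (qLl _ _)).
- rewrite (_ : _ * t = k *: (u * t)); last exact: esym (scalerAl k u t).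
  by rewrite !(linZ symmap_linear) Hu (linZ (qLl _ _)).
Qed.

Lemma iter_hext_const j a : iter j (hext del) (hconst a) = hconst (iter j del a).
Proof.
elim: j => //= j ->; exact: (hext_const (vl_del_linear RP)).
Qed.

Lemma symmap_surj x : exists s, g s = x.
Proof.
rewrite -(hclass_repr x).
elim/(am_ind WM): (repr x) => [|u v [s Hs] [t Ht]|k u [s Hs]|f n u [s Hs]].
- by exists 1; rewrite symmap1.
- by exists (s + t); rewrite (linD symmap_linear) Hs Ht -hclassD.
- by exists (k.[0] *: s); rewrite (linZ symmap_linear) Hs -hclass_horner0.
rewrite hmode_const0 -memb_class; set a := f 0%N.
case: n => n; first by exists 0; rewrite (lin0 symmap_linear) qN.
(* The mode a(-n-1) is the mode -1 of del^n a / n!, and nonnegative modes vanish modulo h. *)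
exists ((n`!%:R)^-1 *: (symgen (iter n del a) * s)).
rewrite (linZ symmap_linear) symmap_gen Hs !memb_class -iter_hext_const.
rewrite (iter_del_modes (Phi := fun f m => hmode f m u)); last first.
  by move=> f' m; apply: (am_del WM).
rewrite binzN1 -expr2 sqrr_sign mulr1z hclass_horner0.
rewrite (_ : (n`!%:R : {poly C}).[0] = n`!%:R); last first.
  by rewrite -(rmorph_nat (@polyC C)) hornerC.
rewrite scalerA mulVr ?fact_unit // scale1r.
by rewrite (_ : -1 - n%:Z = Negz n) // NegzE; lia.
Qed.

(** [k] is the coefficient of h^0 in the symbol. It kills torsion because h u = 0 makes h times the
    symbol of u vanish, and the coefficient of h^1 there is [k u]. *)
Let symbol : exists k : W -> S,
  [/\ forall c u v, k (c%:P *: u + v) = c *: k u + k v,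
      forall u v, k (u + 'X *: v) = k u,
      forall u, 'X *: u = 0 -> k u = 0 &
      forall l, k (foldr (fun a v => hmode (hconst a) (-1) v) hvac l) = symprod l].
Proof.
have [sigma [sL s0 sM]] := assoc_model_symbol (hpoly S) hRP natU WM.
have sLp := sL (@prodh C R).
exists (fun w => sigma w (@prodh C R) 0%N); split.
- by move=> c u v; rewrite sLp hpolyDE hscaleC.
- by move=> u v; rewrite (linD sLp) (linZ sLp) hpolyDE hscaleX addr0.
- move=> u u0; have : ('X *: sigma u (@prodh C R)) 1%N = 0.
    by rewrite -(linZ sLp) u0 (lin0 sLp).
  by rewrite hscaleX.
- move=> l.
  have [z] := symbol_leading hRP natU hprd_divisible s0 sM (map (@hconst C R) l)
    (prodh_symlin R).
  rewrite prodh_const foldr_map => ->.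
  by rewrite hpolyDE hscaleX addr0 hconstE.
Qed.

(** The monomial a_1 ... a_l lifts to a_1(-1) ... a_l(-1) 1, whose image under [k] is the monomial
    itself; sums and scalar multiples follow. *)
Let symbol_section (k : W -> S) s :
  (forall c u v, k (c%:P *: u + v) = c *: k u + k v) ->
  (forall l, k (foldr (fun a v => hmode (hconst a) (-1) v) hvac l) = symprod l) ->
  exists w, cl w = g s /\ k w = s.
Proof.
move=> kL kp; elim/sym_ind: s => [l|u v [w [Hw Kw]] [w' [Hw' Kw']]|c u [w [Hw Kw]]].
- exists (foldr (fun a v => hmode (hconst a) (-1) v) hvac l); split=> //.
  elim: l => [|a l IH] /=; first by rewrite symmap1.
  by rewrite -memb_class IH symmap_gen.
- exists (w + w'); rewrite hclassD Hw Hw' (linD symmap_linear); split=> //.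
  by rewrite -[w]scale1r -[1]/(1%:P) kL scale1r Kw Kw'.
- exists (c%:P *: w + 0); rewrite addr0 hclassZ Hw (linZ symmap_linear); split=> //.
  have k0 : k 0 = 0.
    have := kL (-1) w w; rewrite polyCN scaleN1r addNr => ->.
    by rewrite scaleN1r addNr.
  by rewrite -[_ *: w]addr0 kL Kw k0 addr0.
Qed.

(** Lifts of s and t with the same class differ by an element of hW, which [k] does not see. *)
Lemma symmap_inj : injective g.
Proof.
move=> s t gst; have [k [kL kX _ kp]] := symbol.
have [w [Hw Kw]] := symbol_section s kL kp.
have [w' [Hw' Kw']] := symbol_section t kL kp.
have [|z Ez] := @hclass_eq _ _ 'X w w'; first by rewrite Hw Hw' gst.
by rewrite -Kw -Kw' Ez kX.
Qed.

(* The symbol kills h-torsion, since S(R)[h] has none, and modulo h it is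
   inverse to symmap. *)
Theorem model_torsion : torsion_in_h W.
Proof.
move=> w w0; have [k [kL kX k0 kp]] := symbol.
have [s Hs] := symmap_surj (cl w).
have [w' [Hw' Kw']] := symbol_section s kL kp.
have [|z Ez] := @hclass_eq _ _ 'X w w'; first by rewrite Hw' Hs.
apply: hclass_eq0; rewrite -Hs -Kw' -(kX w' z) -Ez k0 //.
exact: lin0 symmap_linear.
Qed.

Lemma symmap_bij : bijective g.
Proof.
have /choice[g' gK] := symmap_surj.
by exists g' => // s; apply: symmap_inj; rewrite gK.
Qed.

(** * The vertex Poisson structure on the quotient by h *)

Local Notation P := (quot_vp Yh hvac).
Local Notation T x := (vp_del P x).

Let vp_delE x : T x = qY x (-2) (cl hvac).
Proof. by rewrite -{2}(hclass_repr x) (quotY_class _ hVA). Qed.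

Let vp_delL : linear (vp_del P).
Proof. by move=> k x y; rewrite !vp_delE qLl. Qed.

(** Changing representatives by elements of hW changes u_n v by h times products that are themselves
    divisible by h, hence its quotient by h by an element of hW. Two quotients of one element differ
    by h-torsion, again in hW. *)
Lemma quot_prd_class n u v d : 'X *: d = Yh u n%:Z v ->
  vp_prd P n (cl u) (cl v) = cl d.
Proof.
move=> Hd; rewrite /=.
have [v1 ->] := hclass_eq (hclass_repr (cl v)).
have [u1 ->] := hclass_eq (hclass_repr (cl u)).
have [e1 He1] := Yh_divisible u n v1.
have [e2 He2] := Yh_divisible u1 n (v + 'X *: v1).
have E : Yh (u + 'X *: u1) n (v + 'X *: v1) = 'X *: (d + 'X *: (e1 + e2)).
  rewrite (linD (YLl _ _)) (linZ (YLl _ _)) -He2 (linD (YLr _ _)) (linZ (YLr _ _)).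
  by rewrite -He1 -Hd !scalerDr addrA.
have hd : 'X *: hdiv (Yh (u + 'X *: u1) n (v + 'X *: v1)) =
    'X *: (d + 'X *: (e1 + e2)).
  rewrite -E; apply: (@xgetPex _ 0 [set w | 'X *: w = Yh (u + 'X *: u1) n (v + 'X *: v1)]).
  by exists (d + 'X *: (e1 + e2)).
have [|z Ez] := model_torsion (w := hdiv (Yh (u + 'X *: u1) n (v + 'X *: v1)) -
    (d + 'X *: (e1 + e2))).
  by rewrite scalerBr hd subrr.
move/(canRL (subrK _)): Ez => ->.
by rewrite !hclassD !hclass_mul add0r addr0.
Qed.

Let classE x : exists u, x = cl u.
Proof. by exists (repr x); rewrite hclass_repr. Qed.

Let vp_prdLr n x : linear (vp_prd P n x).
Proof.
move=> k y y'; have [v ->] := classE y; have [v' ->] := classE y'.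
have [u ->] := classE x.
have [d Hd] := Yh_divisible u n v; have [d' Hd'] := Yh_divisible u n v'.
rewrite -hclassZ -hclassD (quot_prd_class Hd) (quot_prd_class Hd').
rewrite (@quot_prd_class _ _ _ (k%:P *: d + d')) ?hclassD ?hclassZ //.
by rewrite YLr scalerDr scaleCA Hd Hd'.
Qed.

Lemma quot_prd_vac n x : vp_prd P n x (cl hvac) = 0.
Proof.
have [u ->] := classE x; rewrite (@quot_prd_class _ _ _ 0) //.
by rewrite va_creation // scaler0.
Qed.

(** Divide by h the commutator formula for u_n and v_(-1). The terms (u_i v)_(n-1-i) w with i < n
    have a nonnegative mode and still vanish modulo h after the division; i = n gives (u_n v)_(-1)
    w. *)
Lemma quot_prdM n x y z : vp_prd P n x (qY y (-1) z) =
  qY (vp_prd P n x y) (-1) z + qY y (-1) (vp_prd P n x z).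
Proof.
have [u ->] := classE x; have [v ->] := classE y; have [w ->] := classE z.
have /choice[e He] : forall i : nat, exists d, 'X *: d = Yh u i v.
  by move=> i; apply: Yh_divisible.
have [d Hd] := Yh_divisible u n w.
rewrite (quot_prd_class (He n)) (quot_prd_class Hd) (quotY_class _ hVA).
rewrite (@quot_prd_class _ _ _ (\sum_(i < n.+1) Yh (e i) (n%:Z - 1 - i%:Z) w *~ binz n i
   + Yh v (-1) d)).
  rewrite hclassD -(quotY_class _ hVA v); congr (_ + _).
  rewrite (big_morph _ (hclassD (W:=W) 'X) (hclass0 W 'X)) big_ord_recr /= big1 ?add0r.
    rewrite binn mulr1z (quotY_class _ hVA); congr (cl (Yh _ _ _)); lia.
  move=> i _; rewrite hclassMz -(quotY_class _ hVA).
  rewrite (_ : n%:Z - 1 - i%:Z = (n - i.+1)%N); last by have := ltn_ord i; lia.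
  by rewrite qN mul0rz.
have := va_commutator hVA u v w n (-1); rewrite (fsum_nat (N := n.+1)); last first.
  by move=> i ni; rewrite binz_small // mulr0z.
move=> /(canRL (subrK _)) ->; rewrite scalerDr scaler_sumr; congr (_ + _).
  by apply: eq_bigr => i _; rewrite -scalerMzr -(linZ (YLl _ _)) He.
by rewrite -(linZ (YLr _ _)) Hd.
Qed.

(** This is [va_skew] divided by h, with the divided powers of the derivation in the form given by
    [va_iter_creation]. *)
Lemma quot_prd_skew n x y : vp_prd P n x y = \sum_(i \in [set: nat])
  ((-1) ^+ (n + i + 1) * (i`!%:R)^-1 : C) *: iter i (vp_del P) (vp_prd P (n + i)%N y x).
Proof.
have [u ->] := classE x; have [v ->] := classE y.
have [N HN] := va_fin hVA v n u.
(* From N on the quotient by h is chosen to be 0, so that the sums truncate. *)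
have /choice[e He] : forall i : nat, exists d, 'X *: d = Yh v (n + i)%N u /\
    ((N <= i)%N -> d = 0).
  move=> i; have [Ni|iN] := leqP N i.
    by exists 0; split=> //; rewrite PoszD HN // scaler0.
  by have [d Hd] := Yh_divisible v (n + i)%N u; exists d.
have eE i : vp_prd P (n + i) (cl v) (cl u) = cl (e i).
  by apply: quot_prd_class; case: (He i).
have iterE i x' : iter i (vp_del P) x' = i`!%:R *: qY x' (-1 - i%:Z) (cl hvac).
  rewrite -(va_iter_creation QVA); elim: i => // i IH.
  by rewrite !iterS IH vp_delE.
rewrite (fsum_nat (N := N)) => [|i Ni]; last first.
  by rewrite eE (proj2 (He i)) // iterE (lin0 (qLl _ _)) !scaler0.
rewrite (@quot_prd_class _ _ _ (\sum_(i < N) Yh (e i) (-1 - i%:Z) hvac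
    *~ (- (-1) ^ n%:Z * (-1) ^+ i))).
  rewrite (big_morph _ (hclassD (W:=W) 'X) (hclass0 W 'X)); apply: eq_bigr => i _.
  rewrite eE iterE scalerA -mulrA mulVr ?fact_unit // mulr1 (quotY_class _ hVA).
  rewrite hclassMz (_ : (-1) ^+ (n + i + 1) = ((-1) ^+ (n + i + 1))%:~R).
    by rewrite scaler_int; congr (_ *~ _); rewrite !exprD -exprnP; ring.
  by rewrite rmorphXn rmorphN1.
rewrite (va_skew hVA v u n) (fsum_nat (N := N)) => [|i Ni]; last first.
  by rewrite HN // (lin0 (YLl _ _)) mul0rz.
rewrite scaler_sumr; apply: eq_bigr => i _.
by rewrite -scalerMzr -(linZ (YLl _ _)) (proj1 (He i)) PoszD.
Qed.

(** In the commutator of a(n) and b(-1) on the vacuum, i < n leaves a nonnegative mode and i > n a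
    zero binomial coefficient. The term i = n is (h a_n b)(-1) 1. *)
Lemma quot_prd_emb n a b : vp_prd P n (memb a) (memb b) = memb (prd n a b).
Proof.
apply: quot_prd_class; rewrite Yhmode.
have := am_comm WM (hconst a) n (hconst b) (-1) hvac.
rewrite (am_vac WM) (lin0 (am_linear WM _ _)) subr0 => ->.
rewrite (fsum_nat1 (k := n)) => [|i]; last first.
  rewrite neq_ltn => /orP[ni|ni]; last by rewrite binz_small // mulr0z.
  rewrite (_ : n%:Z + -1 - i%:Z = (n - i.+1)%N); last by lia.
  by rewrite (am_vac WM) mul0rz.
rewrite (hprd_const RP) (linZ (am_linearl WM _ _)) /= binn mulr1z.
by rewrite (_ : n%:Z + -1 - n%:Z = -1) //; lia.
Qed.

Variable SP : vpData S.
Hypothesis SPP : sym_structure del prd SP.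

Let SV := sym_vp SPP.
Let SL := vp_lie SV.

Let vp_mulE s t : vp_mul SP s t = s * t.
Proof. by rewrite (sym_mul SPP). Qed.

Let symmap_del s : g (vp_del SP s) = vp_del P (g s).
Proof.
have dL := vl_del_linear SL.
have d1 : vp_del SP 1 = 0.
  apply: (addrI (vp_del SP 1)); rewrite addr0 -[in RHS](mulr1 1) -vp_mulE (vp_delM SV).
  by rewrite !vp_mulE mulr1 mul1r.
elim/sym_ind: s => [l|u v Hu Hv|k u Hu].
- elim: l => [|a l IH]; rewrite [symprod _]/=.
    rewrite d1 (lin0 symmap_linear) symmap1 vp_delE.
    by rewrite (va_vacuum QVA).
  rewrite -vp_mulE (vp_delM SV) (sym_del SPP) !vp_mulE (linD symmap_linear).
  rewrite !symmapM !symmap_emb IH !vp_delE (comm_delM QVA quot_commutative).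
  congr (qY _ _ _ + _); rewrite memb_class; congr cl.
  (* This is (del a)(-1) = a(-2): the two signs cancel. *)
  rewrite -(hext_const (vl_del_linear RP)) (am_del WM) mulNrz -mulrNz.
  by rewrite opprK mulr1z.
- by rewrite (linD dL) (linD symmap_linear) Hu Hv (linD symmap_linear) (linD vp_delL).
- by rewrite (linZ dL) (linZ symmap_linear) Hu (linZ symmap_linear) (linZ vp_delL).
Qed.

(** On both sides the product with a fixed first argument is a derivation, and derivations are
    determined by their values on generators. *)
Let symmap_prd_der n s0 : (forall a, g (vp_prd SP n s0 (symgen a)) =
    vp_prd P n (g s0) (memb a)) ->
  forall s, g (vp_prd SP n s0 s) = vp_prd P n (g s0) (g s).
Proof.
move=> H0; have pL := vl_linearr SL n s0.
have p1 : vp_prd SP n s0 1 = 0.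
  apply: (addrI (vp_prd SP n s0 1)); rewrite addr0 -[in RHS](mulr1 1) -vp_mulE.
  by rewrite (vp_prdM SV) !vp_mulE mulr1 mul1r.
elim/sym_ind => [l|u v Hu Hv|k u Hu].
- elim: l => [|a l IH]; rewrite [symprod _]/=.
    by rewrite p1 (lin0 symmap_linear) symmap1 quot_prd_vac.
  rewrite -vp_mulE (vp_prdM SV) !vp_mulE (linD symmap_linear) !symmapM H0 IH.
  by rewrite symmap_emb quot_prdM.
- by rewrite (linD pL) !(linD symmap_linear) Hu Hv (linD (vp_prdLr _ _)).
- by rewrite (linZ pL) !(linZ symmap_linear) Hu (linZ (vp_prdLr _ _)).
Qed.

(* Both products are derivations in the second argument; skew-symmetry carries
   this over to the first one. *)
Let symmap_prd n s t : g (vp_prd SP n s t) = vp_prd P n (g s) (g t).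
Proof.
move: t; apply: symmap_prd_der => a.
have gens m b : g (vp_prd SP m (symgen b) s) = vp_prd P m (memb b) (g s).
  rewrite -symmap_emb; apply: symmap_prd_der => c.
  by rewrite (sym_prd SPP) !symmap_emb quot_prd_emb.
have iterL i : linear (iter i (vp_del SP)).
  by elim: i => // i IH x y z; rewrite !iterS IH (vl_del_linear SL).
have g_iter i x : g (iter i (vp_del SP) x) = iter i (vp_del P) (g x).
  by elim: i => // i IH; rewrite !iterS symmap_del IH.
rewrite (vl_C2 SL) quot_prd_skew (lin_fsum symmap_linear); last first.
  have [N H] := vl_C0 SL (symgen a) s; exists N => i Ni.
  rewrite H ?(lin0 (iterL i)) ?scaler0 //.
  by apply: leq_trans Ni _; rewrite leq_addl.
apply: eq_fsbigr => i _.
by rewrite (linZ symmap_linear) g_iter gens.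
Qed.

Theorem vp_iso_at0 : exists! f : S -> Q,
  vp_iso SP P f /\ (forall a, f (symgen a) = memb a).
Proof.
exists g; split.
  split; last exact: symmap_emb.
  split.
  - exact: symmap_linear.
  - exact: symmap_bij.
  - by rewrite (sym_one SPP) symmap1.
  - by move=> s t; rewrite vp_mulE symmapM /= -(quotY_class _ hVA) !hclass_repr.
  - exact: symmap_del.
  - exact: symmap_prd.
move=> f [[fL _ f1 fM _ _] femb]; apply: funext; elim/sym_ind => [l|u v Hu Hv|k u Hu].
- elim: l => [|a l IH] /=; first by rewrite symmap1 -(sym_one SPP) f1.
  rewrite symmap_gen IH -vp_mulE fM femb /=.
  by rewrite -(quotY_class _ hVA) !hclass_repr.
- by rewrite (linD fL) (linD symmap_linear) Hu Hv.
- by rewrite (linZ fL) (linZ symmap_linear) Hu.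
Qed.

End AtZero.

Theorem theorem5p11 (F : realType) (R : lmodType F[i])
    (del : R -> R) (prd : nat -> R -> R -> R)
    (RP : vertex_lie del prd)
    (YV : assocV del prd -> int -> assocV del prd -> assocV del prd)
    (YVP : assoc_structure YV)
    (Yh : assocVh del prd -> int -> assocVh del prd -> assocVh del prd)
    (YhP : assoc_structure Yh)
    (SP : vpData (sym R))
    (SPP : sym_structure del prd SP) :
  [/\ exists! f : assocV del prd -> hquot (assocVh del prd) ('X - 1),
        va_iso YV (assoc_vac del prd)
          (@quotY _ _ Yh ('X - 1)) (hclass ('X - 1) (assoch_vac del prd)) f
        /\ (forall a, f (assoc_emb del prd a)
                      = hclass ('X - 1) (assoch_emb del prd a)),
      va_commutative (@quotY _ _ Yh 'X),
      torsion_in_h (assocVh del prd) &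
      exists! g : sym R -> hquot (assocVh del prd) 'X,
        vp_iso SP (quot_vp Yh (assoch_vac del prd)) g
        /\ (forall a, g (symgen a) = hclass 'X (assoch_emb del prd a))].
Proof.
have natC n : n.+1%:R \is a @GRing.unit F[i] by rewrite unitfE pnatr_eq0.
have WM := assocVh_model RP natC.
have hVA := assoc_va YhP.
have hY := assoc_Y YhP.
split.
- exact: (va_iso_at1 natC RP (assocV_model RP natC) (assoc_va YVP) (assoc_Y YVP)
    WM hVA hY).
- exact: (quot_commutative natC RP WM hVA hY).
- exact: (model_torsion natC RP WM hVA hY).
- exact: (vp_iso_at0 natC RP WM hVA hY SPP).
Qed.
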